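(* Let $p\in(0,1)$ be fixed, and let $k=k_n$, $\varepsilon=\varepsilon_n$ satisfy $k/n\le1-\log(1+3p)$ and $(\varepsilon/n)^{1-\frac kn}=o(1/n)$. Then for all sufficiently large $n$ the expected Choi error of the random codes formed by $\mathfrak C_n^\varepsilon$ against the strength-$p$ i.i.d. erasure error satisfies $$\mathbb E_{U\sim\mathfrak C_n^\varepsilon}\epsilon_{\mathrm{Choi}}\le\left(2^{-n(1-\log(1+3p)-\frac kn)}+\frac{4\varepsilon^{1-\frac kn}n^{\frac kn}}{\log(n/\varepsilon)}\right)^{\frac14}.$$ That is, 1D $O(\log n)$-depth double-layer blocked circuits can achieve the encoding rate $1-\log(1+3p)$ for strength-$p$ erasure error: for every constant $0<R<1-\log(1+3p)$ one can choose parameters with $k/n\to R$, circuit depth $O(\log n)$, and expected Choi error tending to $0$.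
   Context: All logarithms are base 2. Double-layer blocked ensemble $\mathfrak C_n^\varepsilon$: $n$ qubits on a line are divided into $2N$ consecutive regions of $\xi=n/2N$ qubits each, with $\xi=\log(n/\varepsilon)$. $U=U_2U_1$ with $U_1=\bigotimes_{i=1}^NU_C^{2i-1,2i}$, $U_2=\bigotimes_{i=1}^{N-1}U_C^{2i,2i+1}$, where the $U_C^{j,j+1}$ are independent uniformly random Clifford unitaries on the $2\xi$ qubits of regions $j,j+1$. Such a Clifford is implementable in 1D depth $O(\xi)$, so the circuit depth is $O(\log(n/\varepsilon))$. Each region contains $\frac kn\xi$ logical qubits and $\frac{n-k}n\xi$ ancillas in $|0\rangle$. Parameters are such that all these numbers are integers. Choi error: $L$ is the $k$-qubit logical system, $S$ the $n$-qubit physical system, $R$ a $k$-qubit reference, $\hat\phi_{LR}$ the maximally entangled state, $\mathcal E(\rho)=U(\rho\otimes|0^{n-k}\rangle\langle0^{n-k}|)U^\dagger$. For a noise channel $\mathcal N$ on $S$, $\epsilon_{\mathrm{Choi}}=\min_{\mathcal D}P(\hat\phi_{LR},[(\mathcal D\circ\mathcal N\circ\mathcal E)_L\otimes I_R](\hat\phi_{LR}))$ over quantum channels $\mathcal D$ to $L$, with $P=\sqrt{1-F^2}$, $F(\rho,\sigma)=\Vert\sqrt\rho\sqrt\sigma\Vert_1$. Strength-$p$ i.i.d. erasure: $\mathcal N=\mathcal N_e^{\otimes n}$, $\mathcal N_e(\rho)=(1-p)\rho+p|2\rangle\langle2|$ with $|2\rangle$ orthogonal to the qubit space. *)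

(* Defs.v *)
From HB Require Import structures.
From mathcomp Require Import all_boot all_order all_algebra.
From mathcomp Require Import all_classical all_reals all_analysis.
From mathcomp Require Import complex.

Set Implicit Arguments.
Unset Strict Implicit.
Unset Printing Implicit Defensive.

Import Order.TTheory GRing.Theory Num.Theory.
Import numFieldNormedType.Exports.

Local Open Scope classical_set_scope.
Local Open Scope ring_scope.
Local Open Scope sesquilinear_scope.

Lemma imag_exp_inj (F : numClosedFieldType) (c c' : 'I_4) :
  'i ^+ c = 'i ^+ c' :> F -> c = c'.
Proof.
have exp1 d : (d < 4)%N -> 'i ^+ d = 1 :> F -> d = 0%N.
  have n2 : (2%:R : F) != 0 by rewrite pnatr_eq0.
  have o_nN : (-1 : F) == 1 = false.
    by rewrite eq_sym -addr_eq0; exact/negbTE.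
  move=> lt_d4 id1; have : ('i ^+ 2) ^+ d = 1 :> F.
    by rewrite exprAC id1 expr1n.
  rewrite sqrCi; case: d lt_d4 id1 => [|[|[|[|//]]]] // _ id1 /eqP.
  - by rewrite expr1 o_nN.
  - by move: id1; rewrite sqrCi => /eqP; rewrite o_nN.
  - by rewrite -signr_odd expr1 o_nN.
move=> eq_i; apply/val_inj => /=.
wlog le_cc : c c' eq_i / (c <= c')%N.
  by move=> ih; case/orP: (leq_total c c') => [|/ih->]; first exact: ih.
have := exp1 (c' - c)%N (leq_ltn_trans (leq_subr _ _) (ltn_ord c')).
have /mulfI : 'i ^+ c != 0 :> F by rewrite expf_neq0 // neq0Ci.
move=> injM; move=> H; apply/eqP; rewrite eqn_leq le_cc -subn_eq0; apply/eqP/H.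
by apply: injM; rewrite -exprD subnKC // mulr1.
Qed.

Lemma unitary_conj_comm (F : numClosedFieldType) d (U V P : 'M[F]_d) :
  U \is unitarymx -> V \is unitarymx ->
  U *m P *m U ^t* = V *m P *m V ^t* ->
  V ^t* *m U *m P = P *m (V ^t* *m U).
Proof.
move=> /unitarymxP uU /unitarymxP uV E.
transitivity (V ^t* *m (U *m P *m U ^t*) *m U).
  by rewrite -!mulmxA (mulmx1C uU) mulmx1.
by rewrite E !mulmxA (mulmx1C uV) mul1mx.
Qed.

Lemma unitary_scalar_phase (F : numClosedFieldType) d (i : 'I_d) (U V : 'M[F]_d) c :
  U \is unitarymx -> V \is unitarymx ->
  V ^t* *m U = c%:M -> `|c| = 1 /\ U = c *: V.
Proof.
move=> /unitarymxP uU /unitarymxP uV E.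
have UE : U = c *: V by rewrite -mul_mx_scalar -E mulmxA uV mul1mx.
split=> //; move: uU; rewrite UE.
have -> : (c *: V) ^t* = c^* *: V ^t* by rewrite linearZ map_mxZ.
rewrite -scalemxAl -scalemxAr uV => /matrixP/(_ i i).
rewrite !mxE eqxx mulr1 -normCK => /eqP.
by rewrite sqrp_eq1 // => /eqP.
Qed.

Lemma phase_conj (F : numClosedFieldType) d (V P : 'M[F]_d) c :
  `|c| = 1 -> (c *: V) *m P *m (c *: V) ^t* = V *m P *m V ^t*.
Proof.
move=> c1; have -> : (c *: V) ^t* = c^* *: V ^t* by rewrite linearZ map_mxZ.
by rewrite -!scalemxAl -scalemxAr scalerA -normCK c1 expr1n scale1r.
Qed.

Section Operators.
Variable R : realType.
Local Notation C := (complex R).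

(** A finite type [A] labels the computational basis of the Hilbert space
    C^A, so that product types label composite systems. *)
Definition op (A B : finType) : Type := 'M[C]_(#|A|, #|B|).
Definition mkop (A B : finType) (f : A -> B -> C) : op A B :=
  \matrix_(i, j) f (enum_val i) (enum_val j).
Definition ent (A B : finType) (M : op A B) (a : A) (b : B) : C :=
  M (enum_rank a) (enum_rank b).

Definition psd (A : finType) (M : op A A) : Prop :=
  M ^t* = M /\ forall v : 'cV[C]_#|A|, 0 <= \tr (v ^t* *m M *m v).

(** [Phi (x) id_T]: apply [Phi] to each of the [T x T] blocks. *)
Definition ampl (A B T : finType) (Phi : op A A -> op B B)
    (X : op (A * T)%type (A * T)%type) : op (B * T)%type (B * T)%type :=
  mkop (fun x y : B * T =>
    ent (Phi (mkop (fun a a' => ent X (a, x.2) (a', y.2)))) x.1 y.1).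

Definition quantum_channel (A B : finType) (Phi : op A A -> op B B) : Prop :=
  [/\ forall (c : C) (X Y : op A A), Phi (c *: X + Y) = c *: Phi X + Phi Y,
      forall X : op A A, \tr (Phi X) = \tr X
    & forall (r : nat) (X : op (A * 'I_r)%type (A * 'I_r)%type),
        psd X -> psd (ampl Phi X)].

(** The positive semidefinite square root of a positive semidefinite matrix. *)
Definition sqrtmx (n : nat) (M : 'M[C]_n) : 'M[C]_n :=
  invmx (spectralmx M) *m diag_mx (map_mx sqrtC (spectral_diag M))
    *m spectralmx M.

Definition trace_norm (n : nat) (M : 'M[C]_n) : R :=
  complex.Re (\tr (sqrtmx (M ^t* *m M))).

Definition fidelity (A : finType) (rho sigma : op A A) : R :=
  trace_norm (sqrtmx rho *m sqrtmx sigma).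

Definition purified_distance (A : finType) (rho sigma : op A A) : R :=
  Num.sqrt (1 - fidelity rho sigma ^+ 2).

Definition max_entangled (A : finType) : op (A * A)%type (A * A)%type :=
  mkop (fun x y : A * A => ((x.1 == x.2) && (y.1 == y.2))%:R / #|A|%:R).

(** The infimum over decoders is attained, by compactness of the set of
    channels between two fixed finite-dimensional systems. *)
Definition choi_error (L S S' : finType)
    (E : op L L -> op S S) (noise : op S S -> op S' S') : R :=
  inf [set e | exists2 D : op S' S' -> op L L, quantum_channel D &
    e = purified_distance (max_entangled L)
          (ampl (fun X => D (noise (E X))) (max_entangled L))].

(** [Phi^{(x) n}], on the matrix units of the n-fold tensor power. *)
Definition tensor_power (n : nat) (A B : finType) (Phi : op A A -> op B B)
    (X : op {ffun 'I_n -> A} {ffun 'I_n -> A}) :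
    op {ffun 'I_n -> B} {ffun 'I_n -> B} :=
  mkop (fun x y : {ffun 'I_n -> B} =>
    \sum_(u : {ffun 'I_n -> A}) \sum_(v : {ffun 'I_n -> A})
      ent X u v *
      \prod_(i < n)
        ent (Phi (mkop (fun a a' => ((a == u i) && (a' == v i))%:R))) (x i) (y i)).

(** [None] is the erasure flag |2>; [Some b] is the qubit basis state |b>.
    The factor [\tr rho] is the linear extension to unnormalised operators. *)
Definition erasure (p : R) (rho : op bool bool) :
    op (option bool) (option bool) :=
  mkop (fun a b => match a, b with
    | Some a', Some b' => (1 - p)%:C%C * ent rho a' b'
    | None, None => p%:C%C * \tr rho
    | _, _ => 0
    end).

Definition bits (n : nat) : finType := {ffun 'I_n -> bool}.

Definition window (n o m : nat) (x : bits n) : bits m :=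
  [ffun q : 'I_m => if insub (o + q)%N is Some i then x i else false].

(** The m-qubit operator [U] on qubits o, ..., o + m - 1 of an n-qubit line,
    tensored with the identity on the others; meant for [o + m <= n]. *)
Definition embed (n o m : nat) (U : op (bits m) (bits m)) :
    op (bits n) (bits n) :=
  mkop (fun x y : bits n =>
    ent U (window o m x) (window o m y) *
    [forall q : 'I_n, ~~ (o <= q < o + m)%N ==> (x q == y q)]%:R).

(** One layer of nearest-neighbour two-qubit gates with disjoint supports; the
    gate labelled by [i] acts on qubits [i] and [i + 1]. *)
Definition gate_layer (n : nat) (V : op (bits n) (bits n)) : Prop :=
  exists (A : {set 'I_n}) (G : 'I_n -> op (bits 2) (bits 2)),
    [/\ forall i : 'I_n, i \in A -> (i.+1 < n)%N,
        forall i j : 'I_n, i \in A -> j \in A -> j <> i.+1 :> nat,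
        forall i : 'I_n, G i \is unitarymx
      & V = \prod_(i in A) embed n i (G i)].

Definition depth_at_most (n d : nat) (U : op (bits n) (bits n)) : Prop :=
  exists2 V : 'I_d -> op (bits n) (bits n),
    forall t, gate_layer (V t) & U = \prod_t V t.

(** The label (x, z) stands for i^(x z) X^x Z^z, i.e. (0, 0), (1, 0), (1, 1)
    and (0, 1) for I, X, Y and Z. *)
Definition pauli_label (m : nat) : finType := {ffun 'I_m -> bool * bool}.

Definition pauli1 (s : bool * bool) (b b' : bool) : C :=
  (b == b' (+) s.1)%:R * (-1) ^+ (s.2 && b') * 'i ^+ (s.1 && s.2).

Definition pauli (m : nat) (s : pauli_label m) : op (bits m) (bits m) :=
  mkop (fun x y : bits m => \prod_(q < m) pauli1 (s q) (x q) (y q)).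

Definition clifford (m : nat) (U : op (bits m) (bits m)) : Prop :=
  U \is unitarymx /\
  forall s : pauli_label m, exists (c : 'I_4) (s' : pauli_label m),
    U *m pauli s *m U ^t* = 'i ^+ c *: pauli s'.

(** The Clifford group modulo global phases is finite: a class is determined by
    how it conjugates the Pauli operators, see [clifford_class_unique]. The
    uniform distribution on Clifford unitaries is the uniform distribution on
    these classes. *)
Definition tableau (m : nat) : finType :=
  {ffun pauli_label m -> 'I_4 * pauli_label m}.

Definition has_tableau (m : nat) (U : op (bits m) (bits m)) (t : tableau m) :=
  U \is unitarymx /\
  forall s, U *m pauli s *m U ^t* = 'i ^+ (t s).1 *: pauli (t s).2.

Definition clifford_classes (m : nat) : {set tableau m} :=
  [set t : tableau m | `[< exists U, has_tableau U t >]]%SET.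

Definition clifford_of (m : nat) (t : tableau m) : op (bits m) (bits m) :=
  xget 1%:M [set U | has_tableau U t].

Lemma ent_mkop (A B : finType) (f : A -> B -> C) a b : ent (mkop f) a b = f a b.
Proof. by rewrite /ent /mkop mxE !enum_rankK. Qed.

Lemma op_ext (A B : finType) (M N : op A B) :
  (forall a b, ent M a b = ent N a b) -> M = N.
Proof.
by move=> eqMN; apply/matrixP => i j;
   have := eqMN (enum_val i) (enum_val j); rewrite /ent !enum_valK.
Qed.

Lemma ent_mul (A B D : finType) (M : op A B) (N : op B D) a d :
  ent (M *m N : op A D) a d = \sum_b ent M a b * ent N b d.
Proof.
rewrite /ent mxE (reindex enum_rank) //=.
by apply: onW_bij; apply: enum_rank_bij.
Qed.

Section Paulis.
Variable m : nat.
Implicit Types (s : pauli_label m) (x y a : bits m).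

Definition xpart s : bits m := [ffun q => (s q).1].
Definition zsign s y : C := \prod_(q < m) (-1) ^+ ((s q).2 && y q).
Definition iphase s : C := \prod_(q < m) 'i ^+ ((s q).1 && (s q).2).
Definition xorb a y : bits m := [ffun q => a q (+) y q].

Lemma ent_pauli s x y :
  ent (pauli s) x y = (x == xorb (xpart s) y)%:R * (zsign s y * iphase s).
Proof.
rewrite ent_mkop; transitivity (\prod_(q < m) ((x q == y q (+) (s q).1)%:R * ((-1) ^+ ((s q).2 && y q) * 'i ^+ ((s q).1 && (s q).2))) : C).
  by apply: eq_bigr => q _; rewrite /pauli1 mulrA.
rewrite 2!big_split /=; congr (_ * _); case: eqP => [->|neq_x].
  by rewrite big1 // => q _; rewrite !ffunE addbC eqxx.
have [q neq_q] : exists q, x q != y q (+) (s q).1.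
  apply/existsP; rewrite -negb_forall; apply/negP => /forallP eq_x.
  by apply: neq_x; apply/ffunP => q; rewrite !ffunE addbC; apply/eqP.
by rewrite (bigD1 q) //= (negPf neq_q) mul0r.
Qed.

Definition zflip (q : 'I_m) : pauli_label m := [ffun j => (false, j == q)].
Definition xflip a : pauli_label m := [ffun j => (a j, false)].

Lemma ent_zflip q x y :
  ent (pauli (zflip q)) x y = (x == y)%:R * (-1) ^+ (y q).
Proof.
rewrite ent_pauli; congr (_%:R * _).
  by congr (_ == _); apply/ffunP => j; rewrite !ffunE.
rewrite /zsign /iphase [X in _ * X]big1 ?mulr1; last by move=> j; rewrite ffunE.
rewrite (bigD1 q) //= big1 ?mulr1 ?ffunE ?eqxx //= => j neq_jq.
by rewrite ffunE /= (negPf neq_jq).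
Qed.

Lemma ent_xflip a x y : ent (pauli (xflip a)) x y = (x == xorb a y)%:R.
Proof.
rewrite ent_pauli /zsign /iphase !big1 ?mulr1 //.
- by congr (_ == _)%:R; apply/ffunP => j; rewrite !ffunE.
- by move=> j; rewrite ffunE andbF.
- by move=> j; rewrite ffunE.
Qed.

Lemma xorbK a : involutive (xorb a).
Proof. by move=> y; apply/ffunP => q; rewrite !ffunE addbA addbb. Qed.

Lemma pauli_commutant (W : op (bits m) (bits m)) :
  (forall s, W *m pauli s = pauli s *m W) -> exists c, W = c%:M.
Proof.
move=> comW; pose x0 : bits m := [ffun=> false]; exists (ent W x0 x0).
have entC s x y := congr1 (fun M : op (bits m) (bits m) => ent M x y) (comW s).
have diagW x y : x != y -> ent W x y = 0.
  move=> neq_xy; have [q neq_q] : exists q, x q != y q.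
    apply/existsP; rewrite -negb_forall; apply: contra neq_xy => /forallP eq_xy.
    by apply/eqP/ffunP => q; apply/eqP.
  have := entC (zflip q) x y; rewrite !ent_mul.
  rewrite (bigD1 y) //= big1 => [|b neq_b]; last first.
    by rewrite ent_zflip (negPf neq_b) mul0r mulr0.
  rewrite addr0 (bigD1 x) //= big1 => [|b neq_b]; last first.
    by rewrite ent_zflip eq_sym (negPf neq_b) !mul0r.
  rewrite addr0 !ent_zflip !eqxx !mul1r.
  case: (x q) (y q) neq_q => [] [] // _;
    rewrite expr1 expr0 ?mulr1 ?mulrN1 ?mulN1r ?mul1r => /eqP;
    by rewrite ?[- _ == _]eq_sym -addr_eq0 -mulr2n mulrn_eq0 => /eqP.
have constW a : ent W a a = ent W x0 x0.
  have := entC (xflip a) a x0; rewrite !ent_mul.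
  have ax0 : a = xorb a x0 by apply/ffunP => q; rewrite !ffunE addbF.
  rewrite (bigD1 a) //= big1 => [|b neq_b]; last first.
    by rewrite ent_xflip -ax0 (negPf neq_b) mulr0.
  rewrite addr0 (bigD1 x0) //= big1 => [|b neq_b]; last first.
    by rewrite diagW // mulr0.
  by rewrite !ent_xflip -ax0 eqxx mulr1 mul1r addr0.
apply: op_ext => x y; rewrite [RHS]/ent mxE (inj_eq enum_rank_inj).
by case: eqP => [->|/eqP neq_xy]; rewrite ?constW ?mulr1n // diagW.
Qed.

Lemma pauli_phase_inj (c c' : 'I_4) s s' :
  'i ^+ c *: pauli s = 'i ^+ c' *: pauli s' -> c = c' /\ s = s'.
Proof.
have i_neq0 : 'i != 0 :> C by exact: neq0Ci.
move=> eqPP; have entE x y :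
    'i ^+ c * ent (pauli s) x y = 'i ^+ c' * ent (pauli s') x y.
  by have := congr1 (fun M : op (bits m) (bits m) => ent M x y) eqPP;
     rewrite /ent !mxE.
have z_neq0 t y : zsign t y != 0 by apply/prodf_neq0 => q _; rewrite signr_eq0.
have p_neq0 t : iphase t != 0 by apply/prodf_neq0 => q _; rewrite expf_neq0.
have eqx : xpart s = xpart s'.
  pose x0 : bits m := [ffun=> false].
  have x0E a : xorb a x0 = a by apply/ffunP => q; rewrite !ffunE addbF.
  have := entE (xpart s) x0; rewrite !ent_pauli !x0E eqxx mul1r.
  case: (xpart s =P xpart s') => // _; rewrite mulr0n mul0r mulr0 => /eqP.
  by rewrite !mulf_eq0 expf_eq0 (negPf i_neq0) (negPf (z_neq0 _ _)) (negPf (p_neq0 _)) andbF.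
have valE y : 'i ^+ c * (zsign s y * iphase s) = 'i ^+ c' * (zsign s' y * iphase s').
  by have := entE (xorb (xpart s) y) y; rewrite !ent_pauli -eqx eqxx !mul1r.
pose x0 : bits m := [ffun=> false].
have z0 t : zsign t x0 = 1 by apply: big1 => q _; rewrite ffunE andbF.
have val0 : 'i ^+ c * iphase s = 'i ^+ c' * iphase s'.
  by have := valE x0; rewrite !z0 !mul1r.
have eqz q : (s q).2 = (s' q).2.
  pose e : bits m := [ffun j => j == q].
  have ze t : zsign t e = (-1) ^+ (t q).2.
    rewrite /zsign (bigD1 q) //= big1 ?mulr1 ?ffunE ?eqxx ?andbT //.
    by move=> j neq_jq; rewrite ffunE (negPf neq_jq) andbF.
  have := valE e; rewrite !ze [LHS]mulrCA [RHS]mulrCA val0 => /mulIf sgn_eq.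
  have /eqP : (-1) ^+ (s q).2 = (-1) ^+ (s' q).2 :> C.
    by apply: sgn_eq; rewrite mulf_neq0 // expf_neq0.
  by move=> /eqP/signr_inj.
have eqs : s = s'.
  apply/ffunP => q; have := eqz q; have := congr1 (fun f : bits m => f q) eqx.
  by rewrite !ffunE; case: (s q) (s' q) => [? ?] [? ?] /= -> ->.
split=> //; apply: (@imag_exp_inj C); rewrite eqs in val0.
exact: (mulIf (p_neq0 s') val0).
Qed.

Lemma clifford_has_tableau (U : op (bits m) (bits m)) :
  clifford U <-> exists t, has_tableau U t.
Proof.
split=> [[uU cU]|[t [uU tU]]]; last first.
  by split=> // s; exists (t s).1, (t s).2.
have /choice[f fP] s : exists q : 'I_4 * pauli_label m,
    U *m pauli s *m U ^t* = 'i ^+ q.1 *: pauli q.2.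
  by have [c [s' E]] := cU s; exists (c, s').
by exists [ffun s => f s]; split=> // s; rewrite ffunE.
Qed.

Lemma has_tableau_inj (U : op (bits m) (bits m)) t t' :
  has_tableau U t -> has_tableau U t' -> t = t'.
Proof.
move=> [_ tU] [_ tU']; apply/ffunP => s.
have [] := @pauli_phase_inj (t s).1 (t' s).1 (t s).2 (t' s).2.
  by rewrite -tU -tU'.
by case: (t s) (t' s) => [? ?] [? ?] /= -> ->.
Qed.

Lemma has_tableau_phase (U V : op (bits m) (bits m)) t :
  has_tableau U t -> has_tableau V t -> exists2 c : C, `|c| = 1 & U = c *: V.
Proof.
move=> [uU tU] [uV tV].
have [s|c Wc] := @pauli_commutant (V ^t* *m U).
  apply: (unitary_conj_comm uU uV).
  exact: (etrans (tU s) (esym (tV s))).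
have [] := unitary_scalar_phase (enum_rank ([ffun=> false] : bits m)) uU uV Wc.
by exists c.
Qed.

Lemma clifford_ofP (t : tableau m) :
  t \in clifford_classes m -> has_tableau (clifford_of t) t.
Proof.
rewrite inE => /asboolP[U Ut].
by have := @xgetPex _ 1%:M [set U | has_tableau U t] (ex_intro _ U Ut).
Qed.

Lemma clifford_class_unique (U : op (bits m) (bits m)) :
  clifford U ->
  exists! t : tableau m, t \in clifford_classes m /\
    exists2 c : C, `|c| = 1 & U = c *: clifford_of t.
Proof.
move=> /clifford_has_tableau[t Ut].
have t_in : t \in clifford_classes m by rewrite inE; apply/asboolP; exists U.
exists t; split=> [|t' [/clifford_ofP[_ t'P] [c c1 UE]]].
  by split=> //; apply: has_tableau_phase Ut (clifford_ofP t_in).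
apply: (has_tableau_inj Ut); split; first by case: Ut.
by move=> s; rewrite -t'P UE phase_conj.
Qed.

End Paulis.

Definition uniform_mean (T : finType) (A : {pred T}) (f : T -> R) : R :=
  (\sum_(t in A) f t) / #|A|%:R.

(** Regions 0, ..., 2N - 1 of [xi] consecutive qubits each; [G j] acts on
    regions j and j + 1, in the first layer for even j (there are N of them)
    and in the second layer for odd j (there are N - 1 of them). *)
Definition double_layer (n N xi : nat)
    (G : 'I_(N.*2).-1 -> op (bits xi.*2) (bits xi.*2)) : op (bits n) (bits n) :=
  (\prod_(j < (N.*2).-1 | odd j) embed n (j * xi) (G j)) *m
  (\prod_(j < (N.*2).-1 | ~~ odd j) embed n (j * xi) (G j)).

(** Expectation over independent uniformly random Cliffords [G j]. *)
Definition ensemble_mean (n N xi : nat) (f : op (bits n) (bits n) -> R) : R :=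
  uniform_mean (ffun_on (mem (clifford_classes xi.*2)))
    (fun t : {ffun 'I_(N.*2).-1 -> tableau xi.*2} =>
       f (double_layer n (fun j => clifford_of (t j)))).

(** The basis state of the line in which the first [kap] qubits of each region
    of [xi] qubits hold the logical qubits, in order, and the others are |0>. *)
Definition place (n k xi kap : nat) (y : bits k) : bits n :=
  [ffun q : 'I_n =>
     if (q %% xi < kap)%N then
       (if insub (q %/ xi * kap + q %% xi)%N is Some l then y l else false)
     else false].

Definition add_ancillas (n k xi : nat) : op (bits n) (bits k) :=
  mkop (fun (x : bits n) (y : bits k) => (x == place n xi (k * xi %/ n) y)%:R).

Definition encoding (n k xi : nat) (U : op (bits n) (bits n))
    (rho : op (bits k) (bits k)) : op (bits n) (bits n) :=
  U *m (add_ancillas n k xi *m rho *m (add_ancillas n k xi) ^t*) *m U ^t*.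

Definition erasure_choi_error (n k xi : nat) (p : R)
    (U : op (bits n) (bits n)) : R :=
  choi_error (@encoding n k xi U) (tensor_power (erasure p)).

Definition log2 (x : R) : R := ln x / ln 2.

(** The standing conditions on the parameters, including integrality. *)
Definition blocked_params (n k N xi : nat) (eps : R) : Prop :=
  [/\ (0 < n)%N, n = (N.*2 * xi)%N, 0 < eps, xi%:R = log2 (n%:R / eps)
    & (k <= n)%N /\ (n %| k * xi)%N].

End Operators.

(* Main.v *)
(** An erasure pattern is perfectly correctable once every nonzero Pauli operator
    supported on the erased qubits is detected by the code (Knill-Laflamme), so
    the Choi error is at most the square root of the probability of an
    uncorrectable pattern. A union bound over the Pauli operators g commuting
    with the ancilla stabilisers, written in the frame before the encoder, bounds
    this probability by the sum of p^wt(U g U^t). Clifford gates act transitively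
    on the nonzero Pauli operators of their 2 xi qubits, so each random gate
    averages a function of the label over all nonzero labels in its window. This
    averaging is self-adjoint, so that of the first layer can act on the ancilla
    constraint while that of the second acts on the weight; the expected sum
    becomes the partition function of a chain of 2N-1 spins, one per gate,
    telling whether the label may be nonzero there. Its excited states
    contribute (2^(-2(xi-kap)) (1+3p)^(2 xi))^N for the fully excited chain and
    8 N 2^-(xi-kap) for the others, kap being the number of logical qubits per
    region.

    For the depth, a Clifford unitary on m qubits is built by sweeps of
    nearest-neighbour two-qubit gates that restore X_j and Z_j one site at a
    time; successive sweeps can be pipelined, which gives depth 5 m + 1. *)

Require Import Defs.
From mathcomp Require Import all_boot all_order all_algebra.
From mathcomp Require Import all_classical all_reals all_analysis.
From mathcomp Require Import complex zify ring lra.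
Import Order.TTheory GRing.Theory Num.Theory.
Import numFieldNormedType.Exports.
Local Open Scope classical_set_scope.
Local Open Scope ring_scope.
Local Open Scope sesquilinear_scope.
Set Implicit Arguments.
Unset Strict Implicit.
Unset Printing Implicit Defensive.

(** * Pauli operators and Clifford unitaries *)

(** The weight averaged over the second layer alone is a product with one factor per second-layer
    window. Averaging this product over the first layer as well would entangle its factors, because
    the two tilings are shifted by one region. Once the first-layer average acts on the ancilla
    constraint instead, each layer yields a product over its own disjoint windows that sees, on a
    window, only whether the label vanishes there. Two neighbouring windows then interact only
    through the region they share, hence the nearest-neighbour chain with a two-by-two transfer
    matrix. The rate condition enters as (1+3p)^xi 2^-(xi-kap) <= 1, so that lengthening an excited
    stretch of the chain never gains weight. The o(1/n) condition enters as N 2^-(xi-kap) <= 1/8, so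
    that accumulated domain walls stay a small perturbation. As n = 2 N xi and xi = log(n/eps), the
    error 8 N 2^-(xi-kap) is exactly 4 eps^(1-k/n) n^(k/n) / log(n/eps). *)

Section OperatorEntries.
Variable R : realType.
Local Notation C := (complex R).

Lemma ent_adj (A B : finType) (M : op R A B) a b :
  ent (M ^t* : op R B A) b a = (ent M a b)^*.
Proof. by rewrite /ent !mxE. Qed.

Lemma ent1 (A : finType) (a b : A) : ent (1%:M : op R A A) a b = (a == b)%:R.
Proof. by rewrite /ent mxE (inj_eq enum_rank_inj). Qed.

Lemma entZ (A B : finType) (M : op R A B) (c : C) a b :
  ent (c *: M : op R A B) a b = c * ent M a b.
Proof. by rewrite /ent mxE. Qed.

Lemma ent0 (A B : finType) a b : ent (0 : op R A B) a b = 0.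
Proof. by rewrite /ent mxE. Qed.

Lemma ent_sum (A B I : finType) (P : pred I) (F : I -> op R A B) a b :
  ent (\sum_(i | P i) F i : op R A B) a b = \sum_(i | P i) ent (F i) a b.
Proof. by rewrite /ent summxE. Qed.

Lemma tr_ent (A : finType) (M : op R A A) : \tr M = \sum_a ent M a a.
Proof.
rewrite /mxtrace (reindex enum_rank) //=.
by apply: onW_bij; apply: enum_rank_bij.
Qed.

Lemma sum_delta (T : finType) (K : pzSemiRingType) (t : T) (F : T -> K) :
  \sum_u (u == t)%:R * F u = F t.
Proof.
rewrite (bigD1 t) //= eqxx mul1r big1 ?addr0 // => u /negPf ->.
by rewrite mul0r.
Qed.

Lemma adjM (l m n : nat) (M : 'M[C]_(l, m)) (N : 'M[C]_(m, n)) :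
  (M *m N) ^t* = N ^t* *m M ^t*.
Proof. by rewrite trmx_mul map_mxM. Qed.

Lemma adjZ (m n : nat) (c : C) (M : 'M[C]_(m, n)) :
  (c *: M) ^t* = c^* *: M ^t*.
Proof. by rewrite linearZ map_mxZ. Qed.

Lemma adjD (m n : nat) (M N : 'M[C]_(m, n)) : (M + N) ^t* = M ^t* + N ^t*.
Proof. by rewrite linearD map_mxD. Qed.

Lemma adj1 n : (1%:M : 'M[C]_n) ^t* = 1%:M.
Proof. by rewrite trmx1 map_mx1. Qed.

Lemma unitary_mulVmx n (U : 'M[C]_n) : U \is unitarymx -> U ^t* *m U = 1%:M.
Proof. by move=> /unitarymxP/mulmx1C. Qed.

Lemma unitary_mulmxV n (U : 'M[C]_n) : U \is unitarymx -> U *m U ^t* = 1%:M.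
Proof. by move=> /unitarymxP. Qed.

Lemma op_unitaryM n (V U : 'M[C]_n) :
  V \is unitarymx -> U \is unitarymx -> V *m U \is unitarymx.
Proof.
move=> uV uU; apply/unitarymxP; rewrite adjM mulmxA -(mulmxA V).
by rewrite unitary_mulmxV // mulmx1 unitary_mulmxV.
Qed.

Lemma op_unitary_adj n (U : 'M[C]_n) : U \is unitarymx -> U ^t* \is unitarymx.
Proof. by move=> uU; apply/unitarymxP; rewrite trmxCK unitary_mulVmx. Qed.

End OperatorEntries.

Section Phases.
Variable R : realType.
Local Notation C := (complex R).

(** Products of Pauli operators and the definition of [clifford] produce no other phases. Keeping
    the exponent existential avoids arithmetic modulo 4; [phase_ord] restores an exponent in
    ['I_4]. *)
Definition phase (c : C) := exists k : nat, c = 'i ^+ k.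

Lemma phase1 : phase 1. Proof. by exists 0%N. Qed.

Lemma phase_i k : phase ('i ^+ k). Proof. by exists k. Qed.

Lemma phaseM a b : phase a -> phase b -> phase (a * b).
Proof. by move=> [j ->] [k ->]; exists (j + k)%N; rewrite exprD. Qed.

Lemma i4 : 'i ^+ 4 = 1 :> C.
Proof. by rewrite (exprM _ 2 2) sqrCi -signr_odd. Qed.

Lemma phase_neq0 c : phase c -> c != 0.
Proof. by move=> [k ->]; rewrite expf_neq0 // neq0Ci. Qed.

Lemma phaseV a : phase a -> phase a^-1.
Proof.
move=> [k ->]; exists (3 * k)%N; apply: (mulfI (phase_neq0 (phase_i k))).
rewrite divff ?phase_neq0 ?phase_i //; last exact: phase_i.
by rewrite -exprD (_ : k + 3 * k = 4 * k)%N ?exprM ?i4 ?expr1n //; lia.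
Qed.

Lemma phase_norm a : phase a -> `|a| = 1.
Proof. by move=> [k ->]; rewrite normrX normCi expr1n. Qed.

Lemma phase_conjV a : phase a -> a^* = a^-1.
Proof. by move=> pa; rewrite invC_norm (phase_norm pa) expr1n invr1 mul1r. Qed.

Lemma phase_prod (I : finType) (F : I -> C) :
  (forall i, phase (F i)) -> phase (\prod_i F i).
Proof. by move=> pF; apply: big_ind => // [|a b]; [exact: phase1|exact: phaseM]. Qed.

Lemma phase_sign k : phase ((-1) ^+ k).
Proof. by exists (2 * k)%N; rewrite exprM sqrCi. Qed.

Lemma phase_ord c : phase c -> exists k : 'I_4, c = 'i ^+ k.
Proof.
move=> [k ->]; exists (Ordinal (ltn_pmod k (isT : 0 < 4)%N)) => /=.
by rewrite {1}(divn_eq k 4) exprD mulnC exprM i4 expr1n mul1r.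
Qed.

End Phases.

Section PauliAlgebra.
Variable R : realType.
Local Notation C := (complex R).
Variable m : nat.
Implicit Types (s t u : pauli_label m) (x y : bits m).

Definition ladd s t : pauli_label m :=
  [ffun q => ((s q).1 (+) (t q).1, (s q).2 (+) (t q).2)].
Definition lzero : pauli_label m := [ffun=> (false, false)].
(** The symplectic form on the binary space of labels; by [pauliC] it gives the sign with which two
    Pauli operators commute. *)
Definition symp s t : bool :=
  \big[addb/false]_(q < m) (((s q).1 && (t q).2) (+) ((s q).2 && (t q).1)).

Lemma laddC s t : ladd s t = ladd t s.
Proof. by apply/ffunP => q; rewrite !ffunE addbC [X in (_, X)]addbC. Qed.

Lemma laddss s : ladd s s = lzero.
Proof. by apply/ffunP => q; rewrite !ffunE !addbb. Qed.

Lemma sympC s t : symp s t = symp t s.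
Proof. by apply: eq_bigr => q _; rewrite addbC andbC [X in _ (+) X]andbC. Qed.

Lemma sympDr s t u : symp s (ladd t u) = symp s t (+) symp s u.
Proof.
rewrite -big_split; apply: eq_bigr => q _; rewrite !ffunE /=.
by case: (s q) (t q) (u q) => [[] []] [[] []] [[] []].
Qed.

Lemma sympDl s t u : symp (ladd s t) u = symp s u (+) symp t u.
Proof. by rewrite sympC sympDr sympC (sympC u t). Qed.

Lemma sympss s : symp s s = false.
Proof. by rewrite /symp big1 // => q _; rewrite andbC addbb. Qed.

Lemma symp0 s : symp s lzero = false.
Proof. by rewrite /symp big1 // => q _; rewrite ffunE !andbF. Qed.

Lemma symp_nondeg s : s != lzero -> exists t, symp s t.
Proof.
move=> s0; have [q sq] : exists q, s q != (false, false).
  apply/existsP; rewrite -negb_forall; apply: contra s0 => /forallP s0.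
  by apply/eqP/ffunP => q; rewrite ffunE; apply/eqP.
(* Against each of the three nonzero one-qubit labels (a, b), the label (b, ~~ b) anticommutes. *)
exists [ffun j => if j == q then ((s q).2, ~~ (s q).2) else (false, false)].
rewrite /symp (bigD1 q) //= big1 => [|j /negPf jq].
  by rewrite ffunE eqxx /= addbF; case: (s q) sq => [[] []].
by rewrite ffunE jq !andbF.
Qed.

Lemma zsignD s t x : zsign R (ladd s t) x = zsign R s x * zsign R t x.
Proof.
rewrite -big_split; apply: eq_bigr => q _; rewrite ffunE /= -signr_addb.
by rewrite andb_addl.
Qed.

Lemma zsign_xorb s x y : zsign R s (xorb x y) = zsign R s x * zsign R s y.
Proof.
rewrite -big_split; apply: eq_bigr => q _; rewrite ffunE /= -signr_addb.
by rewrite andb_addr.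
Qed.

Lemma phase_zsign s x : phase (zsign R s x).
Proof. by apply: phase_prod => q; exact: phase_sign. Qed.

Lemma phase_iphase s : phase (iphase R s).
Proof. by apply: phase_prod => q; exact: phase_i. Qed.

Lemma zsign_sqr s x : zsign R s x * zsign R s x = 1.
Proof. by rewrite -big_split big1 // => q _; rewrite /= -signr_addb addbb. Qed.

Lemma xpartD s t : xpart (ladd s t) = xorb (xpart s) (xpart t).
Proof. by apply/ffunP => q; rewrite !ffunE. Qed.

Lemma xorbA x y (z : bits m) : xorb x (xorb y z) = xorb (xorb x y) z.
Proof. by apply/ffunP => q; rewrite !ffunE addbA. Qed.

(** The sign comes from moving the Z part of [s] past the X part of [t]; the factors [iphase]
    convert between Hermitian Pauli operators and bare products X^x Z^z. *)
Definition pmul_phase s t : C :=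
  zsign R s (xpart t) * iphase R s * iphase R t / iphase R (ladd s t).

Lemma phase_pmul s t : phase (pmul_phase s t).
Proof.
apply: phaseM; last exact/phaseV/phase_iphase.
by do 2?apply: phaseM; [exact: phase_zsign|exact: phase_iphase..].
Qed.

Lemma pauliM s t :
  pauli R s *m pauli R t = pmul_phase s t *: pauli R (ladd s t).
Proof.
apply: op_ext => x y; rewrite ent_mul entZ !ent_pauli.
under eq_bigr do rewrite !ent_pauli mulrCA -[X in _ * X]mulrA.
rewrite sum_delta xorbA -xpartD zsign_xorb zsignD /pmul_phase.
case: eqP => _; rewrite ?(mul0r, mulr0) // !mul1r.
have := phase_neq0 (phase_iphase (ladd s t)); set a := iphase R (ladd _ _) => a0.
by field.
Qed.

Lemma pauliC s t :
  pauli R s *m pauli R t = (-1) ^+ symp s t *: (pauli R t *m pauli R s).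
Proof.
rewrite !pauliM scalerA (laddC t s); congr (_ *: _).
have zE u v : zsign R u (xpart v) = (-1) ^+ (\big[addb/false]_q ((u q).2 && (v q).1)) :> C.
  rewrite (big_morph (fun b : bool => (-1) ^+ b : C) (id1 := 1) (op1 := *%R)) //.
    by apply: eq_bigr => q _; rewrite ffunE.
  by move=> a b; rewrite signr_addb.
have -> : pmul_phase s t = (-1) ^+ symp s t * pmul_phase t s; last by [].
rewrite /pmul_phase (laddC t s).
have -> : zsign R s (xpart t) = (-1) ^+ symp s t * zsign R t (xpart s).
  rewrite !zE -signr_addb; congr (_ ^+ (nat_of_bool _)).
  rewrite /symp big_split /= -addbA.
  have -> : \big[addb/false]_q ((t q).2 && (s q).1)
            = \big[addb/false]_q ((s q).1 && (t q).2).
    by apply: eq_bigr => q _; rewrite andbC.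
  by rewrite addbC -addbA addbb addbF.
by ring.
Qed.

Lemma pauli0 : pauli R lzero = 1%:M.
Proof.
apply: op_ext => x y; rewrite ent1 ent_pauli /zsign /iphase !big1.
- by rewrite !mulr1; congr (_ == _)%:R; apply/ffunP => q; rewrite !ffunE.
- by move=> q _; rewrite ffunE.
- by move=> q _; rewrite ffunE.
Qed.

Lemma pauli_sqr s : pauli R s *m pauli R s = 1%:M.
Proof.
rewrite pauliM laddss pauli0.
rewrite /pmul_phase laddss {3}/iphase [X in _ / X]big1 => [|q _]; last by rewrite ffunE.
rewrite invr1 mulr1 -!big_split big1 ?scale1r //= => q _; rewrite ffunE.
case: (s q) => [[] []] /=; rewrite ?mulr1 ?expr0 ?expr1 ?mul1r //.
by rewrite mulN1r mulNr -expr2 sqrCi opprK.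
Qed.

Lemma pauli_adj s : (pauli R s) ^t* = pauli R s.
Proof.
apply: op_ext => x y; rewrite ent_adj !ent_pauli.
rewrite (_ : (y == _) = (x == xorb (xpart s) y)); last first.
  by apply/eqP/eqP => ->; rewrite xorbK.
case: eqP => [->|_]; rewrite ?(mul0r, conjC0) // !mul1r zsign_xorb.
rewrite !rmorphM /= !(phase_conjV (phase_zsign _ _)) /iphase rmorph_prod /=.
have zV x' : (zsign R s x')^-1 = zsign R s x'.
  by apply: (mulfI (phase_neq0 (phase_zsign s x'))); rewrite zsign_sqr divff ?phase_neq0 //; exact: phase_zsign.
rewrite !zV mulrC mulrA mulrC; congr (_ * _).
rewrite -big_split; apply: eq_bigr => q _ /=; rewrite ffunE.
case: (s q) => [[] []] /=; rewrite ?conjC1 ?expr0 ?mul1r //.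
by rewrite !expr1 conjCi mulrN1 opprK.
Qed.

Lemma pauli_unitary s : pauli R s \is unitarymx.
Proof. by apply/unitarymxP; rewrite pauli_adj pauli_sqr. Qed.

End PauliAlgebra.

(** * Action of Clifford unitaries on Pauli labels *)

Section CliffordTransport.
Variable R : realType.
Local Notation C := (complex R).
Variable m : nat.
Implicit Types (s t u a b : pauli_label m) (U V G : op R (bits m) (bits m)).

(** Weights and detection depend only on labels, so the phase is forgotten. Circuit synthesis needs
    signs as well, which [conjp_sign] recovers. *)
Definition conjp U s s' :=
  exists2 c : C, phase c & U *m pauli R s *m U ^t* = c *: pauli R s'.

Lemma pauli_label_inj (c c' : C) s s' : phase c -> phase c' ->
  c *: pauli R s = c' *: pauli R s' -> c = c' /\ s = s'.
Proof.
by move=> /phase_ord[k ->] /phase_ord[k' ->] /pauli_phase_inj[-> ->].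
Qed.

Lemma cliffordP U :
  clifford U <-> U \is unitarymx /\ forall s, exists s', conjp U s s'.
Proof.
split=> [[uU cU]|[uU cU]]; split=> // s.
  by have [c [s' E]] := cU s; exists s'; exists ('i ^+ c) => //; exact: phase_i.
by have [s' [c /phase_ord[k ->] E]] := cU s; exists k, s'.
Qed.

Lemma conj_mul (V U P : 'M[C]_#|bits m|) :
  (V *m U) *m P *m (V *m U) ^t* = V *m (U *m P *m U ^t*) *m V ^t*.
Proof. by rewrite adjM !mulmxA. Qed.

Lemma conjp_mul V U s s' s'' :
  conjp U s s' -> conjp V s' s'' -> conjp (V *m U) s s''.
Proof.
move=> [c pc E] [d pd F]; exists (c * d); first exact: phaseM.
by rewrite conj_mul E -scalemxAr -scalemxAl F scalerA.
Qed.

Lemma conjp_fun U s s' s'' : conjp U s s' -> conjp U s s'' -> s' = s''.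
Proof.
move=> [c pc E] [d pd F].
by have [] := pauli_label_inj pc pd (etrans (esym E) F).
Qed.

Lemma conjp_adj U s s' : U \is unitarymx -> conjp U s s' -> conjp (U ^t*) s' s.
Proof.
move=> uU [c pc E]; exists c^-1; first exact: phaseV.
rewrite trmxCK; apply: (scalerI (phase_neq0 pc)).
rewrite scalemxAl scalemxAr -E scalerA mulfV ?phase_neq0 // scale1r !mulmxA.
by rewrite unitary_mulVmx // mul1mx -mulmxA unitary_mulVmx // mulmx1.
Qed.

Lemma conjp_inj U s t s' : U \is unitarymx ->
  conjp U s s' -> conjp U t s' -> s = t.
Proof. by move=> uU /conjp_adj-/(_ uU) Hs /conjp_adj-/(_ uU); exact: conjp_fun. Qed.

Lemma conjp0 U : U \is unitarymx -> conjp U (lzero m) (lzero m).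
Proof.
move=> uU; exists 1; first exact: phase1.
by rewrite pauli0 mulmx1 unitary_mulmxV // scale1r.
Qed.

Lemma conjp1 s : conjp 1%:M s s.
Proof. by exists 1; [exact: phase1|rewrite mul1mx adj1 mulmx1 scale1r]. Qed.

(** Conjugation by a unitary is multiplicative, so it preserves the sign in [pauliC]. *)
Lemma conjp_symp U s t s' t' : U \is unitarymx ->
  conjp U s s' -> conjp U t t' -> symp s' t' = symp s t.
Proof.
move=> uU [c pc Es] [d pd Et].
have E : (c * d) *: (pauli R s' *m pauli R t')
       = (c * d) *: ((-1) ^+ symp s t *: (pauli R t' *m pauli R s')).
  transitivity ((c *: pauli R s') *m (d *: pauli R t')).
    by rewrite -scalemxAl -scalemxAr scalerA.
  rewrite -Es -Et; transitivity (U *m (pauli R s *m pauli R t) *m U ^t*).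
    rewrite !mulmxA; congr (_ *m _); rewrite -!mulmxA; congr (_ *m (_ *m _)).
    by rewrite mulmxA unitary_mulVmx // mul1mx.
  rewrite pauliC -scalemxAr -scalemxAl [c * d]mulrC scalerA [_ * _ ^+ _]mulrC.
  rewrite -scalerA; congr (_ *: _); rewrite -scalerA scalemxAr scalemxAl -Es -Et.
  rewrite !mulmxA; congr (_ *m _); rewrite -!mulmxA; congr (_ *m (_ *m _)).
  by rewrite mulmxA unitary_mulVmx // mul1mx.
move/(scalerI (mulf_neq0 (phase_neq0 pc) (phase_neq0 pd))): E.
rewrite pauliC !pauliM !scalerA => /pauli_label_inj[||/mulIf + _].
- by apply: phaseM; [exact: phase_sign|exact: phase_pmul].
- by apply: phaseM; [exact: phase_sign|exact: phase_pmul].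
move=> /(_ (phase_neq0 (phase_pmul _ _ _)))/eqP.
by case: (symp s' t') (symp s t) => [] [] //;
  rewrite expr0 expr1 ?[1 == _]eq_sym eqNr oner_eq0.
Qed.

Lemma clifford_unitary U : clifford U -> U \is unitarymx.
Proof. by case. Qed.

Lemma clifford1 : clifford (1%:M : op R (bits m) (bits m)).
Proof.
apply/cliffordP; split=> [|s]; last by exists s; exact: conjp1.
by apply/unitarymxP; rewrite adj1 mulmx1.
Qed.

Lemma clifford_mul V U : clifford V -> clifford U -> clifford (V *m U).
Proof.
move=> /cliffordP[uV cV] /cliffordP[uU cU]; apply/cliffordP; split.
  exact (op_unitaryM uV uU).
move=> s; have [s' s1] := cU s; have [s'' s2] := cV s'.
by exists s''; exact: conjp_mul s1 s2.
Qed.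

Lemma conjp_pauli t s : conjp (pauli R t) s s.
Proof.
exists ((-1) ^+ symp t s); first exact: phase_sign.
rewrite pauli_adj pauliC -scalemxAl; congr (_ *: _).
by rewrite -mulmxA pauli_sqr mulmx1.
Qed.

Lemma clifford_pauli t : clifford (pauli R t).
Proof.
apply/cliffordP; split=> [|s]; first exact: pauli_unitary.
by exists s; exact: conjp_pauli.
Qed.

(** Conjugation by [U] acts injectively on the finite set of labels, hence bijectively, so every
    label has a preimage. *)
Lemma clifford_adj U : clifford U -> clifford (U ^t* : op R (bits m) (bits m)).
Proof.
move=> /cliffordP[uU cU]; apply/cliffordP; split=> [|s'].
  by rewrite trmxC_unitary.
have /choice[f fP] := cU.
have f_inj : injective f.
  by move=> s t E; apply: (conjp_inj uU (fP s)); rewrite E.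
by exists (invF f_inj s'); apply: conjp_adj; rewrite // -{2}(f_invF f_inj s').
Qed.

(** If [a] and [b] anticommute, conjugation by this Clifford unitary fixes the
    labels with equal symplectic products against both and shifts the others by
    [ladd a b]. *)
Definition transv a b : op R (bits m) (bits m) :=
  (sqrtC 2)^-1 *: (pauli R a + pauli R b).

Lemma isqrt2_real : ((sqrtC 2)^-1 : C)^* = (sqrtC 2)^-1.
Proof. by apply/CrealP; rewrite rpredV sqrtC_real // ler0n. Qed.

Lemma isqrt2_sqr : (sqrtC 2)^-1 * (sqrtC 2)^-1 = 2^-1 :> C.
Proof. by rewrite -invfM -expr2 sqrtCK. Qed.

Lemma transv_adj a b : (transv a b) ^t* = transv a b.
Proof. by rewrite adjZ isqrt2_real adjD !pauli_adj. Qed.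

(** Expanding gives two diagonal terms, multiples of [pauli R s], and two cross terms. As [a] and
    [b] anticommute, the cross terms cancel if [s] has equal products with both, and the diagonal
    terms cancel otherwise. *)
Lemma transv_conj a b s : symp a b ->
  transv a b *m pauli R s *m (transv a b) ^t* =
  if symp s a == symp s b then (-1) ^+ symp s a *: pauli R s
  else (-1) ^+ symp s b *: (pauli R a *m (pauli R b *m pauli R s)).
Proof.
move=> ab; rewrite transv_adj /transv -!scalemxAl -!scalemxAr scalerA isqrt2_sqr.
rewrite !mulmxDl !mulmxDr.
have sandwich t : pauli R t *m pauli R s *m pauli R t = (-1) ^+ symp s t *: pauli R s.
  by rewrite -mulmxA pauliC -scalemxAr mulmxA pauli_sqr mul1mx.
rewrite !sandwich.
have -> : pauli R a *m pauli R s *m pauli R b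
        = (-1) ^+ symp s b *: (pauli R a *m (pauli R b *m pauli R s)).
  by rewrite -mulmxA (pauliC R s) -scalemxAr.
have -> : pauli R b *m pauli R s *m pauli R a
        = - ((-1) ^+ symp s a) *: (pauli R a *m (pauli R b *m pauli R s)).
  rewrite -mulmxA (pauliC R s) -scalemxAr (mulmxA (pauli R b)) (pauliC R b a) (sympC b a) ab expr1.
  by rewrite -scalemxAl -mulmxA scalerA mulrN1.
case: eqP => [<-|ne].
  rewrite scaleNr addrA addrK -scalerDl scalerA.
  by congr (_ *: _); field.
have -> : (-1) ^+ symp s a = - (-1) ^+ symp s b :> C.
  by move: ne; case: (symp s a) (symp s b) => [] [] // _; rewrite ?opprK.
rewrite opprK scaleNr; set A := _ *: pauli R s; set B := _ *: (pauli R a *m _).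
rewrite (addrC B A) addrACA addNr add0r -scalerDl scalerA.
by congr (_ *: _); field.
Qed.

Lemma transv_unitary a b : symp a b -> transv a b \is unitarymx.
Proof.
move=> ab; apply/unitarymxP; have := transv_conj (lzero m) ab.
by rewrite !(sympC (lzero m)) !symp0 eqxx expr0 scale1r pauli0 mulmx1.
Qed.

Lemma transv_fix a b s : symp a b -> symp s a = symp s b -> conjp (transv a b) s s.
Proof.
move=> ab E; exists ((-1) ^+ symp s a); first exact: phase_sign.
by rewrite transv_conj // E eqxx.
Qed.

Lemma transv_move a b : symp a b -> conjp (transv a b) a b.
Proof.
move=> ab; exists 1; first exact: phase1.
rewrite transv_conj // sympss ab /= (pauliC R b) sympC ab -scalemxAr mulmxA.
by rewrite pauli_sqr mul1mx scalerA mulrNN mulr1.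
Qed.

Lemma clifford_transv a b : symp a b -> clifford (transv a b).
Proof.
move=> ab; apply/cliffordP; split=> [|s]; first exact: transv_unitary.
have [E|ne] := eqVneq (symp s a) (symp s b).
  by exists s; apply: transv_fix.
exists (ladd a (ladd b s)).
exists ((-1) ^+ symp s b * (pmul_phase R b s * pmul_phase R a (ladd b s))).
  by apply: phaseM; [exact: phase_sign|apply: phaseM; exact: phase_pmul].
by rewrite transv_conj // ifN // pauliM -scalemxAr pauliM !scalerA -mulrA.
Qed.

End CliffordTransport.

Section PauliPairs.
Variable R : realType.
Variable m : nat.
Implicit Types (s t a b : pauli_label m) (U V G : op R (bits m) (bits m)).

(** The labels commuting with [a] and those commuting with [b] form two proper subgroups, and these
    cannot cover the whole group. *)
Lemma symp_common a b : a != lzero m -> b != lzero m ->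
  exists t, symp t a && symp t b.
Proof.
move=> /symp_nondeg[t at1] /symp_nondeg[u bu].
have [tb|tb] := boolP (symp t b); first by exists t; rewrite sympC at1.
have [ua|ua] := boolP (symp u a); first by exists u; rewrite ua sympC.
exists (ladd t u); rewrite !sympDl (sympC t a) at1 (negPf ua) (negPf tb).
by rewrite (sympC u b) bu.
Qed.

Lemma pauli_transitive a b : a != lzero m -> b != lzero m ->
  exists2 G : op R (bits m) (bits m), clifford G & conjp G a b.
Proof.
move=> a0 b0; have [<-|ab] := eqVneq a b.
  by exists 1%:M; [exact: clifford1|exact: conjp1].
have [t /andP[ta tb]] := symp_common a0 b0.
exists (transv R t b *m transv R a t).
  by apply: clifford_mul; apply: clifford_transv; rewrite // sympC.
apply: (@conjp_mul _ _ _ _ _ t); apply: transv_move => //.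
by rewrite sympC.
Qed.

Lemma symp_neq0 a b : symp a b -> a != lzero m.
Proof. by apply: contraTneq => ->; rewrite sympC symp0. Qed.

(** Witt's extension theorem for hyperbolic pairs. With [a] already at [a'], the second label must
    move while [a'] stays; a transvection between two labels that both anticommute with [a'] does
    this. *)
Lemma pauli_pair_transitive a b a' b' : symp a b -> symp a' b' ->
  exists2 G : op R (bits m) (bits m), clifford G & conjp G a a' /\ conjp G b b'.
Proof.
move=> ab ab'; have [V cV Va] := pauli_transitive (symp_neq0 ab) (symp_neq0 ab').
have [_ /(_ b)[b1 Vb]] := (cliffordP V).1 cV.
have ab1 : symp a' b1 by rewrite (conjp_symp (clifford_unitary cV) Va Vb).
suff [G cG [Ga Gb]] : exists2 G : op R (bits m) (bits m),
    clifford G & conjp G a' a' /\ conjp G b1 b'.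
  exists (G *m V); first exact: clifford_mul.
  by split; [exact: conjp_mul Va Ga|exact: conjp_mul Vb Gb].
have [<-|bb] := eqVneq b1 b'.
  by exists 1%:M; [exact: clifford1|split; exact: conjp1].
have [b1b'|b1b'] := boolP (symp b1 b').
  exists (transv R b1 b'); first exact: clifford_transv.
  by split; [apply: transv_fix; rewrite // ab1 ab'|exact: transv_move].
(* [transv_move] needs anticommuting ends. The label [r] anticommutes with [b1], [b'] and [a'], so
   the detour from [b1] over [r] to [b'] fixes [a'] at both steps. *)
pose r := ladd a' b1.
have b1r : symp b1 r by rewrite sympDr sympss sympC ab1.
have rb' : symp r b' by rewrite sympDl ab' (negPf b1b').
have a'r : symp a' r by rewrite sympDr sympss ab1.
exists (transv R r b' *m transv R b1 r).
  by apply: clifford_mul; apply: clifford_transv.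
split; last by apply: (@conjp_mul _ _ _ _ _ r); apply: transv_move.
apply: (@conjp_mul _ _ _ _ _ a'); apply: transv_fix => //.
- by rewrite ab1 a'r.
- by rewrite a'r ab'.
Qed.

(** Pauli operators square to the identity and conjugation preserves this, so the phase squares to
    one. *)
Lemma conjp_sign U s s' : U \is unitarymx -> conjp U s s' ->
  exists b : bool, U *m pauli R s *m U ^t* = (-1) ^+ b *: pauli R s'.
Proof.
move=> uU [c pc E]; suff /eqP : c ^+ 2 = 1.
  by rewrite sqrf_eq1 => /orP[] /eqP Ec; [exists false|exists true]; rewrite E Ec.
have : (U *m pauli R s *m U ^t*) *m (U *m pauli R s *m U ^t*) = 1%:M.
  rewrite !mulmxA -(mulmxA (U *m pauli R s)) unitary_mulVmx // mulmx1.
  by rewrite -(mulmxA U) pauli_sqr mulmx1 unitary_mulmxV.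
rewrite E -scalemxAl -scalemxAr pauli_sqr scalerA -expr2 => /matrixP.
move=> /(_ (enum_rank [ffun=> false]) (enum_rank [ffun=> false])).
by rewrite !mxE eqxx mulr1.
Qed.

(** As [a] and [b] anticommute, conjugating by [b] flips the sign of [a] only, and conjugating by
    [a] that of [b] only. *)
Lemma pauli_sign_fix a b (x y : bool) : symp a b ->
  exists t, (-1) ^+ symp t a = (-1) ^+ x :> complex R /\
            (-1) ^+ symp t b = (-1) ^+ y :> complex R.
Proof.
move=> ab; exists (ladd (if x then b else lzero m) (if y then a else lzero m)).
rewrite !sympDl; case: x y => [] [] /=;
  by rewrite ?sympss ?(sympC (lzero m)) ?symp0 ?ab ?(sympC b) ?ab.
Qed.

Lemma pauli_pair_transport a b a' b' (x y : bool) : symp a b -> symp a' b' ->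
  exists G : op R (bits m) (bits m), [/\ clifford G,
    G *m ((-1) ^+ x *: pauli R a) *m G ^t* = pauli R a' &
    G *m ((-1) ^+ y *: pauli R b) *m G ^t* = pauli R b'].
Proof.
move=> ab ab'; have [G cG [Ga Gb]] := pauli_pair_transitive ab ab'.
have [x' Ea] := conjp_sign (clifford_unitary cG) Ga.
have [y' Eb] := conjp_sign (clifford_unitary cG) Gb.
have [t [ta tb]] := pauli_sign_fix (x (+) x') (y (+) y') ab'.
exists (pauli R t *m G); split.
- exact: clifford_mul (clifford_pauli _ _) cG.
- rewrite conj_mul -scalemxAr -scalemxAl Ea scalerA -signr_addb.
  rewrite -scalemxAr -scalemxAl pauli_adj pauliC -scalemxAl -mulmxA pauli_sqr.
  by rewrite mulmx1 scalerA ta -signr_addb addbb scale1r.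
- rewrite conj_mul -scalemxAr -scalemxAl Eb scalerA -signr_addb.
  rewrite -scalemxAr -scalemxAl pauli_adj pauliC -scalemxAl -mulmxA pauli_sqr.
  by rewrite mulmx1 scalerA tb -signr_addb addbb scale1r.
Qed.

End PauliPairs.

Section UniformTableau.
Variable R : realType.
Variable m : nat.
Implicit Types (s u : pauli_label m) (t : tableau m).
Local Notation cl := (clifford_classes R m).

Lemma clifford_of_unitary t : t \in cl -> clifford_of R t \is unitarymx.
Proof. by move=> /clifford_ofP[]. Qed.

Lemma clifford_ofE t : t \in cl -> clifford (clifford_of R t).
Proof. by move=> tcl; apply/clifford_has_tableau; exists t; exact: clifford_ofP. Qed.

Lemma clifford_of_conjp t s : t \in cl -> conjp (clifford_of R t) s (t s).2.
Proof.
by move=> /clifford_ofP[_ /(_ s) E]; exists ('i ^+ (t s).1) => //; exact: phase_i.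
Qed.

Lemma tableau_of (U : op R (bits m) (bits m)) : clifford U ->
  exists2 t, t \in cl & has_tableau U t.
Proof.
move=> /clifford_has_tableau[t Ut]; exists t => //.
by rewrite inE; apply/asboolP; exists U.
Qed.

Lemma clifford_classes_gt0 : (0 < #|cl|)%N.
Proof. by have [t tcl _] := tableau_of (clifford1 R m); apply/card_gt0P; exists t. Qed.

Lemma tableau_lzero t : t \in cl -> (t (lzero m)).2 = lzero m.
Proof.
move=> tcl; apply: (conjp_fun (clifford_of_conjp _ tcl)).
exact/conjp0/clifford_of_unitary.
Qed.

Lemma tableau_inj t : t \in cl -> injective (fun s => (t s).2).
Proof.
move=> tcl s s' E; apply: (conjp_inj (clifford_of_unitary tcl) (clifford_of_conjp s tcl)).
by rewrite E; exact: clifford_of_conjp.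
Qed.

(** Left multiplication by a Clifford unitary taking [u] to [u'] maps the first set of classes into
    the second. It is injective because equal tableaux mean equal unitaries up to phase, and the
    left factor cancels. *)
Lemma card_tableau_image s u u' : u != lzero m -> u' != lzero m ->
  (#|[set t in cl | (t s).2 == u]| <= #|[set t in cl | (t s).2 == u']|)%N.
Proof.
move=> u0 u'0; have [V cV Vu] := pauli_transitive R u0 u'0.
have /choice[f fP] t : exists t' : tableau m,
    t \in cl -> t' \in cl /\ has_tableau (V *m clifford_of R t) t'.
  have [tcl|] := boolP (t \in cl); last by exists t.
  have [t' t'cl Ht'] := tableau_of (clifford_mul cV (clifford_ofE tcl)).
  by exists t'.
rewrite -(card_in_imset (f := f)); last first.
  move=> t t'; rewrite !inE => /andP[tcl _] /andP[t'cl _] E.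
  have {tcl}tcl : t \in cl by rewrite inE. have {t'cl}t'cl : t' \in cl by rewrite inE.
  have [_ H1] := fP _ tcl; have [_ H2] := fP _ t'cl.
  rewrite E in H1; have [c c1 VE] := has_tableau_phase H1 H2.
  apply: (has_tableau_inj (clifford_ofP tcl)).
  have -> : clifford_of R t = c *: clifford_of R t'.
    have : V ^t* *m (V *m clifford_of R t) = V ^t* *m (c *: (V *m clifford_of R t')).
      by congr (_ *m _).
    by rewrite -scalemxAr !mulmxA unitary_mulVmx ?mul1mx //; exact: clifford_unitary.
  have [uV' tV'] := clifford_ofP t'cl; split; last by move=> w; rewrite phase_conj.
  apply/unitarymxP; rewrite adjZ -scalemxAl -scalemxAr unitary_mulmxV // scalerA.
  by rewrite -normCK c1 expr1n scale1r.
apply: subset_leq_card; apply/fintype.subsetP => _ /imsetP[t + ->]; rewrite !inE => /andP[tcl /eqP tu].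
have {tcl}tcl : t \in cl by rewrite inE.
have [fcl Hf] := fP _ tcl; move: (fcl); rewrite inE => -> /=; apply/eqP.
have : conjp (V *m clifford_of R t) s (f t s).2.
  by have [_ /(_ s) E] := Hf; exists ('i ^+ (f t s).1) => //; exact: phase_i.
move/conjp_fun; apply; apply: conjp_mul Vu.
by rewrite -tu; exact: clifford_of_conjp.
Qed.

(** No class sends [s] to the zero label; by [card_tableau_image] in both directions all other
    fibres have one common size, which cancels. *)
Lemma mean_tableau s (f : pauli_label m -> R) : s != lzero m ->
  uniform_mean (mem cl) (fun t => f (t s).2)
  = (\sum_(u | u != lzero m) f u) / (#|pauli_label m|.-1)%:R.
Proof.
move=> s0; rewrite /uniform_mean.
pose n u := #|[set t in cl | (t s).2 == u]|.
have n_const u : u != lzero m -> n u = n s.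
  by move=> u0; apply/eqP; rewrite eqn_leq !card_tableau_image.
have sumE (g : pauli_label m -> R) :
    \sum_(t in cl) g (t s).2 = (n s)%:R * \sum_(u | u != lzero m) g u.
  rewrite (partition_big (fun t : tableau m => (t s).2) (fun u => u != lzero m)) /=.
    rewrite mulr_sumr; apply: eq_bigr => u u0; rewrite -(n_const u u0) /n.
    rewrite (eq_bigr (fun=> g u)) => [|t /andP[_ /eqP ->] //].
    rewrite sumr_const mulr_natl; congr (_ *+ _).
    by rewrite cardsE.
  move=> t tcl; apply: contra s0 => /eqP E; apply/eqP/(tableau_inj tcl).
  by rewrite E tableau_lzero.
have cardE : (#|cl|%:R : R) = (n s)%:R * (#|pauli_label m|.-1)%:R.
  have := sumE (fun=> 1); rewrite !sumr_const => ->; congr (_ * _%:R).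
  by rewrite (@cardC1 _ (lzero m)).
have n0 : (n s)%:R != 0 :> R.
  have := clifford_classes_gt0; rewrite -(ltr_nat R) cardE.
  by apply: contraTneq => ->; rewrite mul0r ltxx.
rewrite sumE; have -> : #|mem cl|%:R = #|cl|%:R :> R by [].
by rewrite cardE -mulf_div divff // mul1r.
Qed.

End UniformTableau.

(** * Embedded gates *)

Section Windows.
Variables (T : finType) (d : T) (n o m : nat).
Hypothesis le_n : (o + m <= n)%N.
Implicit Types (x y : {ffun 'I_n -> T}) (w : {ffun 'I_m -> T}).

(** This is [window] over an arbitrary alphabet with default [d], so that bit strings and Pauli
    labels share one theory. *)
Definition gwin x : {ffun 'I_m -> T} :=
  [ffun q : 'I_m => if insub (o + q)%N is Some i then x i else d].

Definition patch x w : {ffun 'I_n -> T} :=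
  [ffun q : 'I_n => if (o <= q)%N then
     if insub (q - o)%N is Some j then w j else x q else x q].

Definition inwin (q : nat) := (o <= q < o + m)%N.

Definition agree x y := [forall q : 'I_n, ~~ inwin q ==> (x q == y q)].

Lemma winord_subproof (q : 'I_m) : (o + q < n)%N.
Proof. by apply: leq_trans le_n; rewrite ltn_add2l. Qed.

Definition winord (q : 'I_m) : 'I_n := Ordinal (winord_subproof q).

Lemma inwin_winord q : inwin (winord q).
Proof. by rewrite /inwin /= leq_addr ltn_add2l ltn_ord. Qed.

Lemma inwinP (q : 'I_n) : reflect (exists j, q = winord j) (inwin q).
Proof.
apply: (iffP idP) => [/andP[oq qm]|[j ->]]; last exact: inwin_winord.
have qo : (q - o < m)%N by rewrite ltn_subLR.
by exists (Ordinal qo); apply: val_inj; rewrite /= subnKC.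
Qed.

Lemma gwinE x q : gwin x q = x (winord q).
Proof.
rewrite ffunE; case: insubP => [i _ Ei|]; first by congr (x _); apply: val_inj.
by rewrite winord_subproof.
Qed.

Lemma patch_in x w q : patch x w (winord q) = w q.
Proof.
rewrite ffunE /= leq_addr addKn; case: insubP => [i _ Ei|].
  by congr (w _); apply: val_inj.
by rewrite ltn_ord.
Qed.

Lemma patch_out x w (q : 'I_n) : ~~ inwin q -> patch x w q = x q.
Proof.
rewrite ffunE /inwin => nq; case: (leqP o q) => // oq.
by case: insubP => // j; rewrite ltn_subLR // => h; rewrite oq h in nq.
Qed.

Lemma gwin_patch x w : gwin (patch x w) = w.
Proof. by apply/ffunP => q; rewrite gwinE patch_in. Qed.

Lemma agreeP x y : reflect (forall q : 'I_n, ~~ inwin q -> x q = y q) (agree x y).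
Proof.
apply: (iffP forallP) => H q; first by move=> nq; exact: (eqP (implyP (H q) nq)).
by apply/implyP => nq; rewrite H.
Qed.

Lemma agree_patch x w : agree x (patch x w).
Proof. by apply/agreeP => q nq; rewrite patch_out. Qed.

Lemma patch_eq x y w : (forall q : 'I_n, ~~ inwin q -> y q = x q) ->
  (forall q, y (winord q) = w q) -> y = patch x w.
Proof.
move=> out win; apply/ffunP => q; have [/inwinP[j ->]|nq] := boolP (inwin q).
  by rewrite patch_in.
by rewrite patch_out // out.
Qed.

Lemma patch_gwin x y : agree x y -> patch x (gwin y) = y.
Proof.
by move=> /agreeP xy; apply/esym/patch_eq => q; [move=> /xy|rewrite gwinE].
Qed.

Lemma sum_agree (K : nzSemiRingType) (F : {ffun 'I_n -> T} -> K) x :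
  \sum_y F y * (agree x y)%:R = \sum_w F (patch x w).
Proof.
rewrite (bigID (agree x)) /= [X in _ + X]big1 => [|y /negPf ->]; last by rewrite mulr0.
rewrite addr0 (reindex_onto (patch x) gwin) => [|y]; last exact: patch_gwin.
by apply: eq_big => [w|w _]; rewrite ?agree_patch ?mulr1 // gwin_patch eqxx.
Qed.

End Windows.

Section Embedding.
Variable R : realType.
Local Notation C := (complex R).

Section OneWindow.
Variables (n o m : nat).
Hypothesis le_n : (o + m <= n)%N.
Implicit Types (U V : op R (bits m) (bits m)) (x y z : bits n).

Lemma ent_embed U x y : ent (embed n o U) x y =
  ent U (gwin false o m x) (gwin false o m y) * (agree o m x y)%:R.
Proof. by rewrite ent_mkop. Qed.

Lemma agree_sym x y : agree o m x y = agree o m y x.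
Proof. by apply: eq_forallb => q; rewrite eq_sym. Qed.

Lemma agree_trans x y z : agree o m x y -> agree o m x z = agree o m y z.
Proof.
move=> /agreeP xy; apply/agreeP/agreeP => H q nq.
  by rewrite -xy // H.
by rewrite xy // H.
Qed.

Lemma embedM U V : embed n o (U *m V) = embed n o U *m embed n o V.
Proof.
apply: op_ext => x y; rewrite ent_mul ent_embed.
transitivity (\sum_z (ent U (gwin false o m x) (gwin false o m z) *
    (ent V (gwin false o m z) (gwin false o m y) * (agree o m z y)%:R)) *
    (agree o m x z)%:R); last first.
  by apply: eq_bigr => z _; rewrite !ent_embed; ring.
rewrite (sum_agree false le_n).
rewrite ent_mul mulr_suml; apply: eq_bigr => w _.
by rewrite (gwin_patch _ le_n) mulrA -(agree_trans y (agree_patch o x w)).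
Qed.

Lemma embed1 : embed n o (1%:M : op R (bits m) (bits m)) = 1%:M.
Proof.
apply: op_ext => x y; rewrite ent_embed !ent1.
have [<-|xy] := eqVneq x y.
  by rewrite eqxx mul1r (_ : agree _ _ _ _) //; apply/agreeP.
case: eqP => [win|]; rewrite ?mul0r // mul1r.
case: (boolP (agree _ _ _ _)) => // /(patch_gwin false le_n) E.
by case/eqP: xy; rewrite -E -win; apply/esym/(patch_gwin false le_n); apply/agreeP.
Qed.

Lemma embedZ (c : C) U : embed n o (c *: U) = c *: embed n o U.
Proof. by apply: op_ext => x y; rewrite entZ !ent_embed entZ mulrA. Qed.

Lemma embed_adj U : embed n o (U ^t*) = (embed n o U) ^t*.
Proof.
apply: op_ext => x y; rewrite ent_adj !ent_embed ent_adj rmorphM /= conjC_nat.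
by rewrite agree_sym.
Qed.

Lemma embed_unitary U : U \is unitarymx -> embed n o U \is unitarymx.
Proof.
by move=> uU; apply/unitarymxP; rewrite -embed_adj -embedM unitary_mulmxV // embed1.
Qed.

Definition lpatch (s : pauli_label n) (u : pauli_label m) : pauli_label n :=
  patch o s u.
Definition lwin (s : pauli_label n) : pauli_label m := gwin (false, false) o m s.

Lemma prod_bool (I : finType) (P b : pred I) :
  \prod_(i | P i) (b i)%:R = [forall i : I, P i ==> b i]%:R :> C.
Proof.
case: (pickP (fun i => P i && ~~ b i)) => [i /andP[Pi /negPf bi]|H].
  rewrite (bigD1 i) //= bi mul0r; case: forallP => // /(_ i).
  by rewrite Pi bi.
have -> : [forall i : I, P i ==> b i].
  by apply/forallP => i; apply/implyP => Pi; move: (H i); rewrite Pi /= => /negbFE.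
by rewrite big1 // => i Pi; move: (H i); rewrite Pi /= => /negbFE ->.
Qed.

Lemma prod_inwin (K : comNzRingType) (F : 'I_n -> K) :
  \prod_(q : 'I_n | inwin o m q) F q = \prod_(j < m) F (winord le_n j).
Proof.
have inj : {in [set: 'I_m]%SET &, injective (winord le_n)}.
  by move=> i j _ _ /(congr1 val)/= /addnI /val_inj.
transitivity (\prod_(q in [set winord le_n j | j in [set: 'I_m]%SET]%SET) F q).
  apply: eq_bigl => q; apply/inwinP/imsetP => [[j ->]|[j _ ->]]; last by exists j.
  by exists j; rewrite ?inE.
by rewrite (big_imset _ inj) /=; apply: eq_bigl => j; rewrite inE.
Qed.

Lemma embed_pauli u : embed n o (pauli R u) = pauli R (lpatch (lzero n) u).
Proof.
apply: op_ext => x y; rewrite ent_embed !ent_mkop.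
rewrite [RHS](bigID (fun q : 'I_n => inwin o m q)) /=; congr (_ * _).
  rewrite prod_inwin; apply: eq_bigr => j _.
  by rewrite (patch_in le_n) !(gwinE _ le_n).
rewrite -prod_bool; apply: eq_bigr => q nq; rewrite patch_out // ffunE /pauli1 /=.
by rewrite addbF !mulr1.
Qed.

Lemma embed_comm_pauli U (l : pauli_label n) :
  (forall q : 'I_n, inwin o m q -> l q = (false, false)) ->
  embed n o U *m pauli R l = pauli R l *m embed n o U.
Proof.
move=> l0; apply: op_ext => x y; rewrite !ent_mul.
have flip z w : (z == xorb (xpart l) w) = (w == xorb (xpart l) z).
  by apply/eqP/eqP => ->; rewrite xorbK.
under eq_bigr => z _ do rewrite ent_pauli mulrCA.
under [RHS]eq_bigr => z _ do rewrite ent_pauli flip -mulrA.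
rewrite !sum_delta !ent_embed.
have winx z : gwin false o m (xorb (xpart l) z) = gwin false o m z.
  apply/ffunP => j; rewrite !(gwinE _ le_n) !ffunE l0 //; exact: inwin_winord.
have -> : agree o m x (xorb (xpart l) y) = agree o m (xorb (xpart l) x) y.
  apply: eq_forallb => q; congr (_ ==> _); rewrite !ffunE.
  by case: (x q) (y q) (l q) => [] [] [[] []].
rewrite !winx -mulrA mulrC -!mulrA; case: (boolP (agree _ _ _ _)) => [ag|_]; last first.
  by rewrite !(mul0r, mulr0).
have -> : zsign R l (xorb (xpart l) x) = zsign R l y; last by ring.
apply: eq_bigr => q _; have [inq|nq] := boolP (inwin o m q); first by rewrite l0.
by rewrite (agreeP _ _ _ _ ag q nq).
Qed.

Lemma lpatch_lwin (s : pauli_label n) :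
  s = ladd (lpatch (lzero n) (lwin s)) (lpatch s (lzero m)).
Proof.
apply/ffunP => q; rewrite ffunE; have [/(inwinP le_n)[j ->]|nq] := boolP (inwin o m q).
  rewrite !(patch_in le_n) (gwinE _ le_n) ffunE /= !addbF; by case: (s _).
by rewrite !patch_out // ffunE /=; case: (s _).
Qed.

Lemma lpatch_add (s : pauli_label n) u :
  lpatch s u = ladd (lpatch (lzero n) u) (lpatch s (lzero m)).
Proof.
apply/ffunP => q; rewrite [RHS]ffunE; have [/(inwinP le_n)[j ->]|nq] := boolP (inwin o m q).
  by rewrite !(patch_in le_n) ffunE /= !addbF; case: (u _).
by rewrite !patch_out // ffunE /=; case: (s _).
Qed.

Lemma embed_conj U (u : pauli_label m) (c : C) v :
  U *m pauli R u *m U ^t* = c *: pauli R v ->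
  embed n o U *m pauli R (lpatch (lzero n) u) *m (embed n o U) ^t*
  = c *: pauli R (lpatch (lzero n) v).
Proof. by move=> E; rewrite -!embed_pauli -embed_adj -!embedM E embedZ. Qed.

(** The label splits into its part inside the window, which the gate transforms, and the rest, with
    which the gate commutes; [p0] and [p1] are the phases of splitting and recombining. *)
Lemma embed_conjp U (s : pauli_label n) v : U \is unitarymx ->
  conjp U (lwin s) v -> conjp (embed n o U) s (lpatch s v).
Proof.
move=> uU [c pc /embed_conj E].
set p0 := pmul_phase R (lpatch (lzero n) (lwin s)) (lpatch s (lzero m)).
set p1 := pmul_phase R (lpatch (lzero n) v) (lpatch s (lzero m)).
have p00 : phase p0 by exact: phase_pmul.
have p10 : phase p1 by exact: phase_pmul.
exists (p0^-1 * c * p1); first by do 2?apply: phaseM => //; exact: phaseV.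
have -> : pauli R s = p0^-1 *: (pauli R (lpatch (lzero n) (lwin s)) *m
                                pauli R (lpatch s (lzero m))).
  by rewrite pauliM -/p0 scalerA mulVf ?phase_neq0 // scale1r -lpatch_lwin.
have com : embed n o U *m pauli R (lpatch s (lzero m))
         = pauli R (lpatch s (lzero m)) *m embed n o U.
  apply: embed_comm_pauli => q /(inwinP le_n)[j ->].
  by rewrite (patch_in le_n) ffunE.
have comV : pauli R (lpatch s (lzero m)) *m (embed n o U) ^t*
          = (embed n o U) ^t* *m pauli R (lpatch s (lzero m)).
  by rewrite -[X in X *m _]pauli_adj -adjM com adjM pauli_adj.
rewrite -scalemxAr -scalemxAl -!mulmxA comV !mulmxA E.
by rewrite -scalemxAl pauliM -/p1 -lpatch_add !scalerA mulrA.
Qed.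

Lemma embed_fix_pauli U (s : pauli_label n) : U \is unitarymx ->
  (forall q : 'I_n, inwin o m q -> s q = (false, false)) ->
  embed n o U *m pauli R s *m (embed n o U) ^t* = pauli R s.
Proof.
move=> uU s0; rewrite embed_comm_pauli // -mulmxA unitary_mulmxV ?mulmx1 //.
exact: embed_unitary.
Qed.

End OneWindow.

Lemma embed_embed n o m i k (U : op R (bits k) (bits k)) :
  (o + m <= n)%N -> (i + k <= m)%N ->
  embed n o (embed m i U) = embed n (o + i) U.
Proof.
move=> om ik; have oik : (o + i + k <= n)%N by rewrite -addnA (leq_trans _ om) ?leq_add2l.
apply: op_ext => x y; rewrite !ent_embed -mulrA -natrM mulnb.
have winE (z : bits n) : gwin false i k (gwin false o m z) = gwin false (o + i) k z.
  apply/ffunP => q; rewrite (gwinE _ ik) (gwinE _ om) (gwinE _ oik); congr (z _).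
  by apply: val_inj; rewrite /= addnA.
rewrite !winE; congr (_ * (nat_of_bool _)%:R).
apply/andP/agreeP => [[/agreeP H1 /agreeP H2] q nq|H].
  have [/(inwinP om)[j E]|] := boolP (inwin o m q); last exact: H2.
  have := H1 j; rewrite !(gwinE _ om) -E; apply.
  by move: nq; rewrite E /inwin /= -addnA !leq_add2l ltn_add2l.
split; apply/agreeP => q nq.
  rewrite !(gwinE _ om) H //.
  by move: nq; rewrite /inwin /= -addnA !leq_add2l ltn_add2l.
by rewrite H //; move: nq; rewrite /inwin; apply: contra => /andP[? ?]; lia.
Qed.

Section TwoWindows.
Variables (n o m o' m' : nat).
Hypotheses (le_n : (o + m <= n)%N) (le_n' : (o' + m' <= n)%N).
Hypothesis disj : forall q, inwin o m q -> ~~ inwin o' m' q.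

Lemma ent_embed_disjoint (U : op R (bits m) (bits m)) (V : op R (bits m') (bits m')) x y :
  ent (embed n o U *m embed n o' V) x y =
  ent U (gwin false o m x) (gwin false o m y) *
  ent V (gwin false o' m' x) (gwin false o' m' y) *
  [forall q : 'I_n, ~~ inwin o m q && ~~ inwin o' m' q ==> (x q == y q)]%:R.
Proof.
rewrite ent_mul.
under eq_bigr => z _ do rewrite ent_embed mulrAC.
rewrite (sum_agree false le_n).
rewrite (bigD1 (gwin false o m y)) //= big1 ?addr0 => [|w wy].
  rewrite (gwin_patch _ le_n) ent_embed -mulrA; congr (_ * (_ * _%:R)).
    congr ent; apply/ffunP => j; rewrite !(gwinE _ le_n') patch_out //.
    by apply: contraL (inwin_winord le_n' j) => /disj.
  congr nat_of_bool; apply/agreeP/forallP => H q.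
    apply/implyP => /andP[nq nq']; apply/eqP.
    by rewrite -H // patch_out.
  move=> nq'; have [/(inwinP le_n)[j ->]|nq] := boolP (inwin o m q).
    by rewrite (patch_in le_n) (gwinE _ le_n).
  by rewrite patch_out //; apply/eqP; have := H q; rewrite nq nq'.
rewrite ent_embed (_ : agree _ _ _ _ = false) ?mulr0 //.
apply/negP => /agreeP H; case/eqP: wy; apply/ffunP => j; rewrite (gwinE _ le_n).
rewrite -H ?(patch_in le_n) //; exact/disj/inwin_winord.
Qed.

End TwoWindows.

Lemma embed_comm n o m o' m' (U : op R (bits m) (bits m)) (V : op R (bits m') (bits m')) :
  (o + m <= n)%N -> (o' + m' <= n)%N ->
  (forall q, inwin o m q -> ~~ inwin o' m' q) ->
  embed n o U *m embed n o' V = embed n o' V *m embed n o U.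
Proof.
move=> h h' disj; apply: op_ext => x y.
rewrite !ent_embed_disjoint //; last by move=> q; apply: contraL => /disj.
rewrite [ent U _ _ * _]mulrC; congr (_ * (nat_of_bool _)%:R).
by apply: eq_forallb => q; rewrite andbC.
Qed.

End Embedding.

(** * Fidelity and decoders *)

Section Fidelity.
Variable R : realType.
Local Notation C := (complex R).

(** The formula of [psd] at plain matrix sizes; the two agree by conversion, so facts pass from one
    to the other directly. *)
Definition psdm (n : nat) (M : 'M[C]_n) : Prop :=
  M ^t* = M /\ forall v : 'cV[C]_n, 0 <= \tr (v ^t* *m M *m v).

Lemma tr_adj_ge0 (m n : nat) (M : 'M[C]_(m, n)) : 0 <= \tr (M ^t* *m M).
Proof.
rewrite /mxtrace sumr_ge0 // => i _; rewrite mxE sumr_ge0 // => j _.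
by rewrite !mxE mulrC -normCK exprn_ge0.
Qed.

Lemma psdm_conj (m n : nat) (K : 'M[C]_(n, m)) (M : 'M[C]_m) :
  psdm M -> psdm (K *m M *m K ^t*).
Proof.
move=> [hM pM]; split; first by rewrite !adjM trmxCK hM mulmxA.
by move=> v; have := pM (K ^t* *m v); rewrite adjM trmxCK !mulmxA.
Qed.

Lemma psdm1 n : psdm (1%:M : 'M[C]_n).
Proof. by split=> [|v]; [rewrite adj1|rewrite mulmx1 tr_adj_ge0]. Qed.

Lemma psdm0 n : psdm (0 : 'M[C]_n).
Proof.
split=> [|v]; first by rewrite trmx0 map_mx0.
by rewrite mulmx0 mul0mx mxtrace0.
Qed.

Lemma psdmD n (M N : 'M[C]_n) : psdm M -> psdm N -> psdm (M + N).
Proof.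
move=> [hM pM] [hN pN]; split=> [|v]; first by rewrite adjD hM hN.
by rewrite mulmxDr mulmxDl mxtraceD addr_ge0.
Qed.

Lemma psdm_sum n (I : finType) (P : pred I) (F : I -> 'M[C]_n) :
  (forall i, P i -> psdm (F i)) -> psdm (\sum_(i | P i) F i).
Proof.
by move=> pF; apply: big_ind; [exact: psdm0|exact: psdmD|].
Qed.

Section Spectrum.
Variables (n : nat) (M : 'M[C]_n).
Hypothesis pM : psdm M.
Let P := spectralmx M.
Let d := spectral_diag M.

Lemma psdm_spectral : M = P ^t* *m diag_mx d *m P.
Proof.
have : M \is normalmx by apply/normalmxP; rewrite pM.1.
by move=> /orthomx_spectralP; rewrite invmx_unitary ?spectral_unitarymx.
Qed.

Lemma spectral_unitary : P \is unitarymx. Proof. exact: spectral_unitarymx. Qed.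

Lemma psdm_eigen_ge0 i : 0 <= d 0 i.
Proof.
have := pM.2 ((row i P) ^t*); rewrite trmxCK {1}psdm_spectral.
rewrite !mulmxA -row_mul unitary_mulmxV ?spectral_unitary // -!mulmxA.
have -> : P *m (row i P) ^t* = (row i 1%:M) ^t*.
  by rewrite -[LHS]trmxCK adjM trmxCK -row_mul unitary_mulmxV ?spectral_unitary.
rewrite /mxtrace big_ord1 mxE (bigD1 i) //= big1 => [|j ji].
  rewrite !mxE eqxx mul1r (bigD1 i) //= big1 => [|k ki]; last first.
    by rewrite !mxE eq_sym (negPf ki) mulr0n mul0r.
  by rewrite !mxE eqxx mulr1n conjC1 mulr1 !addr0.
by rewrite !mxE eq_sym (negPf ji) mul0r.
Qed.

Lemma sqrtmxE : sqrtmx M = P ^t* *m diag_mx (map_mx sqrtC d) *m P.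
Proof. by rewrite /sqrtmx invmx_unitary ?spectral_unitarymx. Qed.

Lemma sqrtmx_sqr : sqrtmx M *m sqrtmx M = M.
Proof.
have E : diag_mx (map_mx sqrtC d) *m diag_mx (map_mx sqrtC d) = diag_mx d.
  rewrite mulmx_diag; congr diag_mx; apply/rowP => i; rewrite !mxE.
  by rewrite -expr2 sqrtCK.
rewrite sqrtmxE -!mulmxA (mulmxA P) unitary_mulmxV ?spectral_unitary //.
by rewrite mul1mx (mulmxA (diag_mx _)) E [RHS]psdm_spectral !mulmxA.
Qed.

Lemma sqrtmx_adj : (sqrtmx M) ^t* = sqrtmx M.
Proof.
rewrite sqrtmxE !adjM trmxCK !mulmxA tr_diag_mx map_diag_mx.
congr (_ *m diag_mx _ *m _); apply/rowP => i; rewrite !mxE.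
by apply/CrealP; rewrite sqrtC_real // psdm_eigen_ge0.
Qed.

Lemma tr_sqrtmx : \tr (sqrtmx M) = \sum_i sqrtC (d 0 i).
Proof.
rewrite sqrtmxE mxtrace_mulC mulmxA unitary_mulmxV ?spectral_unitary // mul1mx.
by rewrite mxtrace_diag; apply: eq_bigr => i _; rewrite mxE.
Qed.

Lemma tr_spectral : \tr M = \sum_i d 0 i.
Proof.
rewrite psdm_spectral mxtrace_mulC mulmxA unitary_mulmxV ?spectral_unitary //.
by rewrite mul1mx mxtrace_diag.
Qed.

Lemma tr_sqrtmx_ge0 : 0 <= \tr (sqrtmx M).
Proof. by rewrite tr_sqrtmx sumr_ge0 // => i _; rewrite sqrtC_ge0 psdm_eigen_ge0. Qed.

(** In terms of eigenvalues, a sum of squares of nonnegative numbers is at most the square of their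
    sum. This puts the Hilbert-Schmidt norm below the trace norm. *)
Lemma tr_le_sqr_tr_sqrtmx : \tr M <= \tr (sqrtmx M) ^+ 2.
Proof.
rewrite tr_sqrtmx tr_spectral expr2 mulr_suml; apply: ler_sum => i _.
rewrite -{1}(sqrtCK (d 0 i)) expr2 ler_wpM2l ?sqrtC_ge0 ?psdm_eigen_ge0 //.
rewrite (bigD1 i) //= lerDl sumr_ge0 // => j _.
by rewrite sqrtC_ge0 psdm_eigen_ge0.
Qed.

End Spectrum.

Lemma Re_ge0_sqr (x : C) : 0 <= x -> (complex.Re x) ^+ 2 = complex.Re (x ^+ 2).
Proof. by case: x => a b; rewrite lecE /= => /andP[/eqP -> _]; rewrite expr2 /= mulr0 subr0. Qed.

Lemma trace_norm_sqr_ge (n : nat) (M : 'M[C]_n) :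
  complex.Re (\tr (M ^t* *m M)) <= trace_norm M ^+ 2.
Proof.
have pM : psdm (M ^t* *m M).
  have := psdm_conj (M ^t*) (psdm1 n); by rewrite mulmx1 trmxCK.
rewrite /trace_norm Re_ge0_sqr ?tr_sqrtmx_ge0 //.
by have := tr_le_sqr_tr_sqrtmx pM; rewrite lecE => /andP[].
Qed.

Lemma trace_norm_sqrt_sqr_ge n (rho sigma : 'M[C]_n) :
  psdm rho -> psdm sigma ->
  complex.Re (\tr (rho *m sigma)) <= trace_norm (sqrtmx rho *m sqrtmx sigma) ^+ 2.
Proof.
move=> prho psigma; move: (sqrtmx_adj prho) (sqrtmx_sqr prho) (sqrtmx_adj psigma) (sqrtmx_sqr psigma).
move: (sqrtmx rho) (sqrtmx sigma) => S T hS S2 hT T2.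
have := trace_norm_sqr_ge (S *m T); rewrite adjM hS hT -(mulmxA T) (mulmxA S) S2.
by rewrite mxtrace_mulC -mulmxA T2.
Qed.

(** Replaces the fidelity by an expression linear in the decoded state. For a pure [rho] the two
    sides are equal, so nothing is lost at the maximally entangled state. *)
Lemma fidelity_sqr_ge (A : finType) (rho sigma : op R A A) :
  psd rho -> psd sigma ->
  complex.Re (\tr (rho *m sigma)) <= fidelity rho sigma ^+ 2.
Proof. exact: trace_norm_sqrt_sqr_ge. Qed.

End Fidelity.

(** * Kraus maps and entanglement fidelity *)

Section Kraus.
Variable R : realType.
Local Notation C := (complex R).

Definition tens (A B T : finType) (K : op R B A) : op R (B * T)%type (A * T)%type :=
  mkop (fun x y => ent K x.1 y.1 * (x.2 == y.2)%:R).

Definition kraus (I A B : finType) (K : I -> op R B A) (X : op R A A) : op R B B :=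
  \sum_i K i *m X *m (K i) ^t*.

Lemma ent_conj (A B : finType) (K : op R B A) (X : op R A A) b b' :
  ent (K *m X *m K ^t* : op R B B) b b' =
  \sum_a \sum_a' ent K b a * ent X a a' * (ent K b' a')^*.
Proof.
rewrite ent_mul exchange_big /=; apply: eq_bigr => a' _.
by rewrite ent_mul mulr_suml ent_adj.
Qed.

Lemma sum_pair_delta (A T : finType) (t : T) (F : A * T -> C) :
  \sum_z (t == z.2)%:R * F z = \sum_a F (a, t).
Proof.
rewrite (eq_bigr (fun z => (t == z.2)%:R * F (z.1, z.2))) => [|[] //].
rewrite -(pair_bigA _ (fun a u => (t == u)%:R * F (a, u))) /=.
by apply: eq_bigr => a _; under eq_bigr do rewrite eq_sym; rewrite sum_delta.
Qed.

Lemma ampl_conj (A B T : finType) (K : op R B A) (X : op R (A * T)%type (A * T)%type) :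
  ampl (fun Y => K *m Y *m K ^t*) X = tens T K *m X *m (tens T K) ^t*.
Proof.
apply: op_ext => x y; rewrite ent_mkop !ent_conj.
under [RHS]eq_bigr => a _.
  under eq_bigr => a' _.
    rewrite !ent_mkop rmorphM /= conjC_nat.
    rewrite (_ : _ * _ = (y.2 == a'.2)%:R * ((x.2 == a.2)%:R *
      (ent K x.1 a.1 * ent X a a' * (ent K y.1 a'.1)^* ))); last by ring.
    over.
  rewrite (sum_pair_delta y.2 (fun a' => (x.2 == a.2)%:R *
      (ent K x.1 a.1 * ent X a a' * (ent K y.1 a'.1)^* ))) -mulr_sumr.
  over.
rewrite (sum_pair_delta x.2 (fun a => \sum_(b : A)
      (ent K x.1 a.1 * ent X a (b, y.2) * (ent K y.1 b)^* ))) /=.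
by apply: eq_bigr => a _; apply: eq_bigr => a' _; rewrite ent_mkop.
Qed.

Lemma ampl_kraus (I A B T : finType) (K : I -> op R B A) (X : op R (A * T)%type (A * T)%type) :
  ampl (kraus K) X = kraus (fun i => tens T (K i)) X.
Proof.
rewrite /kraus; under eq_bigr do rewrite -ampl_conj.
by apply: op_ext => x y; rewrite ent_sum !ent_mkop ent_sum; apply: eq_bigr => i _; rewrite ent_mkop.
Qed.

Lemma psd_kraus (I A B : finType) (K : I -> op R B A) (X : op R A A) :
  psd X -> psd (kraus K X).
Proof. by move=> pX; apply: psdm_sum => i _; apply: psdm_conj. Qed.

Lemma kraus_comp (I J A B D : finType) (K : I -> op R D B) (L : J -> op R B A) X :
  kraus K (kraus L X) = kraus (fun ij : I * J => K ij.1 *m L ij.2) X.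
Proof.
rewrite /kraus -(pair_bigA _ (fun i j => (K i *m L j) *m X *m (K i *m L j) ^t*)) /=.
apply: eq_bigr => i _; rewrite mulmx_sumr mulmx_suml; apply: eq_bigr => j _.
by rewrite adjM !mulmxA.
Qed.

Lemma quantum_channel_kraus (I A B : finType) (K : I -> op R B A) :
  \sum_i (K i) ^t* *m K i = 1%:M -> quantum_channel (kraus K).
Proof.
move=> sumK; split.
- move=> c X Y; rewrite /kraus scaler_sumr -big_split; apply: eq_bigr => i _ /=.
  by rewrite mulmxDr mulmxDl -scalemxAr -scalemxAl.
- move=> X; rewrite /kraus raddf_sum /= -[in RHS](mul1mx X) -sumK mulmx_suml raddf_sum /=.
  by apply: eq_bigr => i _; rewrite mxtrace_mulC mulmxA.
- by move=> r X pX; rewrite ampl_kraus; exact: psd_kraus.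
Qed.

Lemma psd_max_entangled (A : finType) : psd (max_entangled R A).
Proof.
pose w : op R (A * A)%type unit := mkop (fun x _ => (x.1 == x.2)%:R / sqrtC #|A|%:R).
have -> : max_entangled R A = w *m (1%:M : op R unit unit) *m w ^t*.
  apply: op_ext => x y; rewrite mulmx1 ent_mul (bigD1 tt) //= big1 => [|[] //].
  rewrite ent_adj !ent_mkop addr0 rmorphM /= conjC_nat.
  rewrite conj_Creal ?rpredV ?sqrtC_real ?ler0n //.
  by rewrite mulrACA -invfM -expr2 sqrtCK -natrM mulnb.
by apply: psdm_conj; exact: psdm1.
Qed.

(** The expectation of K (x) 1 in the maximally entangled vector is tr K / d; its squared modulus is
    the entanglement fidelity contributed by one Kraus operator. *)
Lemma tr_tens_max_entangled (A : finType) (K : op R A A) :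
  \tr (max_entangled R A *m (tens A K *m max_entangled R A *m (tens A K) ^t*))
  = `|\tr K| ^+ 2 / #|A|%:R ^+ 2.
Proof.
rewrite -ampl_conj [\tr (_ *m _)]tr_ent.
have entE (x y : A) : ent (ampl (fun Y => K *m Y *m K ^t*) (max_entangled R A)) (x, x) (y, y)
    = ent K x x * (ent K y y)^* / #|A|%:R.
  rewrite ent_mkop ent_conj /=.
  under eq_bigr => a _.
    under eq_bigr => a' _.
      rewrite !ent_mkop /= -mulnb natrM.
      rewrite (_ : _ * _ = (a' == y)%:R * ((a == x)%:R *
        (ent K x a * (ent K y a')^* / #|A|%:R))); last by ring.
      over.
    rewrite sum_delta; over.
  by rewrite sum_delta.
have sum_diag (F : A * A -> C) : \sum_z (z.1 == z.2)%:R * F z = \sum_a F (a, a).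
  rewrite (eq_bigr (fun z => (z.1 == z.2)%:R * F (z.1, z.2))) => [|[] //].
  rewrite -(pair_bigA _ (fun a b => (a == b)%:R * F (a, b))) /=.
  by apply: eq_bigr => a _; under eq_bigr do rewrite eq_sym; rewrite sum_delta.
under eq_bigr => z _.
  rewrite ent_mul; under eq_bigr => z' _.
    rewrite ent_mkop -mulnb natrM -!mulrA mulrCA; over.
  rewrite (sum_diag (fun z' => (z.1 == z.2)%:R * (#|A|%:R^-1 * ent _ z' z))) -mulr_sumr.
  over.
rewrite (sum_diag (fun z => \sum_a (#|A|%:R^-1 * ent _ (a, a) z))).
under eq_bigr do under eq_bigr do rewrite entE.
rewrite exchange_big normCK tr_ent rmorph_sum mulr_suml mulr_suml /=.
apply: eq_bigr => a _; rewrite mulr_sumr mulr_suml; apply: eq_bigr => b _.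
by rewrite expr2 invfM; ring.
Qed.

End Kraus.

Section Decoding.
Variable R : realType.
Local Notation C := (complex R).
Variables (L S S' I J : finType) (z : L).
Variables (V : op R S L) (N : J -> op R S' S).
Variables (K : I -> op R L S') (G : pred I).
Hypothesis orthoK : forall i j, G i -> G j ->
  K i *m (K j) ^t* = (i == j)%:R *: (1%:M : op R L L).

(** By [orthoK] the adjoints of the good [K i] are isometries with pairwise orthogonal ranges, so
    this is the projector onto the sum of the ranges. *)
Let Pi : op R S' S' := \sum_(i | G i) (K i) ^t* *m K i.

Lemma Pi_adj : Pi ^t* = Pi.
Proof.
rewrite /Pi (raddf_sum (@trmx C _ _)) /= (raddf_sum (map_mx (Num.conj : C -> C))) /=.
by apply: eq_bigr => i _; rewrite adjM trmxCK.
Qed.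

Lemma Pi_idem : Pi *m Pi = Pi.
Proof.
rewrite {1 2}/Pi mulmx_suml; apply: eq_bigr => i Gi.
rewrite mulmx_sumr (bigD1 i) //= big1 => [|j /andP[Gj ji]].
  rewrite addr0 mulmxA -(mulmxA ((K i) ^t*)) orthoK // eqxx scale1r mulmx1 //.
rewrite mulmxA -(mulmxA ((K i) ^t*)) orthoK // eq_sym (negPf ji) scale0r.
by rewrite mulmx0 mul0mx.
Qed.

Definition ketbra (y : S') : op R L S' := mkop (fun a b => (a == z)%:R * (b == y)%:R).

Lemma sum_ketbra : \sum_y (ketbra y) ^t* *m ketbra y = 1%:M.
Proof.
apply: op_ext => a b; rewrite ent_sum ent1.
under eq_bigr => y _.
  rewrite ent_mul; under eq_bigr => l _.
    rewrite ent_adj !ent_mkop rmorphM /= !conjC_nat -mulrA; over.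
  rewrite sum_delta eqxx mul1r (eq_sym a); over.
by rewrite sum_delta eq_sym.
Qed.

(** The summands [inr] measure the complement of the recovered subspaces and
    prepare the fixed state [z], which makes the map trace preserving. *)
Definition decoder (i : I + S') : op R L S' :=
  match i with
  | inl i => if G i then K i else 0
  | inr y => ketbra y *m (1%:M - Pi)
  end.

Lemma decoder_channel : quantum_channel (kraus decoder).
Proof.
apply: quantum_channel_kraus; rewrite big_sumType /=.
have -> : \sum_i ((if G i then K i else 0) ^t* *m (if G i then K i else 0)) = Pi.
  rewrite /Pi [RHS]big_mkcond; apply: eq_bigr => i _; case: (G i) => //.
  by rewrite mulmx0.
under eq_bigr => y _ do rewrite adjM -mulmxA (mulmxA _ (ketbra y)).
rewrite -mulmx_sumr -mulmx_suml sum_ketbra mul1mx.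
have -> : (1%:M - Pi) ^t* = 1%:M - Pi.
  by rewrite -scaleN1r adjD adjZ adj1 Pi_adj rmorphN1.
rewrite mulmxBl mul1mx mulmxBr mulmx1 Pi_idem subrr subr0.
by rewrite addrC subrK.
Qed.

Lemma purified_distance_ge0 (A : finType) (rho sigma : op R A A) :
  0 <= purified_distance rho sigma.
Proof. exact: sqrtr_ge0. Qed.

(** The squared fidelity is at least the sum of the contributions of all pairs of a decoding and a
    noise operator. Those of the fallback operators are nonnegative and dropped; [g] bounds what
    remains. *)
Lemma choi_error_le (E : op R L L -> op R S S) (noise : op R S S -> op R S' S') (g : R) :
  (forall X, E X = V *m X *m V ^t*) -> (forall X, noise X = kraus N X) ->
  g%:C%C <= \sum_(i | G i) \sum_j `|\tr (K i *m N j *m V)| ^+ 2 / #|L|%:R ^+ 2 ->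
  choi_error E noise <= Num.sqrt (1 - g).
Proof.
move=> EV noiseN gle.
have chE : (fun X => kraus decoder (noise (E X)))
    = kraus (fun ij : (I + S') * J => decoder ij.1 *m N ij.2 *m V).
  apply/funext => X; rewrite noiseN EV kraus_comp /kraus; apply: eq_bigr => ij _.
  by rewrite !adjM !mulmxA.
set D := fun X => _ in chE.
have : choi_error E noise <= purified_distance (max_entangled R L) (ampl D (max_entangled R L)).
  apply: ge_inf; first by exists 0 => _ [D' _ ->]; exact: purified_distance_ge0.
  by exists (kraus decoder) => //; exact: decoder_channel.
move=> /le_trans; apply; apply: ler_wsqrtr; rewrite lerD2l lerN2.
have pD : psd (ampl D (max_entangled R L)).
  by rewrite chE ampl_kraus; apply: psd_kraus; exact: psd_max_entangled.
apply: le_trans (fidelity_sqr_ge (psd_max_entangled _ _) pD).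
suff : g%:C%C <= \tr (max_entangled R L *m ampl D (max_entangled R L)).
  by rewrite lecE => /andP[].
apply: (le_trans gle); rewrite chE ampl_kraus /kraus mulmx_sumr raddf_sum /=.
under [leRHS]eq_bigr do rewrite tr_tens_max_entangled.
rewrite -(pair_bigA _ (fun i j => `|\tr (decoder i *m N j *m V)| ^+ 2 / #|L|%:R ^+ 2)) /=.
rewrite big_sumType /=; apply: ler_wpDr.
  by apply: sumr_ge0 => i _; apply: sumr_ge0 => j _; rewrite divr_ge0 // exprn_ge0 // ler0n.
rewrite [leLHS]big_mkcond; apply: ler_sum => i _ /=; case: (G i) => //.
by apply: sumr_ge0 => j _; rewrite divr_ge0 // exprn_ge0 // ler0n.
Qed.

End Decoding.

(** * Erasure noise and the Knill-Laflamme conditions *)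

Lemma sum_bits_prod (K : comPzRingType) n (F : 'I_n -> bool -> K) :
  \sum_(x : bits n) \prod_q F q (x q) = \prod_q (F q true + F q false).
Proof.
by rewrite -(bigA_distr_bigA F); apply: eq_bigr => q _; rewrite big_bool.
Qed.

Lemma sum_label_prod (K : comPzRingType) n (F : 'I_n -> bool * bool -> K) :
  \sum_(s : pauli_label n) \prod_q F q (s q) = \prod_q \sum_a F q a.
Proof. by rewrite -(bigA_distr_bigA F). Qed.

Section Erasure.
Variable R : realType.
Local Notation C := (complex R).
Variable n : nat.
Implicit Types (A a b x z : bits n) (y : {ffun 'I_n -> option bool}).

Definition erase A x : {ffun 'I_n -> option bool} :=
  [ffun q => if A q then None else Some (x q)].

Definition below a A := [forall q, a q ==> A q].

Definition reads A a x := [forall q, A q ==> (x q == a q)].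

(** The Kraus operator that erases the qubits of [A] and finds the bits [a] there;
    only the values of [a] on [A] matter, so [a] is taken below [A]. *)
Definition Er A a : op R {ffun 'I_n -> option bool} (bits n) :=
  mkop (fun y x => (y == erase A x)%:R * (reads A a x)%:R).

Definition pattern_prob (p : R) A : R := \prod_q (if A q then p else 1 - p).

Definition noise_kraus (p : R) (j : bits n * bits n) :
    op R {ffun 'I_n -> option bool} (bits n) :=
  ((below j.2 j.1)%:R * (Num.sqrt (pattern_prob p j.1))%:C%C) *: Er j.1 j.2.

Lemma pattern_prob_ge0 p A : 0 <= p <= 1 -> 0 <= pattern_prob p A.
Proof.
by move=> /andP[p0 p1]; apply: prodr_ge0 => q _; case: ifP; rewrite ?subr_ge0.
Qed.

Lemma eq_erase y A x :
  (y == erase A x)%:R = \prod_q (y q == if A q then None else Some (x q))%:R :> C.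
Proof.
rewrite prod_bool; congr (nat_of_bool _)%:R; apply/eqP/forallP => [-> q|H].
  by rewrite ffunE eqxx.
by apply/ffunP => q; rewrite ffunE; exact/eqP/H.
Qed.

Lemma belowE a A : (below a A)%:R = \prod_q (a q ==> A q)%:R :> C.
Proof. by rewrite prod_bool. Qed.

Lemma readsE A a x : (reads A a x)%:R = \prod_q (A q ==> (x q == a q))%:R :> C.
Proof. by rewrite prod_bool. Qed.

Lemma pattern_probE p A :
  (pattern_prob p A)%:C%C = \prod_q (if A q then p%:C%C else (1 - p)%:C%C).
Proof. by rewrite rmorph_prod; apply: eq_bigr => q _; case: ifP. Qed.

Lemma tensor_power_erasure (p : R) X : 0 <= p <= 1 ->
  tensor_power (erasure p) X = kraus (noise_kraus p) X.
Proof.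
move=> p01; apply: op_ext => y y'; rewrite ent_mkop /kraus ent_sum.
under [RHS]eq_bigr do rewrite ent_conj.
rewrite [RHS]exchange_big /=; apply: eq_bigr => u _.
rewrite [RHS]exchange_big /=; apply: eq_bigr => v _.
transitivity (ent X u v * \sum_(j : bits n * bits n)
    (below j.2 j.1)%:R * (pattern_prob p j.1)%:C%C *
    ((y == erase j.1 u)%:R * (reads j.1 j.2 u)%:R) *
    ((y' == erase j.1 v)%:R * (reads j.1 j.2 v)%:R)); last first.
  rewrite mulr_sumr; apply: eq_bigr => j _; rewrite !entZ !ent_mkop.
  rewrite !rmorphM /= !conjC_nat.
  have -> : ((Num.sqrt (pattern_prob p j.1))%:C%C)^* = (Num.sqrt (pattern_prob p j.1))%:C%C :> C.
    by apply: conj_Creal; rewrite complex_real.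
  have -> : (pattern_prob p j.1)%:C%C =
      (Num.sqrt (pattern_prob p j.1))%:C%C * (Num.sqrt (pattern_prob p j.1))%:C%C :> C.
    by rewrite -rmorphM -expr2 sqr_sqrtr // pattern_prob_ge0.
  by case: (below _ _); rewrite ?mulr1n ?mulr0n; ring.
congr (_ * _).
rewrite -(pair_bigA _ (fun A a => (below a A)%:R * (pattern_prob p A)%:C%C *
    ((y == erase A u)%:R * (reads A a u)%:R) *
    ((y' == erase A v)%:R * (reads A a v)%:R))) /=.
(* Both sides factor over qubits. [T q c b] is the contribution of qubit [q] with erasure flag [c]
   and lost bit [b]; a finite case analysis per qubit remains. *)
pose T q (c b : bool) : C := (b ==> c)%:R * (if c then p%:C%C else (1 - p)%:C%C) *
  ((y q == if c then None else Some (u q))%:R * (c ==> (u q == b))%:R) *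
  ((y' q == if c then None else Some (v q))%:R * (c ==> (v q == b))%:R).
transitivity (\sum_(A : bits n) \sum_(a : bits n) \prod_q T q (A q) (a q)); last first.
  apply: eq_bigr => A _; apply: eq_bigr => a _.
  by rewrite belowE pattern_probE !eq_erase !readsE -!big_split.
under [RHS]eq_bigr do rewrite (sum_bits_prod (fun q d => T q _ d)).
rewrite (sum_bits_prod (fun q c => T q c true + T q c false)).
apply: eq_bigr => q _; rewrite ent_mkop /T.
have trE (c c' : bool) : \tr (mkop (fun d d' => ((d == c) && (d' == c'))%:R) : op R bool bool)
    = (c == c')%:R.
  rewrite tr_ent big_bool /= !ent_mkop.
  by case: c c' => [] []; rewrite /= ?addr0 ?add0r.
case: (y q) (y' q) => [[]|] [[]|]; rewrite ?ent_mkop ?trE;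
  by case: (u q) (v q) => [] [];
  rewrite /= ?(mulr0, mul0r, mulr1, mul1r, addr0, add0r).
Qed.

Definition xzlabel a z : pauli_label n := [ffun q => (a q, z q)].

Definition lbelow (s : pauli_label n) A :=
  [forall q, (s q != (false, false)) ==> A q].

(** This is 2^|A|, the number of strings below [A]; the product form fits [sum_bits_prod]. *)
Definition pow2 A : C := \prod_q (if A q then 2 else 1).

Lemma pow2_neq0 A : pow2 A != 0.
Proof. by apply/prodf_neq0 => q _; case: ifP; rewrite ?oner_eq0 ?pnatr_eq0. Qed.

Lemma pow2_ge0 A : 0 <= pow2 A.
Proof. by apply: prodr_ge0 => q _; case: ifP; rewrite ?ler01 ?ler0n. Qed.

Lemma ler_sum_one (I : finType) (F : I -> C) i :
  (forall j, 0 <= F j) -> F i <= \sum_j F j.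
Proof. by move=> F0; rewrite (bigD1 i) //= lerDl sumr_ge0. Qed.

(** The left side is |a><b| on the erased qubits tensored with the identity elsewhere. It equals
    X^(a+b) times the projector onto [b] on [A], and that projector is the average of (-1)^(z.b) Z^z
    over [z] below [A]. Dividing by [iphase] undoes the normalisation of [pauli]. *)
Lemma Er_expand A a b : below a A -> below b A ->
  (Er A a) ^t* *m Er A b = \sum_(z | below z A)
    ((pow2 A)^-1 * zsign R (xzlabel (xorb a b) z) b / iphase R (xzlabel (xorb a b) z))
    *: pauli R (xzlabel (xorb a b) z).
Proof.
move=> aA bA; apply: op_ext => x x'; rewrite ent_mul ent_sum.
under eq_bigr => y _ do rewrite ent_adj !ent_mkop rmorphM /= !conjC_nat -mulrA.
rewrite sum_delta.
have xpE z : xpart (xzlabel (xorb a b) z) = xorb a b.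
  by apply/ffunP => q; rewrite !ffunE.
have termE z : ent (((pow2 A)^-1 * zsign R (xzlabel (xorb a b) z) b /
      iphase R (xzlabel (xorb a b) z)) *: pauli R (xzlabel (xorb a b) z)) x x' =
    (x == xorb (xorb a b) x')%:R *
     ((pow2 A)^-1 * zsign R (xzlabel (xorb a b) z) (xorb b x')).
  rewrite entZ ent_pauli xpE zsign_xorb.
  have := phase_neq0 (phase_iphase R (xzlabel (xorb a b) z)).
  by have := pow2_neq0 A; move: (iphase _ _) (pow2 A) => i w w0 i0; field; rewrite i0 w0.
under [RHS]eq_bigr do rewrite termE.
rewrite -mulr_sumr -mulr_sumr big_mkcond /=.
have -> : \sum_z (if below z A then zsign R (xzlabel (xorb a b) z) (xorb b x') else 0)
    = \prod_q ((~~ (A q) || (x' q == b q))%:R * (if A q then 2 else 1)) :> C.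
  transitivity (\sum_(z : bits n) \prod_q ((z q ==> A q)%:R *
     (-1) ^+ (z q && (b q (+) x' q)) : C)).
    apply: eq_bigr => z _; rewrite big_split -belowE /=; case: (below z A).
      by rewrite mul1r; apply: eq_bigr => q _; rewrite !ffunE.
    by rewrite mul0r.
  rewrite (sum_bits_prod (fun q c => (c ==> A q)%:R * (-1) ^+ (c && (b q (+) x' q)))).
  apply: eq_bigr => q _; case: (A q) (x' q) (b q) => [] [] [] /=;
  by rewrite ?(mul1r, mul0r, expr0, expr1, add0r) ?addNr.
rewrite big_split /= -/(pow2 A) [_ * pow2 A]mulrC mulKf ?pow2_neq0 // prod_bool.
rewrite -!natrM !mulnb; congr (nat_of_bool _)%:R.
apply/and3P/andP => [[/forallP xa /eqP/ffunP xx' /forallP xb]|[/eqP -> /forallP xb]].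
  split; last by apply/forallP => q; have := xb q; rewrite implybE.
  apply/eqP/ffunP => q; have := xa q; have := xx' q; have := xb q; rewrite !ffunE.
  case Aq: (A q) => /=; first by move=> /eqP -> _ /eqP ->; rewrite -addbA addbb addbF.
  move: (forallP aA q) (forallP bA q); rewrite Aq !implybF => /negPf -> /negPf ->.
  by move=> _ [->] _; case: (x' q).
split.
- apply/forallP => q; apply/implyP => Aq; rewrite !ffunE.
  by have := xb q; rewrite Aq /= => /eqP ->; rewrite -addbA addbb addbF.
- apply/eqP/ffunP => q; rewrite !ffunE; case Aq: (A q) => //.
  move: (forallP aA q) (forallP bA q); rewrite Aq !implybF => /negPf -> /negPf ->.
  by case: (x' q).
- by apply/forallP => q; rewrite implybE; exact: xb.
Qed.

Lemma Er_ortho A A' a b : A != A' -> (Er A a) ^t* *m Er A' b = 0.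
Proof.
move=> AA'; apply: op_ext => x x'; rewrite ent0 ent_mul.
under eq_bigr => y _ do rewrite ent_adj !ent_mkop rmorphM /= !conjC_nat -mulrA.
rewrite sum_delta; case: eqP => [/ffunP E|]; last by rewrite mul0r mulr0.
case/eqP: AA'; apply/ffunP => q; have := E q; rewrite !ffunE.
by case: (A q) (A' q) => [] [].
Qed.

Section KnillLaflamme.
Variables (L : finType) (z0 : L) (V : op R (bits n) L).
Hypothesis isoV : V ^t* *m V = 1%:M.
Variable p : R.
Hypothesis p01 : 0 <= p <= 1.

(** Stricter than Knill-Laflamme, which would allow a nonzero multiple of the identity: stabiliser
    elements supported on [A] count as undetected, just as the union bound counts them. *)
Definition detects A : Prop :=
  forall s, s != lzero n -> lbelow s A -> V ^t* *m pauli R s *m V = 0.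

Lemma detects_KL A a b : detects A -> below a A -> below b A ->
  V ^t* *m ((Er A a) ^t* *m Er A b) *m V = ((a == b)%:R / pow2 A) *: (1%:M : op R L L).
Proof.
move=> det aA bA; rewrite Er_expand // mulmx_sumr mulmx_suml.
have supp z : below z A -> lbelow (xzlabel (xorb a b) z) A.
  move=> zA; apply/forallP => q; rewrite !ffunE.
  move: (forallP aA q) (forallP bA q) (forallP zA q).
  by case: (A q) (a q) (b q) (z q) => [] [] [] [].
have [ab|ab] := eqVneq a b.
  subst b; have aa : xorb a a = [ffun=> false] by apply/ffunP => q; rewrite !ffunE addbb.
  have l0 : xzlabel [ffun=> false] [ffun=> false] = lzero n.
    by apply/ffunP => q; rewrite !ffunE.
  rewrite (bigD1 [ffun=> false]) /=; last by apply/forallP => q; rewrite ffunE.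
  rewrite big1 => [|z /andP[zA z0']]; last first.
    rewrite -scalemxAr -scalemxAl (det (xzlabel (xorb a a) z)) ?scaler0 //.
      apply: contra z0' => /eqP/ffunP E; apply/eqP/ffunP => q.
      by have := E q; rewrite !ffunE => -[].
    exact: supp.
  rewrite aa l0 addr0 -scalemxAr -scalemxAl pauli0 mulmx1 isoV.
  congr (_ *: _); rewrite /zsign /iphase !big1 ?invr1 ?mulr1 ?mul1r //.
  by move=> q _; rewrite ffunE.
  by move=> q _; rewrite ffunE.
rewrite big1 ?mul0r ?scale0r // => z zA.
rewrite -scalemxAr -scalemxAl (det (xzlabel (xorb a b) z)) ?scaler0 //.
  apply: contra ab => /eqP/ffunP E; apply/eqP/ffunP => q.
  by have := E q; rewrite !ffunE => -[/negbT]; case: (a q) (b q) => [] [].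
exact: supp.
Qed.

(** On a detected pattern, [detects_KL] makes [Er] after [V] an isometry up to the factor
    2^(-|A|/2), which the square root compensates. *)
Definition recovery (j : bits n * bits n) : op R L {ffun 'I_n -> option bool} :=
  sqrtC (pow2 j.1) *: (V ^t* *m (Er j.1 j.2) ^t*).

Definition recoverable (j : bits n * bits n) : bool :=
  `[< detects j.1 >] && below j.2 j.1.

Lemma recovery_ortho i j : recoverable i -> recoverable j ->
  recovery i *m (recovery j) ^t* = (i == j)%:R *: (1%:M : op R L L).
Proof.
case: i j => [A a] [A' b] /= /andP[/asboolP det aA] /andP[_ bA] /=.
rewrite /recovery /= adjZ adjM !trmxCK -scalemxAl -scalemxAr scalerA.
rewrite !mulmxA -(mulmxA (V ^t*)); have [AA'|AA'] := eqVneq A A'; last first.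
  by rewrite Er_ortho // mulmx0 mul0mx scaler0 xpair_eqE (negPf AA') scale0r.
case: _ / AA' bA => bA; rewrite detects_KL // scalerA xpair_eqE eqxx /=; congr (_ *: _).
rewrite conj_Creal ?sqrtC_real ?pow2_ge0 // -expr2 sqrtCK.
by rewrite mulrCA mulfV ?pow2_neq0 ?mulr1.
Qed.

Lemma card_below A : \sum_(a | below a A) 1 = pow2 A.
Proof.
rewrite big_mkcond /=; transitivity (\sum_(a : bits n) \prod_q (a q ==> A q)%:R : C).
  by apply: eq_bigr => a _; rewrite -belowE; case: below.
rewrite (sum_bits_prod (fun q c => (c ==> A q)%:R)); apply: eq_bigr => q _.
by case: (A q) => /=; rewrite ?add0r // -natrD.
Qed.

Lemma choi_error_erasure (E : op R L L -> op R (bits n) (bits n)) :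
  (forall X, E X = V *m X *m V ^t*) ->
  choi_error E (tensor_power (erasure p)) <=
  Num.sqrt (1 - \sum_(A : bits n | `[< detects A >]) pattern_prob p A).
Proof.
move=> EV; apply: (choi_error_le z0 recovery_ortho EV (N := noise_kraus p)).
  by move=> X; exact: tensor_power_erasure.
have L0 : #|L|%:R != 0 :> C by rewrite pnatr_eq0 -lt0n; apply/card_gt0P; exists z0.
(* Each lost string [a] of a detected pattern contributes its share 2^-|A| of the pattern
   probability; by [card_below] the shares add up to the whole. *)
have term A a : recoverable (A, a) ->
    `|\tr (recovery (A, a) *m noise_kraus p (A, a) *m V)| ^+ 2 / #|L|%:R ^+ 2
    = (pattern_prob p A)%:C%C / pow2 A.
  move=> /andP[/asboolP det aA]; rewrite /recovery /noise_kraus /= aA mul1r.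
  rewrite -!scalemxAl -!scalemxAr -!scalemxAl scalerA -(mulmxA (V ^t*)) detects_KL //.
  rewrite eqxx scalerA mxtraceZ mxtrace1 !normrM normfV !exprMn !normr_nat.
  rewrite mulfK ?expf_neq0 // -!normrX expr1n sqrtCK -rmorphXn /= sqr_sqrtr ?pattern_prob_ge0 //.
  rewrite !ger0_norm ?pow2_ge0 ?ler0c ?pattern_prob_ge0 // ?exprn_ge0 ?pow2_ge0 //.
  by have := pow2_neq0 A; move: (pow2 A) => w w0; field.
apply: (@le_trans _ _ (\sum_(j | recoverable j) (pattern_prob p j.1)%:C%C / pow2 j.1)).
  rewrite rmorph_sum /= -(pair_big_dep (fun A : bits n => `[< detects A >]) (fun A a => below a A)
     (fun A a => (pattern_prob p A)%:C%C / pow2 A)) /=.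
  apply: ler_sum => A _; rewrite -mulr_sumr.
  rewrite (eq_bigr (fun=> (pow2 A)^-1 * 1)) => [|a _]; last by rewrite mulr1.
  by rewrite -mulr_sumr card_below mulVf ?pow2_neq0 // mulr1.
apply: ler_sum => -[A a] rA; rewrite -(term _ _ rA).
apply: (@ler_sum_one _ (fun j => `|\tr (recovery (A, a) *m noise_kraus p j *m V)| ^+ 2 / #|L|%:R ^+ 2)).
by move=> j; rewrite divr_ge0 // exprn_ge0 // ler0n.
Qed.

End KnillLaflamme.
End Erasure.

(** * Averages over the ensemble *)

Section UniformMean.
Variable R : realType.

Lemma uniform_mean_const (T : finType) (P : {pred T}) (c : R) :
  (0 < #|P|)%N -> uniform_mean P (fun=> c) = c.
Proof.
move=> P0; rewrite /uniform_mean sumr_const -(mulr_natr c) mulfK //.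
by rewrite pnatr_eq0 -lt0n.
Qed.

Lemma eq_uniform_mean (T : finType) (P : {pred T}) (f g : T -> R) :
  {in P, f =1 g} -> uniform_mean P f = uniform_mean P g.
Proof. by move=> fg; rewrite /uniform_mean (eq_bigr g). Qed.

Lemma le_uniform_mean (T : finType) (P : {pred T}) (f g : T -> R) :
  {in P, forall t, f t <= g t} -> uniform_mean P f <= uniform_mean P g.
Proof.
by move=> fg; rewrite /uniform_mean ler_wpM2r ?invr_ge0 ?ler0n // ler_sum.
Qed.

Lemma uniform_mean_sum (T I : finType) (P : {pred T}) (Q : pred I) (F : I -> T -> R) :
  uniform_mean P (fun t => \sum_(i | Q i) F i t) = \sum_(i | Q i) uniform_mean P (F i).
Proof. by rewrite /uniform_mean exchange_big mulr_suml. Qed.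

(** Jensen's inequality for the square root, obtained from the nonnegative variance of the square
    root of [f]. *)
Lemma mean_sqrt_le (T : finType) (P : {pred T}) (f : T -> R) :
  (0 < #|P|)%N -> {in P, forall t, 0 <= f t} ->
  uniform_mean P (fun t => Num.sqrt (f t)) <= Num.sqrt (uniform_mean P f).
Proof.
move=> P0 f0; have c0 : 0 < #|P|%:R :> R by rewrite ltr0n.
set g := fun t => Num.sqrt (f t); set M := uniform_mean P g.
have M0 : 0 <= M.
  by rewrite /M /uniform_mean divr_ge0 ?ler0n // sumr_ge0 // => t _; exact: sqrtr_ge0.
rewrite -(ger0_norm M0) -sqrtr_sqr; apply: ler_wsqrtr.
have : 0 <= uniform_mean P (fun t => (g t - M) ^+ 2).
  by rewrite /uniform_mean divr_ge0 ?ler0n // sumr_ge0 // => t _; exact: sqr_ge0.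
have -> : uniform_mean P (fun t => (g t - M) ^+ 2) = uniform_mean P f - M ^+ 2.
  transitivity (uniform_mean P (fun t => f t + ((- 2 * M) * g t + M ^+ 2))).
    apply: eq_uniform_mean => t Pt; rewrite -[f t]sqr_sqrtr ?f0 // -/(g t).
    by ring.
  rewrite /uniform_mean !big_split /= -mulr_sumr !mulrDl -mulrA -/(uniform_mean P g) -/M.
  by rewrite sumr_const -(mulr_natr (M ^+ 2)) mulfK ?gt_eqF //; ring.
by rewrite subr_ge0.
Qed.

Section Resample.
Variables (I X : finType) (Q : {pred X}) (j : I).
Hypothesis Q0 : (0 < #|Q|)%N.
Variable H : X -> {ffun I -> X} -> R.
Hypothesis Hj : forall x (t t' : {ffun I -> X}),
  (forall i, i != j -> t i = t' i) -> H x t = H x t'.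

(** Exchanging the coordinate [t j] with an independent fresh sample is an involution of the
    pairs. *)
Lemma resample : uniform_mean (ffun_on Q) (fun t => H (t j) t)
  = uniform_mean (ffun_on Q) (fun t => uniform_mean Q (fun x => H x t)).
Proof.
rewrite {1 2}/uniform_mean; congr (_ / _).
rewrite /uniform_mean -mulr_suml; have c0 : #|Q|%:R != 0 :> R by rewrite pnatr_eq0 -lt0n.
apply: (mulIf c0); rewrite divfK //.
pose upd (t : {ffun I -> X}) x : {ffun I -> X} := [ffun i => if i == j then x else t i].
pose h (tx : {ffun I -> X} * X) := (upd tx.1 tx.2, tx.1 j).
have hK : involutive h.
  move=> [t x]; rewrite /h /= ffunE eqxx; congr pair.
  by apply/ffunP => i; rewrite !ffunE; case: eqP => // ->.
transitivity (\sum_(t in ffun_on Q) \sum_(x in Q) H (t j) t).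
  by rewrite mulr_suml; apply: eq_bigr => t _; rewrite sumr_const mulr_natr.
rewrite !pair_big /= (reindex_inj (inv_inj hK)) /=; apply: eq_big => [[t x]|[t x] _] /=.
  apply/andP/andP => -[/ffun_onP tQ xQ]; split.
  - apply/ffun_onP => i; have := tQ i; rewrite ffunE.
    by case: eqP => [->|].
  - by have := tQ j; rewrite ffunE eqxx.
  - by apply/ffun_onP => i; rewrite ffunE; case: eqP.
  - exact: tQ.
rewrite ffunE eqxx; apply: Hj => i /negPf ij; by rewrite ffunE ij.
Qed.

End Resample.

End UniformMean.

(** * Gate averages as operators on functions of labels *)

Section TableauAverages.
Variable R : realType.
Variables (n m J : nat) (off : 'I_J -> nat).
Hypothesis le_n : forall j, (off j + m <= n)%N.
Local Notation lab := (pauli_label n).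
Local Notation loc := (pauli_label m).
Local Notation cl := (clifford_classes R m).
Implicit Types (s : lab) (u : loc) (j : 'I_J) (f : lab -> R) (l : seq 'I_J).

Definition tact j (tau : tableau m) s : lab :=
  lpatch (off j) s (tau (lwin (off j) m s)).2.

Definition circuit_label (t : {ffun 'I_J -> tableau m}) l s : lab :=
  foldr (fun j s' => tact j (t j) s') s l.

(** The adjoint action of gate [j], averaged over its tableau, on functions of
    Pauli labels. *)
Definition avg j f s : R := uniform_mean (mem cl) (fun tau => f (tact j tau s)).

Lemma circuit_label_eq (t t' : {ffun 'I_J -> tableau m}) l s : {in l, t =1 t'} ->
  circuit_label t l s = circuit_label t' l s.
Proof.
elim: l => //= j l IH tt'; rewrite IH => [|i il]; last by rewrite tt' // inE il orbT.
by rewrite tt' // inE eqxx.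
Qed.

Lemma mean_circuit_label l f s : uniq l ->
  uniform_mean (ffun_on (mem cl)) (fun t => f (circuit_label t l s))
  = foldl (fun g j => avg j g) f l s.
Proof.
elim: l f => [|j l IH] f /= => [_|/andP[jl ul]].
  apply: uniform_mean_const; rewrite card_ffun_on expn_gt0.
  by rewrite (_ : (0 < #|mem cl|)%N) //; exact: clifford_classes_gt0.
rewrite -IH //; apply: (@resample R 'I_J (tableau m) (mem cl) j (clifford_classes_gt0 R m)
  (fun x t => f (tact j x (circuit_label t l s)))).
move=> x t t' tt'; congr (f (tact _ _ _)); apply: circuit_label_eq => i il.
by apply: tt'; apply: contraNneq jl => <-.
Qed.

Lemma lwin_lpatch j s u : lwin (off j) m (lpatch (off j) s u) = u.
Proof. exact: gwin_patch. Qed.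

Lemma lpatch_lwin_id j s : lpatch (off j) s (lwin (off j) m s) = s.
Proof.
by apply: (@patch_gwin _ (false, false) _ _ _ (le_n j)); apply/agreeP => q _.
Qed.

Lemma lpatch_lpatch j s u (v : loc) : lpatch (off j) (lpatch (off j) s u) v = lpatch (off j) s v.
Proof.
apply/ffunP => q; have [/(inwinP (le_n j))[i ->]|nq] := boolP (inwin (off j) m q).
  by rewrite !(patch_in (le_n j)).
by rewrite !patch_out.
Qed.

Let nz := #|pauli_label m|.-1.

Lemma avgE j f s : avg j f s =
  if lwin (off j) m s == lzero m then f s
  else (\sum_(u | u != lzero m) f (lpatch (off j) s u)) / nz%:R.
Proof.
rewrite /avg /tact; case: eqP => [E|/eqP ne]; last first.
  by rewrite (mean_tableau (fun u => f (lpatch (off j) s u)) ne).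
rewrite -[RHS](uniform_mean_const (P := mem cl) (f s)); last exact: clifford_classes_gt0.
apply: eq_uniform_mean => tau tau_in.
by rewrite E (tableau_lzero tau_in) -E lpatch_lwin_id.
Qed.

(** The averaging kernel is symmetric: exchanging the content of the window with its resampled value
    is an involution. *)
Lemma avg_adjoint j f g : \sum_s f s * avg j g s = \sum_s avg j f s * g s.
Proof.
rewrite (bigID (fun s => lwin (off j) m s == lzero m)) [RHS](bigID (fun s => lwin (off j) m s == lzero m)) /=.
congr (_ + _); first by apply: eq_bigr => s E; rewrite !avgE E.
under eq_bigr => s /negPf E do rewrite avgE E mulrA mulr_sumr.
under [RHS]eq_bigr => s /negPf E do rewrite avgE E mulrAC mulr_suml.
rewrite -!mulr_suml; congr (_ / _).
pose h (su : lab * loc) := (lpatch (off j) su.1 su.2, lwin (off j) m su.1).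
have hK : involutive h.
  by move=> [s u]; rewrite /h /= lwin_lpatch lpatch_lpatch lpatch_lwin_id.
rewrite !pair_big /= (reindex_inj (inv_inj hK)) /=.
apply: eq_big => [[s u]|[s u] _] /=; first by rewrite lwin_lpatch andbC.
by rewrite lpatch_lpatch lpatch_lwin_id.
Qed.

Lemma foldl_avg_adjoint l f g :
  \sum_s f s * foldl (fun g j => avg j g) g l s
  = \sum_s foldl (fun g j => avg j g) f (rev l) s * g s.
Proof.
elim: l f g => //= j l IH f g; rewrite IH avg_adjoint.
by rewrite rev_cons -cats1 foldl_cat.
Qed.

Section ProductFunctions.
Variable phi : 'I_n -> bool * bool -> R.
Hypothesis phi0 : forall q, phi q (false, false) = 1.
Variable w : R.

Definition covered l (q : nat) := has (fun j => inwin (off j) m q) l.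

Definition window_weight u : R := if u == lzero m then 1 else w.

(** The shape of a product function once the disjoint gates of [l] have been averaged: of each
    window only the vanishing of the label survives, while uncovered qubits keep their factors. *)
Definition blocked l s : R :=
  (\prod_(j <- l) window_weight (lwin (off j) m s)) *
  \prod_(q : 'I_n | ~~ covered l q) phi q (s q).

(** The sum over all local labels factors over qubits; the [- 1] takes away the zero label, whose
    product is 1 by [phi0]. *)
Definition window_avg j : R :=
  (\prod_(q < m) (\sum_a phi (winord (le_n j) q) a) - 1) / nz%:R.

Lemma avg_blocked l j s :
  (forall i, i \in l -> forall q, inwin (off j) m q -> ~~ inwin (off i) m q) ->
  window_avg j = w ->
  avg j (blocked l) s = blocked (j :: l) s.
Proof.
move=> disj wj; rewrite avgE.
have blockedE u : blocked l (lpatch (off j) s u) =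
    \prod_(q < m) phi (winord (le_n j) q) (u q) *
    ((\prod_(i <- l) window_weight (lwin (off i) m s)) *
     \prod_(q : 'I_n | ~~ covered (j :: l) q) phi q (s q)).
  rewrite /blocked mulrCA; congr (_ * _).
    apply: eq_big_seq => i il; congr window_weight.
    apply/ffunP => q; rewrite !(gwinE _ (le_n i)) patch_out //.
    apply/negP => /(disj i il); by rewrite inwin_winord.
  rewrite (bigID (fun q : 'I_n => inwin (off j) m q)) /=; congr (_ * _).
    transitivity (\prod_(q : 'I_n | inwin (off j) m q) phi q (lpatch (off j) s u q)).
      apply: eq_bigl => q; case: (boolP (inwin _ _ _)) => jq; rewrite ?andbF // andbT.
      by apply/hasPn => i il; exact: disj jq.
    rewrite (prod_inwin (le_n j)); apply: eq_bigr => q _.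
    by rewrite (patch_in (le_n j)).
  apply: eq_big => [q|q /andP[_ nq]]; first by rewrite /covered /= negb_or andbC.
  by rewrite patch_out.
rewrite [RHS]/blocked big_cons {1}/window_weight; case: eqP => [E|_].
  rewrite mul1r -{1}(lpatch_lwin_id j s) blockedE E big1 ?mul1r // => q _.
  by rewrite ffunE phi0.
rewrite (eq_bigr _ (fun u _ => blockedE u)).
rewrite -mulr_suml mulrAC -[RHS]mulrA; congr (_ * _); rewrite -wj /window_avg; congr (_ / _).
rewrite -(sum_label_prod (fun q a => phi (winord (le_n j) q) a)).
rewrite [in RHS](bigD1 (lzero m)) //= [X in _ = X + _ - 1]big1 => [|q _]; last by rewrite ffunE phi0.
by rewrite addrAC subrr add0r.
Qed.

Lemma foldl_avg_blocked l s : uniq l ->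
  (forall i j, i \in l -> j \in l -> i != j ->
     forall q, inwin (off j) m q -> ~~ inwin (off i) m q) ->
  (forall j, j \in l -> window_avg j = w) ->
  foldl (fun g j => avg j g) (fun s => \prod_q phi q (s q)) l s = blocked (rev l) s.
Proof.
elim/last_ind: l s => [|l j IH] s.
  move=> _ _ _; rewrite /blocked big_nil mul1r /=.
  by apply: eq_bigl => q.
rewrite rcons_uniq -cats1 => /andP[jl ul] disj wl; rewrite foldl_cat /=.
have E : foldl (fun g j => avg j g) (fun s => \prod_q phi q (s q)) l = blocked (rev l).
  apply/funext => s'; apply: IH => // [i i' il i'l|i il]; last by apply: wl; rewrite mem_cat il.
  by apply: disj; rewrite mem_cat ?il ?i'l.
rewrite E avg_blocked; first by rewrite rev_cat.
- move=> i; rewrite mem_rev => il; apply: disj; rewrite ?mem_cat ?il ?inE ?eqxx ?orbT //.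
  by apply: contraNneq jl => <-.
- by apply: wl; rewrite mem_cat inE eqxx orbT.
Qed.

End ProductFunctions.

End TableauAverages.

Lemma isometryM (R : realType) (l m n : nat) (U : 'M[complex R]_(l, m)) (W : 'M[complex R]_(m, n)) :
  U ^t* *m U = 1%:M -> W ^t* *m W = 1%:M -> (U *m W) ^t* *m (U *m W) = 1%:M.
Proof. by move=> UU WW; rewrite adjM mulmxA -(mulmxA _ _ U) UU mulmx1. Qed.

(** * Undetected errors of the blocked code *)

Section BlockedCode.
Variable R : realType.
Variables (n k N xi : nat).
Hypotheses (n_gt0 : (0 < n)%N) (nE : n = (N.*2 * xi)%N).
Hypotheses (le_kn : (k <= n)%N) (dvd_n : (n %| k * xi)%N).
Local Notation kap := (k * xi %/ n)%N.
Local Notation J := (N.*2).-1.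
Local Notation C := (complex R).

Lemma xi_gt0 : (0 < xi)%N.
Proof. by move: n_gt0; rewrite nE muln_gt0 => /andP[]. Qed.

Lemma N_gt0 : (0 < N)%N.
Proof. by move: n_gt0; rewrite nE muln_gt0 double_gt0 => /andP[]. Qed.

Lemma kE : k = (kap * N.*2)%N.
Proof.
have /eqP := divnK dvd_n; rewrite {2}nE mulnA eqn_pmul2r ?xi_gt0 // => /eqP E.
by rewrite E.
Qed.

Lemma kap_le : (kap <= xi)%N.
Proof.
rewrite -(leq_pmul2r n_gt0) divnK // mulnC leq_mul2l le_kn orbT //.
Qed.

Lemma gate_fits (j : 'I_J) : (j * xi + xi.*2 <= n)%N.
Proof.
have : ((j : nat).+2 <= N.*2)%N by have := ltn_ord j; have := N_gt0; lia.
move: (j : nat) => a h; by rewrite nE -(mul2n xi) -mulnDl leq_mul2r addn2 h orbT.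
Qed.

Lemma window_disjoint (i j : 'I_J) : odd i = odd j -> i != j ->
  forall q, inwin (j * xi) xi.*2 q -> ~~ inwin (i * xi) xi.*2 q.
Proof.
rewrite -(inj_eq val_inj) /= => oij; rewrite neq_ltn => ij q /andP[h1 h2].
have lt2 a b : odd a = odd b -> (a < b)%N -> (a.+2 <= b)%N.
  by move=> oab ab; move: ab; rewrite leq_eqVlt => /orP[/eqP E|//];
     move: oab; rewrite -E /=; case: (odd a).
apply/negP => /andP[h3 h4].
have mul_le a b : (a.+2 <= b)%N -> (a * xi + xi.*2 <= b * xi)%N.
  by move=> ab; rewrite -mul2n -mulnDl leq_mul2r addn2 ab orbT.
case/orP: ij => ij.
  by have := mul_le _ _ (lt2 _ _ oij ij); lia.
by have := mul_le _ _ (lt2 _ _ (esym oij) ij); lia.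
Qed.

Lemma place_inj (y y' : bits k) : place n xi kap y = place n xi kap y' -> y = y'.
Proof.
move=> /ffunP E; apply/ffunP => l.
have kap0 : (0 < kap)%N.
  by have := ltn_ord l; rewrite {2}kE; case: kap => // ; rewrite mul0n.
have lk : (l %% kap < xi)%N by apply: leq_trans kap_le; rewrite ltn_mod.
(* Logical qubit [l] sits at position l mod kap of region l div kap. *)
have qn : (l %/ kap * xi + l %% kap < n)%N.
  rewrite [X in (_ < X)%N]nE; apply: (@leq_trans ((l %/ kap).+1 * xi)).
    by rewrite mulSn [X in (_ < X)%N]addnC ltn_add2l.
  rewrite leq_mul2r ltn_divLR // [X in (_ < X)%N]mulnC -kE ltn_ord orbT //.
have := E (Ordinal qn); rewrite !ffunE /= modnMDl divnMDl ?xi_gt0 //.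
rewrite (modn_small lk) (divn_small lk) addn0 ltn_mod kap0.
rewrite -divn_eq; case: insubP => [l' _ El|]; last by rewrite ltn_ord.
by rewrite (_ : l' = l) //; apply: val_inj.
Qed.

Local Notation W := (add_ancillas R n k xi).

Lemma add_ancillas_iso : W ^t* *m W = 1%:M.
Proof.
apply: op_ext => y y'; rewrite ent_mul ent1.
under eq_bigr do rewrite ent_adj !ent_mkop conjC_nat.
rewrite sum_delta; congr (nat_of_bool _)%:R.
by apply/eqP/eqP => [/place_inj|->].
Qed.

Definition anc (q : nat) := ~~ (q %% xi < kap)%N.

(** Commutation with Z on every ancilla. Products of these Z themselves qualify, in line with the
    strict form of [detects]. *)
Definition logical (s : pauli_label n) := [forall q : 'I_n, anc q ==> ~~ (s q).1].

(** An X or Y on an ancilla flips it out of |0>, so the result is orthogonal to every placed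
    state. *)
Lemma add_ancillas_pauli s : ~~ logical s -> W ^t* *m pauli R s *m W = 0.
Proof.
rewrite negb_forall => /existsP[q]; rewrite negb_imply negbK => /andP[aq sq].
have entW x y : ent W x y = (x == place n xi kap y)%:R by rewrite ent_mkop.
apply: op_ext => y y'; rewrite ent0 ent_mul big1 // => x _; rewrite ent_mul.
under eq_bigr do rewrite ent_adj entW conjC_nat.
rewrite sum_delta entW; have [->|_] := eqVneq x (place n xi kap y'); last by rewrite mulr0.
rewrite ent_pauli; case: eqP => [/ffunP/(_ q)|_]; last by rewrite mul0r mul0r.
by rewrite !ffunE (negPf aq) sq.
Qed.

Let off (j : 'I_J) := (j * xi)%N.

(** The second layer comes first in the list because its factor stands on the left and acts last. *)
Definition gate_order : seq 'I_J :=
  [seq j : 'I_J <- index_enum _ | odd j] ++ [seq j : 'I_J <- index_enum _ | ~~ odd j].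

Section FixedCircuit.
Variable t : {ffun 'I_J -> tableau xi.*2}.
Hypothesis tcl : t \in ffun_on (mem (clifford_classes R xi.*2)).
Local Notation G := (fun j => clifford_of R (t j)).
Local Notation U := (double_layer n G).
Local Notation tau := (@circuit_label n xi.*2 J off t gate_order).

Lemma double_layerE : U = \prod_(j <- gate_order) embed n (off j) (G j).
Proof. by rewrite /gate_order big_cat !big_filter. Qed.

Lemma conjp_circuit l s :
  conjp (\prod_(j <- l) embed n (off j) (G j)) s (circuit_label off t l s)
  /\ \prod_(j <- l) embed n (off j) (G j) \is unitarymx.
Proof.
elim: l s => [|j l IH] s.
  rewrite big_nil; split; first exact: conjp1.
  exact: clifford_unitary (clifford1 R n).
have tj : t j \in clifford_classes R xi.*2 by move/ffun_onP: tcl; apply.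
have [IH1 IH2] := IH s; rewrite big_cons; split.
  apply: (conjp_mul IH1); apply: (embed_conjp (gate_fits j)).
    exact: clifford_of_unitary.
  exact: clifford_of_conjp.
exact (op_unitaryM (embed_unitary (gate_fits j) (clifford_of_unitary tj)) IH2).
Qed.

Lemma double_layer_unitary : U \is unitarymx.
Proof. by rewrite double_layerE; case: (conjp_circuit gate_order (lzero n)). Qed.

Lemma double_layer_conjp s : conjp U s (tau s).
Proof. by rewrite double_layerE; case: (conjp_circuit gate_order s). Qed.

Lemma tau_inj : injective tau.
Proof.
move=> s s' E; apply: (conjp_inj double_layer_unitary (double_layer_conjp s)).
by rewrite E; exact: double_layer_conjp.
Qed.

Lemma tau0 : tau (lzero n) = lzero n.
Proof.
apply: (conjp_fun (double_layer_conjp (lzero n))).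
exact: conjp0 double_layer_unitary.
Qed.

Lemma encoder_iso : (U *m W) ^t* *m (U *m W) = 1%:M.
Proof.
exact: (isometryM (unitary_mulVmx double_layer_unitary) add_ancillas_iso).
Qed.

(** Pulled back through [U], the error becomes the Pauli operator [g] next to the ancilla isometry,
    where every label that is not [logical] is detected. *)
Lemma undetected A : ~ detects (U *m W) A ->
  exists2 g, logical g && (g != lzero n) & lbelow (tau g) A.
Proof.
move=> nd; apply: contrapT => H; apply: nd => s s0 sA.
pose g := invF tau_inj s; have gE : tau g = s by exact: f_invF.
have g0 : g != lzero n.
  by apply: contra s0 => /eqP E; rewrite -gE E tau0.
have ng : ~~ logical g.
  by apply/negP => lg; apply: H; exists g; rewrite ?lg ?gE.
have [c pc E] := conjp_adj double_layer_unitary (double_layer_conjp g).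
rewrite trmxCK gE in E.
have -> : (U *m W) ^t* *m pauli R s *m (U *m W) = W ^t* *m (U ^t* *m pauli R s *m U) *m W.
  by rewrite adjM !mulmxA.
by rewrite E -scalemxAr -scalemxAl add_ancillas_pauli // scaler0.
Qed.

Variable p : R.
Hypothesis p01 : 0 <= p <= 1.

Definition weight (s : pauli_label n) : R :=
  \prod_q (if s q == (false, false) then 1 else p).

Lemma sum_pattern_prob : \sum_(A : bits n) pattern_prob p A = 1.
Proof.
rewrite (sum_bits_prod (fun q b => if b then p else 1 - p)).
by rewrite big1 // => q _; rewrite addrC subrK.
Qed.

(** A random pattern contains the support of [s] with probability p^wt(s), by independence of the
    qubits. *)
Lemma sum_lbelow s :
  \sum_(A : bits n) pattern_prob p A * (lbelow s A)%:R = weight s.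
Proof.
transitivity (\sum_(A : bits n) \prod_q ((if A q then p else 1 - p) *
    ((s q != (false, false)) ==> A q)%:R)).
  apply: eq_bigr => A _; rewrite big_split; congr (_ * _).
  apply: (@complexI R); rewrite rmorph_prod /= rmorph_nat.
  under [RHS]eq_bigr do rewrite rmorph_nat.
  by rewrite prod_bool.
rewrite (sum_bits_prod (fun q b => (if b then p else 1 - p) *
    ((s q != (false, false)) ==> b)%:R)).
apply: eq_bigr => q _; case: eqP => _ /=; rewrite ?mulr1 ?mulr0 ?addr0 //.
by rewrite addrC subrK.
Qed.

Lemma choi_error_double_layer :
  erasure_choi_error k xi p U <=
  Num.sqrt (1 - \sum_(A : bits n | `[< detects (U *m W) A >]) pattern_prob p A).
Proof.
apply: (choi_error_erasure [ffun=> false] encoder_iso p01) => X.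
by rewrite /encoding !adjM !mulmxA.
Qed.

Lemma undetected_prob_ge0 :
  0 <= 1 - \sum_(A : bits n | `[< detects (U *m W) A >]) pattern_prob p A.
Proof.
rewrite -sum_pattern_prob (bigID (fun A : bits n => `[< detects (U *m W) A >])) /=.
rewrite addrAC subrr add0r sumr_ge0 // => A _; exact: pattern_prob_ge0.
Qed.

Lemma undetected_prob_le :
  1 - \sum_(A : bits n | `[< detects (U *m W) A >]) pattern_prob p A
  <= \sum_(g | logical g && (g != lzero n)) weight (tau g).
Proof.
rewrite -sum_pattern_prob (bigID (fun A : bits n => `[< detects (U *m W) A >])) /=.
rewrite addrAC subrr add0r.
under [leRHS]eq_bigr do rewrite -sum_lbelow.
rewrite exchange_big /= big_mkcond /=; apply: ler_sum => A _.
have nn : 0 <= \sum_(i | logical i && (i != lzero n)) pattern_prob p A * (lbelow (tau i) A)%:R.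
  by apply: sumr_ge0 => g _; rewrite mulr_ge0 ?ler0n ?pattern_prob_ge0.
case: asboolP => //= /undetected[g lg gA].
rewrite (bigD1 g) //= gA mulr1 lerDl; apply: sumr_ge0 => i _.
by rewrite mulr_ge0 ?ler0n ?pattern_prob_ge0.
Qed.

Lemma undetected_prob_le1 :
  1 - \sum_(A : bits n | `[< detects (U *m W) A >]) pattern_prob p A <= 1.
Proof.
rewrite gerBl; apply: sumr_ge0 => A _; exact: pattern_prob_ge0.
Qed.

End FixedCircuit.
End BlockedCode.

(** * The spin chain *)

Section SpinChain.
Variable R : realType.
Variables (F : nat -> bool -> R) (x : nat -> bool -> bool -> R).

(** Spins outside the chain are [true], so that the two end regions are
    constrained by their only gate. *)
Definition spin_at (m : nat) (T : {ffun 'I_m -> bool}) (i : nat) : bool :=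
  if insub i is Some j then T j else true.

Definition spin_before (m : nat) (T : {ffun 'I_m -> bool}) (i : nat) : bool :=
  if i is i'.+1 then spin_at T i' else true.

(** Transfer-matrix recursion with [b] as the last spin, [F] the one-site weights and [x] the
    weights of neighbouring pairs. The base value [b%:R] fixes the spin in front of the chain to
    [true]. *)
Fixpoint partition_fun (m : nat) (b : bool) : R :=
  if m is m'.+1 then
    F m' b * (partition_fun m' true * x m' true b + partition_fun m' false * x m' false b)
  else b%:R.

Definition snoc (m : nat) (T : {ffun 'I_m -> bool}) (b : bool) : {ffun 'I_m.+1 -> bool} :=
  [ffun i : 'I_m.+1 => if insub (i : nat) is Some j then T j else b].

Lemma snoc_widen m (T : {ffun 'I_m -> bool}) b (j : 'I_m) :
  snoc T b (widen_ord (leqnSn m) j) = T j.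
Proof.
rewrite ffunE; case: insubP => [i _ Ei|]; first by congr (T _); apply: val_inj.
by rewrite /= ltn_ord.
Qed.

Lemma snoc_max m (T : {ffun 'I_m -> bool}) b : snoc T b ord_max = b.
Proof. by rewrite ffunE /=; case: insubP => // i; rewrite ltnn. Qed.

Lemma spin_at_ord m (T : {ffun 'I_m -> bool}) (j : 'I_m) : spin_at T j = T j.
Proof.
rewrite /spin_at; case: insubP => [i _ Ei|]; last by rewrite ltn_ord.
by congr (T _); apply: val_inj.
Qed.

Lemma spin_before_snoc m (T : {ffun 'I_m -> bool}) b i :
  (i <= m)%N -> spin_before (snoc T b) i = spin_before T i.
Proof.
case: i => //= i im; have -> : i = widen_ord (leqnSn m) (Ordinal im) by [].
by rewrite spin_at_ord snoc_widen -(spin_at_ord T).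
Qed.

Lemma sum_snoc m (Phi : {ffun 'I_m.+1 -> bool} -> R) :
  \sum_T Phi T = \sum_(T : {ffun 'I_m -> bool}) (Phi (snoc T true) + Phi (snoc T false)).
Proof.
transitivity (\sum_(Tb : {ffun 'I_m -> bool} * bool) Phi (snoc Tb.1 Tb.2)).
  rewrite (reindex (fun Tb : {ffun 'I_m -> bool} * bool => snoc Tb.1 Tb.2)) //.
  exists (fun T : {ffun 'I_m.+1 -> bool} => ([ffun j => T (widen_ord (leqnSn m) j)], T ord_max)) => [[T b] _|T _] /=.
    by rewrite snoc_max; congr pair; apply/ffunP => j; rewrite ffunE snoc_widen.
  apply/ffunP => i; case: (ltnP i m) => im.
    have -> : i = widen_ord (leqnSn m) (Ordinal im) by apply: val_inj.
    by rewrite snoc_widen ffunE.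
  have -> : i = ord_max by apply: val_inj => /=; apply/eqP; rewrite eqn_leq im -ltnS ltn_ord.
  by rewrite snoc_max.
rewrite -(pair_bigA _ (fun T b => Phi (snoc T b))) /=.
by apply: eq_bigr => T _; rewrite big_bool.
Qed.

(** The right boundary factor [H] is arbitrary so that the induction can absorb the last spin into
    it. *)
Lemma sum_spins m (H : bool -> R) :
  \sum_(T : {ffun 'I_m -> bool})
    (\prod_(j < m) (F j (T j) * x j (spin_before T j) (T j))) * H (spin_before T m)
  = partition_fun m true * H true + partition_fun m false * H false.
Proof.
elim: m H => [|m IH] H.
  rewrite (bigD1 [ffun=> true]) //= [X in _ + X]big1 => [|T]; last first.
    by move=> /eqP[]; apply/ffunP; case.
  by rewrite big_ord0 /= !mul1r mul0r addr0.
rewrite sum_snoc.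
have E (T : {ffun 'I_m -> bool}) b :
   (\prod_(j < m.+1) (F j (snoc T b j) * x j (spin_before (snoc T b) j) (snoc T b j))) *
   H (spin_before (snoc T b) m.+1) =
   (\prod_(j < m) (F j (T j) * x j (spin_before T j) (T j))) *
    (F m b * x m (spin_before T m) b * H b).
  rewrite big_ord_recr /= -mulrA; congr (_ * _).
    apply: eq_bigr => j _; rewrite snoc_widen spin_before_snoc //.
    exact: ltnW (ltn_ord j).
  have -> : spin_at (snoc T b) m = b by rewrite -[RHS](snoc_max T b) -spin_at_ord.
  by rewrite snoc_max spin_before_snoc.
rewrite big_split /=; under eq_bigr do rewrite E.
under [X in _ + X]eq_bigr do rewrite E.
rewrite (IH (fun c => F m true * x m c true * H true)).
by rewrite (IH (fun c => F m false * x m c false * H false)) /=; ring.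
Qed.

End SpinChain.

(** [al] and [ga] are the partition functions after an odd number of gates with
    the last spin [false] and [true]; the term [(mu s)^(2 N)] is the all-[true]
    configuration and every other excitation costs a domain wall. *)
Lemma chain_bound (R : realType) (N : nat) (mu s B : R) (al ga : nat -> R) :
  0 < mu -> 0 <= s -> s * mu <= 1 -> 0 <= B <= 2 -> N%:R * mu <= 1 / 8 ->
  al 0%N = 1 -> ga 0%N = mu ^+ 2 * s ->
  (forall i, (i.+1 < N)%N -> al i.+1 = al i + ga i * B) ->
  (forall i, (i.+1 < N)%N -> ga i.+1 = mu ^+ 2 * (al i * B + ga i * s ^+ 2)) ->
  (0 < N)%N ->
  al N.-1 + ga N.-1 * s - 1 <= (mu ^+ 2 * s ^+ 2) ^+ N + 8 * N%:R * mu.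
Proof.
move=> mu0 s0 smu /andP[B0 B2] Nmu al0 ga0 alS gaS N0.
set rho := mu ^+ 2 * s ^+ 2.
have rho0 : 0 <= rho by rewrite mulr_ge0 ?sqr_ge0.
have rho1 : rho <= 1.
  by rewrite /rho mulrC -exprMn expr_le1 // mulr_ge0 // ltW.
(* mu^2 s rho^i is the all-[true] part of [ga i]. With N mu <= 1/8 one has al i <= 2 and ga i <= 3/2
   mu, so a step adds at most 3 mu to [al] and 4 mu^2 to the excess of [ga]. The total 3 N mu + 4 N
   mu stays below 8 N mu. *)
have inv i : (i < N)%N -> [/\ 1 <= al i, al i <= 1 + 3 * i%:R * mu,
    0 <= ga i - mu ^+ 2 * s * rho ^+ i & ga i - mu ^+ 2 * s * rho ^+ i <= 4 * i%:R * mu ^+ 2].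
  elim: i => [|i IH] iN.
    by rewrite al0 ga0 expr0 mulr1 subrr !mulr0 !mul0r addr0.
  have [a1 a2 e1 e2] := IH (ltnW iN).
  have iNR : i%:R + 1 <= N%:R :> R by rewrite natr1 ler_nat ltnW.
  have i0 : 0 <= i%:R :> R by rewrite ler0n.
  have imu : i%:R * mu <= 1 / 8 by apply: le_trans Nmu; rewrite ler_pM2r //; lra.
  have rhoi0 : 0 <= rho ^+ i by rewrite exprn_ge0.
  have rhoi1 : rho ^+ i <= 1 by rewrite exprn_ile1.
  have t1 : mu ^+ 2 * s * rho ^+ i <= mu.
    have : mu ^+ 2 * s * rho ^+ i <= mu ^+ 2 * s * 1.
      by rewrite ler_wpM2l // mulr_ge0 // sqr_ge0.
    move/le_trans; apply; rewrite mulr1 expr2 -mulrA -[leRHS]mulr1.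
    by rewrite ler_wpM2l 1?mulrC // ltW.
  have t0 : 0 <= mu ^+ 2 * s * rho ^+ i by rewrite mulr_ge0 // mulr_ge0 // sqr_ge0.
  have g1 : ga i <= 3 / 2 * mu.
    have : 4 * i%:R * mu ^+ 2 <= 1 / 2 * mu.
      by rewrite expr2 mulrA ler_pM2r // -mulrA; lra.
    lra.
  have g0 : 0 <= ga i by lra.
  have al2 : al i <= 2 by rewrite -mulrA in a2; lra.
  have iS : i.+1%:R = i%:R + 1 :> R by rewrite -natr1.
  rewrite alS // gaS // iS; split.
  - have : 0 <= ga i * B by rewrite mulr_ge0.
    lra.
  - have : ga i * B <= 3 / 2 * mu * 2 by rewrite ler_pM.
    by nra.
  - rewrite (exprS rho) mulrDr; have -> : mu ^+ 2 * (ga i * s ^+ 2) = rho * ga i by rewrite /rho; ring.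
    have -> : mu ^+ 2 * s * (rho * rho ^+ i) = rho * (mu ^+ 2 * s * rho ^+ i) by ring.
    rewrite -addrA -mulrBr addr_ge0 ?mulr_ge0 ?sqr_ge0 //; lra.
  - rewrite (exprS rho) mulrDr; have -> : mu ^+ 2 * (ga i * s ^+ 2) = rho * ga i by rewrite /rho; ring.
    have -> : mu ^+ 2 * s * (rho * rho ^+ i) = rho * (mu ^+ 2 * s * rho ^+ i) by ring.
    rewrite -addrA -mulrBr.
    have h1 : mu ^+ 2 * (al i * B) <= mu ^+ 2 * (2 * 2).
      by rewrite ler_wpM2l ?sqr_ge0 // ler_pM //; lra.
    have h2 : rho * (ga i - mu ^+ 2 * s * rho ^+ i) <= 1 * (4 * i%:R * mu ^+ 2).
      by rewrite ler_pM.
    lra.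
have PN : (N.-1 < N)%N by rewrite prednK.
have [a1 a2 e1 e2] := inv _ PN.
have PNR : N.-1%:R <= N%:R :> R by rewrite ler_nat leq_pred.
have -> : al N.-1 + ga N.-1 * s - 1 = (al N.-1 - 1) +
   (ga N.-1 - mu ^+ 2 * s * rho ^+ N.-1) * s + rho ^+ N.
  have -> : rho ^+ N = rho * rho ^+ N.-1 by rewrite -exprS prednK.
  by move: (rho ^+ N.-1) => r; rewrite /rho; ring.
have h1 : al N.-1 - 1 <= 3 * N%:R * mu.
  rewrite lerBlDl; apply: (le_trans a2); rewrite lerD2l ler_pM2r //.
  by rewrite ler_pM2l.
have h2 : (ga N.-1 - mu ^+ 2 * s * rho ^+ N.-1) * s <= 4 * N%:R * mu.
  apply: (@le_trans _ _ (4 * N.-1%:R * mu ^+ 2 * s)); first by rewrite ler_wpM2r.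
  rewrite expr2 -!mulrA ler_pM2l // [mu * s]mulrC.
  apply: ler_pM => //; first by rewrite mulr_ge0 // ?mulr_ge0 // ltW.
  by rewrite -[leRHS]mulr1 ler_pM2l.
have : 0 <= N%:R * mu by rewrite mulr_ge0 ?ler0n // ltW.
lra.
Qed.

(** * Reduction of the ensemble mean to the spin chain *)

Section BlockedBound.
Variable R : realType.
Variables (n k N xi : nat).
Hypotheses (n_gt0 : (0 < n)%N) (nE : n = (N.*2 * xi)%N).
Hypotheses (le_kn : (k <= n)%N) (dvd_n : (n %| k * xi)%N).
Variable p : R.
Hypothesis p01 : 0 <= p <= 1.
Local Notation kap := (k * xi %/ n)%N.
Local Notation J := (N.*2).-1.
Local Notation cl := (clifford_classes R xi.*2).
Let off (j : 'I_J) := (j * xi)%N.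
Let fits : forall j : 'I_J, (off j + xi.*2 <= n)%N := gate_fits n_gt0 nE le_kn dvd_n.
Let xi0 : (0 < xi)%N := xi_gt0 n_gt0 nE.
Let N0 : (0 < N)%N := N_gt0 n_gt0 nE.
Let kapx : (kap <= xi)%N := kap_le n_gt0 le_kn dvd_n.

(** A region has [D] labels and a gate window D^2 - 1 nonzero ones. Among the latter, [beta] is the
    mean weight and [womega] the fraction obeying the ancilla constraint, since a region has 4^kap
    2^(xi-kap) = 2^(xi+kap) labels that obey it. The chain uses the upper bound mu^2 of [womega]. *)
Let D : R := 4 ^+ xi.
Let sg : R := (1 + 3 * p) ^+ xi.
Let beta : R := (sg ^+ 2 - 1) / (D ^+ 2 - 1).
Let mu : R := 2 ^- (xi - kap).
Let womega : R := ((2 ^+ (xi + kap)) ^+ 2 - 1) / (D ^+ 2 - 1).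

Hypothesis sg_mu : sg * mu <= 1.

Let phiw (q : 'I_n) (a : bool * bool) : R := if a == (false, false) then 1 else p.
Let phig (q : 'I_n) (a : bool * bool) : R := (anc n k xi q ==> ~~ a.1)%:R.

Lemma big_bool2 (F : bool * bool -> R) :
  \sum_a F a = F (true, true) + F (true, false) + F (false, true) + F (false, false).
Proof.
rewrite (eq_bigr (fun a => F (a.1, a.2))) => [|[] //].
by rewrite -(pair_bigA _ (fun a b => F (a, b))) /= !big_bool /= addrA.
Qed.

Lemma card_labels : #|pauli_label xi.*2|.-1%:R = D ^+ 2 - 1 :> R.
Proof.
rewrite card_ffun card_prod card_bool card_ord -subn1 natrB ?expn_gt0 //.
by rewrite natrX -muln2 exprM.
Qed.

Lemma window_avg_weight j : window_avg fits phiw j = beta.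
Proof.
rewrite /window_avg /beta card_labels; congr ((_ - 1) / _).
transitivity (\prod_(q < xi.*2) (1 + 3 * p)).
  by apply: eq_bigr => q _; rewrite big_bool2 /phiw /=; ring.
by rewrite prodr_const card_ord -muln2 exprM.
Qed.

Lemma prod_mod (y : nat -> R) (M : nat) :
  \prod_(q < M * xi) y (q %% xi)%N = (\prod_(q < xi) y q) ^+ M.
Proof.
elim: M => [|M IH]; first by rewrite mul0n big_ord0 expr0.
rewrite mulSn addnC big_split_ord /= IH exprSr; congr (_ * _).
by apply: eq_bigr => q _; rewrite modnMDl modn_small.
Qed.

Lemma prod_div (y : nat -> R) (M : nat) :
  \prod_(q < M * xi) y (q %/ xi)%N = \prod_(r < M) y r ^+ xi.
Proof.
elim: M => [|M IH]; first by rewrite mul0n !big_ord0.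
rewrite mulSn addnC big_split_ord /= IH big_ord_recr /=; congr (_ * _).
transitivity (\prod_(q < xi) y M); last by rewrite prodr_const card_ord.
by apply: eq_bigr => q _; rewrite divnMDl // divn_small // addn0.
Qed.

Lemma prod_threshold (K m : nat) :
  \prod_(q < K + m) (if (q < K)%N then 4 else 2 : R) = 2 ^+ (K + K + m).
Proof.
rewrite big_split_ord /=.
transitivity ((\prod_(i < K) (4 : R)) * \prod_(i < m) (2 : R)).
  congr (_ * _); apply: eq_bigr => i _; first by rewrite ltn_ord.
  by rewrite ltnNge leq_addr.
by rewrite !prodr_const !card_ord (_ : 4 = 2 * 2 :> R) ?exprMn -?exprD // -natrM.
Qed.

Lemma window_avg_logical j : window_avg fits phig j = womega.
Proof.
rewrite /window_avg /womega card_labels; congr ((_ - 1) / _).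
pose y q : R := if (q < kap)%N then 4 else 2.
transitivity (\prod_(q < 2 * xi) y (q %% xi)%N).
  rewrite mul2n; apply: eq_bigr => q _; rewrite big_bool2 /phig /anc /= modnMDl /y.
  by case: (_ < _)%N => /=; rewrite ?mulr1n ?mulr0n; ring.
rewrite prod_mod; congr (_ ^+ 2); rewrite /y; move: kapx; move: (kap) => K Kx.
have := prod_threshold K (xi - K); rewrite subnKC // => ->.
by congr (_ ^+ _); lia.
Qed.

Let evens := [seq j : 'I_J <- index_enum _ | ~~ odd j].
Let odds := [seq j : 'I_J <- index_enum _ | odd j].

Lemma covered_evens (q : 'I_n) : covered xi.*2 off evens q.
Proof.
apply/hasP; have qr : (q %/ xi < N.*2)%N by rewrite ltn_divLR // -nE.
(* The first-layer gate acting on region r is the even one among r - 1 and r. *)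
have hj : ((q %/ xi) - odd (q %/ xi) < J)%N.
  move: qr; set r := (q %/ xi)%N => qr.
  have : (r = odd r + r./2.*2)%N by rewrite odd_double_half.
  by have := N0; lia.
have hx : (q %/ xi * xi <= q < (q %/ xi).+1 * xi)%N.
  by rewrite leq_trunc_div -ltn_divLR // ltnS leqnn.
exists (Ordinal hj); last first.
  rewrite /inwin /off /=; case/andP: hx; case: (odd _); rewrite ?subn0 ?subn1.
    case: (q %/ xi)%N => [|r] /=; rewrite ?mul0n ?mulSn; lia.
  by rewrite mulSn; lia.
rewrite mem_filter mem_index_enum andbT /=.
by rewrite oddB ?oddb ?addbb //; case: (q %/ xi)%N => // r; case: odd.
Qed.

(** The sum over the labels of one qubit of region [r]. The second layer does not touch the two end
    regions 0 and J = 2N - 1, where the weight still acts qubit by qubit and gives 1 + 3p; elsewhere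
    all four labels count equally. *)
Let vreg (r : nat) : R := if (r == 0%N) || (r == J) then 1 + 3 * p else 4.

Lemma covered_odds (q : 'I_n) :
  covered xi.*2 off (rev odds) q = ~~ ((q %/ xi == 0)%N || (q %/ xi == J)%N).
Proof.
have qr : (q %/ xi < N.*2)%N by rewrite ltn_divLR // -nE.
have hx : (q %/ xi * xi <= q < (q %/ xi).+1 * xi)%N.
  by rewrite leq_trunc_div -ltn_divLR // ltnS leqnn.
apply/hasP/idP => [[j]|]; last first.
  rewrite negb_or => /andP[r0 rJ].
  have hj : ((q %/ xi) - ~~ odd (q %/ xi) < J)%N.
    by move: qr r0 rJ; case: odd; have := N0; lia.
  exists (Ordinal hj); last first.
    rewrite /inwin /off /=; case/andP: hx; case: (odd _); rewrite ?subn0 ?subn1.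
      by rewrite mulSn; lia.
    case: (q %/ xi)%N => [|r] /=; rewrite ?mul0n ?mulSn; lia.
  rewrite mem_rev mem_filter mem_index_enum andbT /=.
  rewrite oddB ?oddb ?addbN ?addbb //.
  by move: r0; case: (q %/ xi)%N => // r _; case: odd.
rewrite mem_rev mem_filter => /andP[oj _] /andP[h1 h2].
have j1 : (j <= q %/ xi)%N by rewrite leq_divRL.
have j2 : (q %/ xi < j.+2)%N by rewrite ltn_divLR // !mulSn; move: h2; rewrite /off; lia.
have oJ : odd J by move: N0; case: (N) => // N' _; rewrite doubleS /= odd_double.
have := ltn_ord j; move: oj j1 j2 qr.
rewrite negb_or; set r := (q %/ xi)%N => oj j1 j2 qr jJ.
apply/andP; split; first by apply/eqP => r0; move: j1; rewrite r0 leqn0 => /eqP j0; rewrite j0 in oj.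
apply/eqP => rJ; have : (r == j) || (r == j.+1) by lia.
case/orP => /eqP E; first by lia.
by move: oJ; rewrite -rJ E /= oj.
Qed.

Lemma le_womega : 0 <= womega <= mu ^+ 2.
Proof.
have D4 : 4 <= D.
  rewrite /D -(prednK xi0) exprS -[leLHS]mulr1 ler_wpM2l // exprn_ege1 //; lra.
have pos : 0 < D ^+ 2 - 1 by nra.
set a : R := 2 ^+ (xi + kap).
have a1 : 1 <= a by rewrite exprn_ege1 //; lra.
have aE : a = mu * D.
  rewrite /a /mu /D (_ : 4 = 2 ^+ 2 :> R) -?exprM; last by rewrite -natrX.
  apply: (@mulfI _ (2 ^+ (xi - kap))); first by rewrite expf_neq0 // pnatr_eq0.
  rewrite mulrA divff ?mul1r ?expf_neq0 ?pnatr_eq0 // -exprD; congr (_ ^+ _).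
  by move: kapx; lia.
have mu1 : mu <= 1 by rewrite invf_le1 ?exprn_gt0 ?ltr0n // exprn_ege1 //; lra.
have mu0 : 0 < mu by rewrite invr_gt0 exprn_gt0 // ltr0n.
rewrite /womega -/a; apply/andP; split.
  by rewrite divr_ge0 ?(ltW pos) //; nra.
rewrite ler_pdivrMr // aE; nra.
Qed.

Lemma D_ge4 : 4 <= D.
Proof.
rewrite /D -(prednK xi0) exprS -[leLHS]mulr1 ler_wpM2l // exprn_ege1 //; lra.
Qed.

Lemma mu_bounds : 0 < mu <= 1.
Proof.
rewrite invr_gt0 exprn_gt0 ?ltr0n //= invf_le1 ?exprn_gt0 ?ltr0n //.
by rewrite exprn_ege1 //; lra.
Qed.

Lemma sg_bounds : 1 <= sg /\ sg ^+ 2 <= D.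
Proof.
have sg1 : 1 <= sg by rewrite exprn_ege1 //; move: p01 => /andP[]; lra.
(* mu^-2 = 4^(xi-kap) is at most [D], and [sg_mu] bounds sg by 1 / mu. *)
split=> //; have muD : 1 <= mu ^+ 2 * D.
  rewrite /mu /D (_ : 4 = 2 ^+ 2 :> R) -?exprM; last by rewrite -natrX.
  rewrite exprVn -exprM mulrC ler_pdivlMr ?exprn_gt0 ?ltr0n // mul1r.
  by rewrite ler_eXn2l ?ltr1n //; move: kapx; lia.
have /andP[mu0 mu1] := mu_bounds.
have : sg ^+ 2 * mu ^+ 2 <= 1 by rewrite -exprMn expr_le1 // mulr_ge0 ?(ltW mu0) //; lra.
have : 0 < mu ^+ 2 by rewrite exprn_gt0.
nra.
Qed.

Lemma beta_bounds : 0 <= beta <= 1.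
Proof.
have D4 := D_ge4; have [sg1 sgD] := sg_bounds.
have pos : 0 < D ^+ 2 - 1 by nra.
apply/andP; split; first by rewrite divr_ge0 ?(ltW pos) //; nra.
by rewrite ler_pdivrMr // mul1r; nra.
Qed.

(** Spin [j] is [true] when the label may be nonzero on the window of gate [j]. *)
Let Fspin (j : nat) (b : bool) : R :=
  if odd j then (if b then beta else 1 - beta) else (if b then mu ^+ 2 else 1).

(** Region [r] is shared by gates r - 1 and r. Its labels are summed freely only if both spins are
    [true]; otherwise only the zero label remains. *)
Let xspin (r : nat) (b b' : bool) : R := if b && b' then vreg r ^+ xi else 1.

Lemma Fspin_ge0 j b : 0 <= Fspin j b.
Proof.
have /andP[b0 b1] := beta_bounds; rewrite /Fspin.
by case: ifP => _; case: ifP => _ //; rewrite ?subr_ge0 // sqr_ge0.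
Qed.

(** The weight averaged over the second layer; [k2] is the ancilla constraint averaged over the
    first. *)
Let f2 := blocked xi.*2 off phiw beta (rev odds).
Let k2 := blocked xi.*2 off phig womega evens.

Lemma JE : J.+1 = N.*2.
Proof. by rewrite prednK // double_gt0. Qed.

Lemma inwin_div (j : 'I_J) (q : nat) :
  inwin (off j) xi.*2 q = ((q %/ xi == j) || (q %/ xi == j.+1))%N.
Proof.
rewrite /inwin /off; move: (j : nat) => a; rewrite -leq_divRL // -mul2n -mulnDl -ltn_divLR // addn2.
by rewrite ltnS; lia.
Qed.

Lemma spin_local (T : {ffun 'I_J -> bool}) (q : 'I_n) :
  [forall j : 'I_J, inwin (off j) xi.*2 q ==> T j] =
  spin_before T (q %/ xi) && spin_at T (q %/ xi).
Proof.
apply/forallP/andP => [H|[h1 h2] j].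
  split.
    case E: (q %/ xi)%N => [|r] //=; rewrite /spin_at; case: insubP => // j _ Ej.
    by have := H j; rewrite inwin_div E Ej eqxx orbT.
  rewrite /spin_at; case: insubP => // j _ Ej.
  by have := H j; rewrite inwin_div Ej eqxx.
apply/implyP; rewrite inwin_div => /orP[] /eqP E.
  by move: h2; rewrite E spin_at_ord.
by move: h1; rewrite E /= spin_at_ord.
Qed.

(** In terms of the indicator that the label vanishes on a window, a second-layer factor equals (1 -
    beta) zero + beta, and a first-layer factor is at most zero + mu^2. Expanding the product of
    these sums creates the spins: [false] selects the term that retains the indicator. *)
Lemma le_k2f2 s : k2 s * f2 s <=
  \sum_(T : {ffun 'I_J -> bool}) (\prod_(j < J) Fspin j (T j)) *
    \prod_(q < n) ((spin_before T (q %/ xi) && spin_at T (q %/ xi)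
                     || (s q == (false, false)))%:R *
                   (if covered xi.*2 off (rev odds) q then 1 else phiw q (s q))).
Proof.
have /andP[w0 w1] := le_womega; have /andP[b0 b1] := beta_bounds.
pose zero (j : 'I_J) : R := (lwin (off j) xi.*2 s == lzero xi.*2)%:R.
pose c (j : 'I_J) := Fspin j false * zero j + Fspin j true.
pose edge := \prod_(q < n) (if covered xi.*2 off (rev odds) q then 1 else phiw q (s q)).
have edge0 : 0 <= edge.
  apply: prodr_ge0 => q _; case: ifP => // _; rewrite /phiw; case: ifP => // _.
  by case/andP: p01.
have zero01 j : 0 <= zero j by rewrite ler0n.
have le1 : k2 s <= \prod_(j : 'I_J | ~~ odd j) c j.
  rewrite /k2 /blocked [X in _ * X]big1 ?mulr1 => [|q]; last by rewrite covered_evens.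
  rewrite /evens big_filter.
  apply: ler_prod => j /negPf oj; rewrite /window_weight /c /zero /Fspin oj mul1r.
  by case: eqP => _ /=; rewrite ?w0 ?w1 ?add0r ?ler01 ?lerDl ?sqr_ge0 ?w1.
have eq2 : f2 s = (\prod_(j : 'I_J | odd j) c j) * edge.
  rewrite /f2 /blocked; congr (_ * _).
    rewrite (perm_big odds) ?perm_rev // /odds big_filter.
    apply: eq_bigr => j oj; rewrite /window_weight /c /zero /Fspin oj.
    by case: eqP => _ /=; ring.
  by rewrite /edge big_mkcond; apply: eq_bigr => q _; case: covered.
have k0 : 0 <= k2 s.
  rewrite /k2 /blocked mulr_ge0 //; apply: prodr_ge0 => j _.
    by rewrite /window_weight; case: ifP.
  by rewrite ler0n.
have c0 j : 0 <= c j by rewrite addr_ge0 ?mulr_ge0 ?Fspin_ge0.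
have : k2 s * f2 s <= (\prod_j c j) * edge.
  rewrite eq2 [\prod_j c j](bigID (fun j : 'I_J => odd j)) /= mulrA.
  rewrite [X in _ <= X * _]mulrC ler_wpM2r // ler_wpM2r //.
  by apply: prodr_ge0.
move/le_trans; apply.
have -> : \prod_j c j = \sum_(T : {ffun 'I_J -> bool})
    \prod_j (if T j then Fspin j true else Fspin j false * zero j).
  rewrite -(bigA_distr_bigA (fun (j : 'I_J) (b : bool) => if b then Fspin j true else Fspin j false * zero j)).
  by apply: eq_bigr => j _; rewrite big_bool /= addrC.
rewrite mulr_suml; apply: ler_sum => T _.
rewrite [X in _ <= _ * X]big_split /= -/edge mulrA ler_wpM2r //.
have -> : \prod_(j < J) (if T j then Fspin j true else Fspin j false * zero j)
   = (\prod_(j < J) Fspin j (T j)) * \prod_(j < J) (T j || (lwin (off j) xi.*2 s == lzero xi.*2))%:R.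
  rewrite -big_split; apply: eq_bigr => j _ /=; case: (T j) => /=; rewrite ?mulr1 //.
rewrite ler_wpM2l //; first by apply: prodr_ge0 => j _; exact: Fspin_ge0.
case: (boolP [forall q : 'I_n, spin_before T (q %/ xi) && spin_at T (q %/ xi)
                     || (s q == (false, false))]) => [/forallP H|].
  rewrite [leRHS]big1 => [|q _]; last by rewrite H.
  apply: prodr_ile1 => j; by case: (_ || _); rewrite ?ler01 ?lexx.
rewrite negb_forall => /existsP[q]; rewrite negb_or -spin_local => /andP[+ sq].
rewrite negb_forall => /existsP[j]; rewrite negb_imply => /andP[jq Tj].
rewrite (bigD1 j) //= (negPf Tj) /= (_ : (lwin _ _ _ == _) = false).
  by rewrite mul0r prodr_ge0 // => i _; rewrite ler0n.
apply: contraNF sq => /eqP/ffunP E; case/(inwinP (fits j)): jq => i ->.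
by have := E i; rewrite (gwinE _ (fits j)) ffunE => ->.
Qed.

Lemma sum_k2f2 : \sum_s k2 s * f2 s <=
  partition_fun Fspin xspin J true * sg + partition_fun Fspin xspin J false.
Proof.
apply: le_trans (ler_sum _ (fun s _ => le_k2f2 s)) _.
rewrite exchange_big /=.
(* There is one region more than gates; the last region, with the fictitious spin [true] to its
   right, is the boundary factor. *)
have := sum_spins Fspin xspin J (fun b => xspin J b true).
have -> : xspin J true true = sg by rewrite /xspin /= /vreg eqxx orbT.
have -> : xspin J false true = 1 by [].
rewrite mulr1 => <-.
apply: ler_sum => T _; rewrite -mulr_sumr big_split /= -mulrA.
rewrite ler_wpM2l //; first by apply: prodr_ge0 => j _; exact: Fspin_ge0.
rewrite (sum_label_prod (fun (q : 'I_n) a => (spin_before T (q %/ xi) && spin_at T (q %/ xi)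
                     || (a == (false, false)))%:R *
                   (if covered xi.*2 off (rev odds) q then 1 else phiw q a))).
pose y r : R := if spin_before T r && spin_at T r then vreg r else 1.
rewrite (eq_bigr (fun q : 'I_n => y (q %/ xi)%N)) => [|q _]; last first.
  rewrite covered_odds big_bool2 /y /vreg /phiw.
  case: (spin_before _ _ && _); case: ((q %/ xi == 0)%N || _) => /=; by ring.
rewrite -(big_mkord xpredT (fun q => y (q %/ xi)%N)) [X in \prod_(0 <= i < X) _]nE big_mkord.
rewrite prod_div -(big_mkord xpredT (fun r => y r ^+ xi)).
rewrite -[X in \prod_(0 <= r < X) _]JE big_mkord big_ord_recr /=.
have E r : y r ^+ xi = xspin r (spin_before T r) (spin_at T r).
  by rewrite /y /xspin; case: ifP; rewrite ?expr1n.
have Ep : \prod_(r < J) y r ^+ xi = \prod_(r < J) xspin r (spin_before T r) (spin_at T r).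
  by apply: eq_bigr => r _; exact: E.
rewrite E Ep.
have -> : spin_at T J = true by rewrite /spin_at insubF // ltnn.
have Ex : \prod_(r < J) xspin r (spin_before T r) (spin_at T r)
        = \prod_(j < J) xspin j (spin_before T j) (T j).
  by apply: eq_bigr => j _; rewrite spin_at_ord.
by rewrite Ex.
Qed.

Lemma vreg_inner r : (0 < r)%N -> (r < J)%N -> vreg r ^+ xi = D.
Proof. by move=> r0 rJ; rewrite /vreg (gtn_eqF r0) (ltn_eqF rJ). Qed.

Lemma partition_bound : N%:R * mu <= 1 / 8 ->
  partition_fun Fspin xspin J true * sg + partition_fun Fspin xspin J false - 1
  <= (mu ^+ 2 * sg ^+ 2) ^+ N + 8 * N%:R * mu.
Proof.
move=> Nmu; have D4 := D_ge4; have [sg1 sgD] := sg_bounds.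
have /andP[mu0 mu1] := mu_bounds; have /andP[b0 b1] := beta_bounds.
pose al i := partition_fun Fspin xspin i.*2.+1 false.
pose ga i := partition_fun Fspin xspin i.*2.+1 true.
have EJ : J = (N.-1).*2.+1 by move: N0; case: (N) => // N' _; rewrite doubleS.
have pos : 0 < D ^+ 2 - 1 by nra.
have betaE : beta * (D ^+ 2 - 1) = sg ^+ 2 - 1 by rewrite /beta divfK // gt_eqF.
have Bb : 0 <= 1 + beta * (D - 1) <= 2.
  have : beta * (D - 1) * (D + 1) <= D + 1.
    have -> : beta * (D - 1) * (D + 1) = beta * (D ^+ 2 - 1) by ring.
    by rewrite betaE; nra.
  rewrite -[X in _ <= X]mul1r ler_pM2r; last by lra.
  have : 0 <= beta * (D - 1) by rewrite mulr_ge0 //; lra.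
  by move=> ? ?; apply/andP; split; lra.
(* One step covers two gates. Summing the second-layer spin between two first-layer spins gives 1, 1
   + beta (D - 1) or 1 + beta (D^2 - 1) = sg^2, according to whether none, one or both of them are
   [true]. *)
have step i b : (i.+1 < N)%N -> partition_fun Fspin xspin i.+1.*2.+1 b =
   (if b then mu ^+ 2 else 1) *
    (beta * (ga i * D + al i) * (if b then D else 1) + (1 - beta) * (ga i + al i)).
  move=> iN; have iJ : (i.*2.+2 < J)%N.
    by rewrite EJ ltnS -doubleS leq_double -ltnS prednK.
  have pfS r c : partition_fun Fspin xspin r.+1 c = Fspin r c *
    (partition_fun Fspin xspin r true * xspin r true c +
     partition_fun Fspin xspin r false * xspin r false c) by [].
  have xF r c : xspin r false c = 1 by [].
  have xT r c : (0 < r)%N -> (r < J)%N -> xspin r true c = if c then D else 1.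
    by move=> r0 rJ; rewrite /xspin; case: c => //=; exact: vreg_inner.
  rewrite doubleS pfS (pfS i.*2.+1 true) (pfS i.*2.+1 false) -/(ga i) -/(al i).
  have iJ' : (i.*2.+1 < J)%N by exact: ltnW.
  rewrite !xF !xT //.
  rewrite /Fspin /= odd_double /= !mulr1; congr (_ * _).
rewrite EJ -/(al N.-1) -/(ga N.-1) [X in X - 1]addrC.
apply: (@chain_bound R N mu sg (1 + beta * (D - 1)) al ga mu0 _ sg_mu Bb Nmu) => //.
- by apply: le_trans sg1; rewrite ler01.
- by rewrite /al /= /Fspin /xspin /= !mul1r mul0r addr0.
- by rewrite /ga /= /Fspin /xspin /= mul1r mul0r addr0.
- by move=> i iN; rewrite [LHS](step i false iN); ring.
- move=> i iN; rewrite [LHS](step i true iN); congr (_ * _).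
  have -> : sg ^+ 2 = 1 + beta * (D ^+ 2 - 1) by rewrite betaE; ring.
  by ring.
Qed.

Lemma evens_disjoint i j : i \in evens -> j \in evens -> i != j ->
  forall q, inwin (off j) xi.*2 q -> ~~ inwin (off i) xi.*2 q.
Proof.
rewrite !mem_filter => /andP[/negPf oi _] /andP[/negPf oj _].
by apply: (@window_disjoint n k N xi) => //; rewrite oi oj.
Qed.

Lemma odds_disjoint i j : i \in odds -> j \in odds -> i != j ->
  forall q, inwin (off j) xi.*2 q -> ~~ inwin (off i) xi.*2 q.
Proof.
rewrite !mem_filter => /andP[oi _] /andP[oj _].
by apply: (@window_disjoint n k N xi) => //; rewrite oi oj.
Qed.

Lemma mean_logical_weight : N%:R * mu <= 1 / 8 ->
  uniform_mean (ffun_on (mem cl)) (fun t : {ffun 'I_J -> tableau xi.*2} =>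
    \sum_(g : pauli_label n | logical k xi g && (g != lzero n))
       weight p (circuit_label off t (gate_order N) g))
  <= (mu ^+ 2 * sg ^+ 2) ^+ N + 8 * N%:R * mu.
Proof.
move=> Nmu; rewrite uniform_mean_sum.
have uniq_order : uniq (gate_order N).
  rewrite cat_uniq !filter_uniq ?index_enum_uniq //= andbT.
  by apply/hasPn => j; rewrite !mem_filter => /andP[/negPf ->].
pose w2 := foldl (fun g j => @avg R n xi.*2 J off j g) (weight p) (gate_order N).
rewrite (eq_bigr w2) => [|g _]; last exact: mean_circuit_label.
(* Every circuit leaves the zero label at weight 1. Adding it completes the sum over logical labels
   and explains the [- 1] in [partition_bound]. *)
have w20 : w2 (lzero n) = 1.
  rewrite /w2 -mean_circuit_label //.
  rewrite (eq_uniform_mean (g := fun=> 1)) => [|t tcl].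
    rewrite uniform_mean_const // card_ffun_on expn_gt0.
    by rewrite (_ : (0 < #|mem cl|)%N) //; exact: clifford_classes_gt0.
  rewrite (tau0 n_gt0 nE le_kn dvd_n tcl) /weight big1 // => q _.
  by rewrite ffunE eqxx.
apply: le_trans (partition_bound Nmu); rewrite lerBrDl -w20.
have -> : w2 (lzero n) + \sum_(g : pauli_label n | logical k xi g && (g != lzero n)) w2 g
   = \sum_(g : pauli_label n | logical k xi g) w2 g.
  rewrite [RHS](bigD1 (lzero n)) //.
  by apply/forallP => q; rewrite ffunE implybT.
apply: le_trans sum_k2f2.
have -> : \sum_(g : pauli_label n | logical k xi g) w2 g
   = \sum_(g : pauli_label n) (\prod_q phig q (g q)) * w2 g.
  rewrite big_mkcond; apply: eq_bigr => g _; rewrite /phig.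
  have -> : \prod_(q < n) (anc n k xi q ==> ~~ (g q).1)%:R = (logical k xi g)%:R :> R.
    apply: (@complexI R); rewrite rmorph_prod /= rmorph_nat.
    under eq_bigr do rewrite rmorph_nat.
    by rewrite prod_bool.
  by case: logical; rewrite ?mul1r ?mul0r.
rewrite /w2 /gate_order foldl_cat.
have -> : foldl (fun g j => @avg R n xi.*2 J off j g) (weight p) odds = f2.
  apply/funext => s; apply: (@foldl_avg_blocked R n xi.*2 J off fits phiw _ beta).
  - by [].
  - by rewrite filter_uniq // index_enum_uniq.
  - exact: odds_disjoint.
  - by move=> j _; exact: window_avg_weight.
rewrite (foldl_avg_adjoint fits).
rewrite le_eqVlt; apply/orP; left; apply/eqP; apply: eq_bigr => s _; congr (_ * _).
rewrite -/evens /k2 -[X in _ = blocked _ _ _ _ X _](revK evens).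
apply: (@foldl_avg_blocked R n xi.*2 J off fits phig _ womega).
- by move=> q; rewrite /phig /= implybT.
- by rewrite rev_uniq filter_uniq // index_enum_uniq.
- by move=> i j; rewrite !mem_rev; exact: evens_disjoint.
- by move=> j _; exact: window_avg_logical.
Qed.

Lemma ensemble_mean_bound : N%:R * mu <= 1 / 8 ->
  ensemble_mean N xi (erasure_choi_error (n := n) k xi p)
  <= Num.sqrt (Num.sqrt ((mu ^+ 2 * sg ^+ 2) ^+ N + 8 * N%:R * mu)).
Proof.
move=> Nmu; rewrite /ensemble_mean; set P := ffun_on _.
have P0 : (0 < #|P|)%N.
  rewrite card_ffun_on expn_gt0.
  by rewrite (_ : (0 < #|mem cl|)%N) //; exact: clifford_classes_gt0.
pose bad (t : {ffun 'I_J -> tableau xi.*2}) : R := 1 - \sum_(A : bits n |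
  `[< detects (double_layer n (fun j => clifford_of R (t j)) *m add_ancillas R n k xi) A >])
     pattern_prob p A.
apply: (@le_trans _ _ (uniform_mean P (fun t => Num.sqrt (bad t)))).
  by apply: le_uniform_mean => t tP; exact: choi_error_double_layer.
have bad0 : {in P, forall t, 0 <= bad t} by move=> t _; exact: undetected_prob_ge0.
apply: (le_trans (mean_sqrt_le P0 bad0)); apply: ler_wsqrtr.
have M0 : 0 <= uniform_mean P bad.
  by rewrite /uniform_mean divr_ge0 ?ler0n // sumr_ge0.
(* Jensen gives one square root. A mean probability M <= 1 satisfies M <= Num.sqrt M, which gives
   the second and hence the exponent 1/4. *)
have M1 : uniform_mean P bad <= 1.
  rewrite -(uniform_mean_const 1 P0); apply: le_uniform_mean => t _.
  exact: undetected_prob_le1.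
rewrite -[leLHS](ger0_norm M0) -sqrtr_sqr; apply: ler_wsqrtr.
apply: (@le_trans _ _ (uniform_mean P bad)).
  by rewrite expr2 -[leRHS]mul1r ler_wpM2r.
apply: le_trans (mean_logical_weight Nmu); apply: le_uniform_mean => t tP.
exact: undetected_prob_le.
Qed.

End BlockedBound.

(** * Circuit depth *)

Section GateWords.
Variable R : realType.
Local Notation C := (complex R).
Local Notation gate := (nat * op R (bits 2) (bits 2))%type.
Implicit Types (w : seq gate) (h : nat -> nat).

Definition eval_word n w : op R (bits n) (bits n) :=
  foldr (fun g acc => embed n g.1 g.2 *m acc) 1%:M w.

Fixpoint valid_word n w : Prop :=
  if w is g :: w' then [/\ (g.1.+1 < n)%N, clifford g.2 & valid_word n w'] else True.

(** [profile h l q] is the time at which qubit [q] becomes free once the gates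
    at the positions [l] (the head of the list is applied last) have been
    scheduled as early as possible, starting from the busy times [h]. *)
Fixpoint profile h (l : seq nat) : nat -> nat :=
  if l is i :: l' then
    let h' := profile h l' in
    fun q => if (q == i) || (q == i.+1) then (maxn (h' i) (h' i.+1)).+1 else h' q
  else h.

Definition positions w : seq nat := map fst w.

Lemma eval_cat n w1 w2 : eval_word n (w1 ++ w2) = eval_word n w1 *m eval_word n w2.
Proof. by elim: w1 => [|g w1 IH] /=; rewrite ?mul1mx // IH mulmxA. Qed.

Lemma valid_cat n w1 w2 : valid_word n w1 -> valid_word n w2 -> valid_word n (w1 ++ w2).
Proof. by elim: w1 => //= g w1 IH [g1 g2 v1] v2; split=> //; exact: IH. Qed.

Lemma profile_cat h l1 l2 : profile h (l1 ++ l2) = profile (profile h l2) l1.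
Proof. by elim: l1 => //= i l1 ->. Qed.

Section Scheduling.
Variable n : nat.
Variables (A : nat -> {set 'I_n}) (G : nat -> 'I_n -> op R (bits 2) (bits 2)).

Definition layer t : op R (bits n) (bits n) := \prod_(i in A t) embed n i (G t i).

Fixpoint layers d : op R (bits n) (bits n) :=
  if d is d'.+1 then layer d' *m layers d' else 1%:M.

End Scheduling.

(** Every gate lies strictly before the busy time of both its qubits. Hence a new gate placed at the
    later of its two busy times is disjoint from all gates of that layer and of later ones. *)
Definition schedule n w (A : nat -> {set 'I_n}) (G : nat -> 'I_n -> op R (bits 2) (bits 2)) :=
  let h := profile (fun=> 0%N) (positions w) in
  [/\ forall t i, i \in A t -> [/\ (i.+1 < n)%N, (t < h i)%N & (t < h i.+1)%N],
      forall t (i j : 'I_n), i \in A t -> j \in A t -> j <> i.+1 :> nat,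
      forall t i, G t i \is unitarymx
    & forall d, (forall q, (q < n)%N -> (h q <= d)%N) -> eval_word n w = layers A G d].

(** A layer is an ordered product in a noncommutative ring, so a gate inserted at its index has to
    be commuted to the front. *)
Lemma prod_comm_pull (T : eqType) (K : pzRingType) (F : T -> K) (P : pred T) (i0 : T) (r : seq T) :
  ~~ P i0 -> (forall i, P i -> F i0 * F i = F i * F i0) -> uniq r ->
  \prod_(i <- r | (i == i0) || P i) F i =
  (if i0 \in r then F i0 else 1) * \prod_(i <- r | P i) F i.
Proof.
move=> Pi0 com; elim: r => [|i r IH] /=; first by rewrite !big_nil mulr1.
move=> /andP[ir ur]; rewrite !big_cons in_cons (eq_sym i0).
have [E|ne] /= := eqVneq i i0.
  by move: ir; rewrite E IH // (negPf Pi0) => /negPf ->; rewrite mul1r.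
rewrite IH //; case: ifP => Pi //.
by case: ifP => _; rewrite ?mul1r // !mulrA com.
Qed.

Lemma embed_comm2 n (i j : 'I_n) (U V : op R (bits 2) (bits 2)) :
  (i.+1 < n)%N -> (j.+1 < n)%N -> j != i -> j <> i.+1 :> nat -> i <> j.+1 :> nat ->
  embed n i U *m embed n j V = embed n j V *m embed n i U.
Proof.
move=> i_n j_n ij /eqP ji1 /eqP ij1; apply: embed_comm; rewrite ?addn2 //.
move=> q /andP[h1 h2]; apply/negP => /andP[h3 h4].
move: ij ji1 ij1; rewrite -(inj_eq val_inj) /= => ij ji1 ij1.
by move: h1 h2 h3 h4 ij ji1 ij1; move: (i : nat) (j : nat) => a b; lia.
Qed.

Lemma schedule_exists n w : valid_word n w ->
  exists A G, schedule (n := n) w A G.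
Proof.
elim: w => [|[i0 g] w IH] /=.
  move=> _; exists (fun=> finset.set0), (fun _ _ => 1%:M); split => //.
  - by move=> t i; rewrite inE.
  - by move=> t i j; rewrite inE.
  - by move=> t i; apply: clifford_unitary; exact: clifford1.
  - move=> d _; elim: d => //= d <-.
    by rewrite /layer big_pred0 ?mulmx1 // => i; rewrite inE.
move=> [i0n /clifford_unitary ug vw]; have [A [G [hA1 hA2 hG hE]]] := IH vw.
move: hA1 hE; rewrite /schedule /=; set h := profile _ (positions w) => hA1 hE.
set t0 := maxn (h i0) (h i0.+1).
pose i0' : 'I_n := Ordinal (ltnW i0n).
pose A' t := if t == t0 then (i0' |: A t)%SET else A t.
pose G' t i := if (t == t0) && (i == i0') then g else G t i.
have free t i : (t0 <= t)%N -> i \in A t ->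
    [/\ i != i0', (i : nat) <> i0.+1 & i0 <> (i : nat).+1].
  move=> tt0 iA; have [_ h1 h2] := hA1 _ _ iA; split.
  - apply/eqP => E; move: h1; rewrite E /= ltnNge.
    by rewrite (leq_trans _ tt0) // leq_maxl.
  - by move=> E; move: h1; rewrite E ltnNge (leq_trans _ tt0) // leq_maxr.
  - by move=> E; move: h2; rewrite -E ltnNge (leq_trans _ tt0) // leq_maxl.
have com t i : (t0 <= t)%N -> i \in A t ->
    embed n i0 g *m embed n i (G t i) = embed n i (G t i) *m embed n i0 g.
  move=> tt0 iA; have [f1 f2 f3] := free _ _ tt0 iA; have [f4 _ _] := hA1 _ _ iA.
  exact: (@embed_comm2 n i0' i).
have comL t : (t0 <= t)%N -> embed n i0 g *m layer A G t = layer A G t *m embed n i0 g.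
  move=> tt0; rewrite /layer; apply: (big_ind (fun M : op R (bits n) (bits n) =>
     embed n i0 g *m M = M *m embed n i0 g)).
  - exact: (etrans (mulmx1 _) (esym (mul1mx _))).
  - by move=> M N hM hN; rewrite -[M * N]/(M *m N) mulmxA hM -mulmxA hN mulmxA.
  - by move=> i iA; exact: com.
exists A', G'; split.
- move=> t i; rewrite /A'; case: ifP => [/eqP ->|tt0]; last first.
    move=> /hA1[h1 h2 h3]; split=> //.
      by case: ifP => // /orP[] /eqP E; [apply: leq_trans h2 _|apply: leq_trans h2 _];
         rewrite ltnW // ltnS E ?leq_maxl ?leq_maxr.
    case: ifP => // /orP[] /eqP E; apply: leq_trans h3 _;
      by rewrite ltnW // ltnS E ?leq_maxl ?leq_maxr.
  rewrite in_setU1 => /orP[/eqP ->|/hA1[h1 h2 h3]].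
    by split=> //=; rewrite eqxx ?orbT /= /t0 ltnS.
  split=> //; case: ifP => // _; rewrite -/t0 //.
- move=> t i j; rewrite /A'; case: ifP => [/eqP ->|_]; last exact: hA2.
  rewrite !in_setU1 => /orP[/eqP ->|iA] /orP[/eqP ->|jA] /=.
  + by move/eqP; rewrite eqn_leq ltnn andbF.
  + by have [] := free _ _ (leqnn _) jA.
  + by have [] := free _ _ (leqnn _) iA.
  + exact: hA2 iA jA.
- by move=> t i; rewrite /G'; case: ifP => _; [exact: ug|exact: hG].
- move=> d hd; have t0d : (t0 < d)%N.
    by have := hd i0 (ltnW i0n); rewrite eqxx.
  (* Layers below [t0] are unchanged, layer [t0] gains the new gate, and the gate commutes through
     all later layers to the outside. *)
  have lowE d' : (d' <= t0)%N -> layers A' G' d' = layers A G d'.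
    elim: d' => //= d' IHd dt0; rewrite IHd; last exact: ltnW.
    congr (_ *m _); rewrite /layer /A' /G' (ltn_eqF dt0).
    by apply: eq_bigr.
  have highE d' : (t0 < d')%N -> layers A' G' d' = embed n i0 g *m layers A G d'.
    elim: d' => // d' IHd; rewrite ltnS leq_eqVlt => /orP[/eqP E|dt0] /=.
      rewrite -E lowE // mulmxA; congr (_ *m _); rewrite /layer /A' /G' eqxx /=.
      have := @prod_comm_pull 'I_n 'M[C]_#|bits n| (fun i : 'I_n => embed n i (if i == i0' then g else G t0 i))
        (mem (A t0)) i0' (index_enum _) _ _ (index_enum_uniq _).
      rewrite mem_index_enum eqxx => PC.
      transitivity (embed n i0 g * \prod_(i in A t0) embed n i (if i == i0' then g else G t0 i)).
        rewrite -PC; last 2 first.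
        + by apply/negP => /(free _ _ (leqnn _))[]; rewrite eqxx.
        + move=> i iA; have [/negPf -> _ _] := free _ _ (leqnn _) iA; exact: com.
        by apply: eq_bigl => i; rewrite in_setU1.
      congr (_ * _); apply: eq_bigr => i iA.
      by have [/negPf -> _ _] := free _ _ (leqnn _) iA.
    rewrite IHd // !mulmxA; congr (_ *m _).
    have -> : layer A' G' d' = layer A G d'.
      by rewrite /layer /A' /G' (gtn_eqF dt0); apply: eq_bigr.
    by rewrite comL // ltnW.
  rewrite highE //; congr (_ *m _); apply: hE => q qn.
  apply: leq_trans (hd q qn); case: ifP => // /orP[] /eqP ->;
  by rewrite ltnW // ltnS ?leq_maxl ?leq_maxr.
Qed.

Lemma depth_word n w d : valid_word n w ->
  (forall q, (q < n)%N -> (profile (fun=> 0%N) (positions w) q <= d)%N) ->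
  depth_at_most d (eval_word n w).
Proof.
move=> /schedule_exists[A [G [hA1 hA2 hG hE]]] hd; rewrite (hE d hd).
(* The leftmost factor of the product acts last, so the layers are indexed backwards. *)
exists (fun t : 'I_d => layer A G (d - t.+1)).
  move=> t; exists (A (d - t.+1)%N), (G (d - t.+1)%N); split=> //.
  - by move=> i /hA1[].
  - exact: hA2.
elim: d {hd} => [|d IH]; first by rewrite big_ord0.
rewrite big_ord_recl /= subn1 /=; congr (_ *m _); rewrite IH.
by apply: eq_bigr => t _; rewrite /= /bump /= add1n subSS.
Qed.

Lemma embed_clifford n o m (U : op R (bits m) (bits m)) : (o + m <= n)%N ->
  clifford U -> clifford (embed n o U).
Proof.
move=> om /cliffordP[uU cU]; apply/cliffordP; split; first exact: embed_unitary.
by move=> s; have [v Uv] := cU (lwin o m s); exists (lpatch o s v); exact: embed_conjp.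
Qed.

Lemma valid_eval_clifford n w : valid_word n w -> clifford (eval_word n w).
Proof.
elim: w => [_|g w IH] /=; first exact: clifford1.
move=> [gn gu /IH uw]; have le2 : (g.1 + 2 <= n)%N by rewrite addn2.
exact (clifford_mul (embed_clifford le2 gu) uw).
Qed.

Lemma eval_fix n w (s : pauli_label n) : valid_word n w ->
  (forall i, i \in positions w -> forall q : 'I_n, (i <= q)%N -> s q = (false, false)) ->
  eval_word n w *m pauli R s *m (eval_word n w) ^t* = pauli R s.
Proof.
elim: w => [_ _|g w IH] /=; first by rewrite adj1 mul1mx mulmx1.
move=> [gn gu vw] s0; rewrite conj_mul IH // => [|i iw]; last first.
  by apply: s0; rewrite inE iw orbT.
have le2 : (g.1 + 2 <= n)%N by rewrite addn2.
apply: (embed_fix_pauli le2 (clifford_unitary gu)) => q /andP[q1 _].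
by apply: (s0 g.1); rewrite // inE eqxx.
Qed.

Definition shift_word o w : seq gate := [seq ((o + g.1)%N, g.2) | g <- w].

Lemma eval_shift n m o w : (o + m <= n)%N -> valid_word m w ->
  eval_word n (shift_word o w) = embed n o (eval_word m w) /\ valid_word n (shift_word o w).
Proof.
move=> om; elim: w => [_|g w IH] /=; first by rewrite embed1.
move=> [gm gu /IH[-> vw]]; split; last first.
  by split=> //; apply: leq_trans om; rewrite -addnS ltn_add2l.
by rewrite embedM // embed_embed // addn2.
Qed.

Lemma positions_shift o w : positions (shift_word o w) = map (addn o) (positions w).
Proof. by rewrite /positions /shift_word -!map_comp. Qed.

Lemma profile_shift_out h o m l q : all (fun i => i.+1 < m)%N l -> ~~ inwin o m q ->
  profile h (map (addn o) l) q = h q.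
Proof.
move=> + nq; elim: l => //= i l IH /andP[im lm]; rewrite IH //.
case: ifP => // H; case/negP: nq; rewrite /inwin.
by case/orP: H => /eqP ->; lia.
Qed.

Lemma profile_shift_in h o m b l q : all (fun i => i.+1 < m)%N l ->
  (forall r, (r < m)%N -> (h (o + r) <= b)%N) -> (q < m)%N ->
  (profile h (map (addn o) l) (o + q) <= b + profile (fun=> 0%N) l q)%N.
Proof.
move=> + hb; elim: l q => [|i l IH] q /=; first by move=> _ qm; rewrite addn0 hb.
move=> /andP[im lm] qm; rewrite -addnS !eqn_add2l; case: ifP => _; last exact: IH.
rewrite [X in (_ < X)%N]addnS ltnS addn_maxr geq_max !leq_max.
by rewrite !IH ?orbT // ltnW.
Qed.

Lemma valid_positions n w : valid_word n w -> all (fun i => i.+1 < n)%N (positions w).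
Proof. by elim: w => //= g w IH [-> _ /IH]. Qed.

(** The basis of pipelining: the staircase b + (m - q) is, up to a shift of at most 2, preserved by
    a sweep from the right end down to [j]. The next sweep can start on the right while the previous
    one is still moving left, so the depth is linear rather than quadratic. *)
Lemma profile_sweep h b m j c : (j + c = m.-1)%N ->
  (forall q, (q < m)%N -> (h q <= b + (m - q))%N) ->
  forall q, (q < m)%N ->
  (profile h (iota j c) q <= b + (m - q) + (if (q < j)%N then 0 else if q == j then 1 else 2))%N.
Proof.
move=> + hb; elim: c j => [|c IH] j jc q qm /=.
  by apply: leq_trans (hb q qm) _; rewrite leq_addr.
have jc' : (j.+1 + c = m.-1)%N by rewrite addSnnS.
have jm : (j.+1 < m)%N by lia.
have := IH j.+1 jc' j (ltnW jm); have := IH j.+1 jc' j.+1 jm; have := IH j.+1 jc' q qm.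
rewrite ltnS leqnn ltnn eqxx => h1 h2 h3.
case: ifP => [/orP[] /eqP ->|]; rewrite ?ltnn ?eqxx ?ltnS ?leqnn.
- by move: h2 h3; lia.
- have -> : (j.+1 < j)%N = false by lia.
  by rewrite (gtn_eqF (ltnSn j)); lia.
move=> /norP[n1 n2]; apply: (leq_trans h1); rewrite leq_add2l.
by move: n1 n2; case: (ltngtP q j) => // qj _ /negPf ->.
Qed.

End GateWords.

(** * Synthesis of Clifford unitaries from two-qubit gates *)

Section Synthesis.
Variable R : realType.
Local Notation C := (complex R).
Local Notation gate := (nat * op R (bits 2) (bits 2))%type.

Definition lat (n : nat) (j : nat) (a : bool * bool) : pauli_label n :=
  [ffun q : 'I_n => if (q : nat) == j then a else (false, false)].

Definition zero_above (n : nat) (j : nat) (s : pauli_label n) :=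
  forall q : 'I_n, (j < q)%N -> s q = (false, false).

Lemma symp_at n (s t : pauli_label n) (j : 'I_n) :
  (forall q, q != j -> t q = (false, false)) ->
  symp s t = ((s j).1 && (t j).2) (+) ((s j).2 && (t j).1).
Proof.
move=> t0; rewrite /symp (bigD1 j) //= big1 ?addbF // => q qj.
by rewrite t0 // !andbF.
Qed.

Lemma latE n (j : 'I_n) a : lat n j a j = a.
Proof. by rewrite ffunE eqxx. Qed.

Lemma lat_out n (j : 'I_n) a q : q != j -> lat n j a q = (false, false).
Proof. by move=> qj; rewrite ffunE (inj_eq val_inj) (negPf qj). Qed.

Lemma symp_lat n (s : pauli_label n) (j : 'I_n) a :
  symp s (lat n j a) = ((s j).1 && a.2) (+) ((s j).2 && a.1).
Proof. by rewrite (@symp_at n s _ j) ?latE //; exact: lat_out. Qed.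

Lemma clear_second (a : pauli_label 2) :
  exists2 G : op R (bits 2) (bits 2), clifford G &
    exists2 b, conjp G a b & b ord_max = (false, false).
Proof.
have [->|a0] := eqVneq a (lzero 2).
  exists 1%:M; first exact: clifford1.
  by exists (lzero 2); [exact: conjp1|rewrite ffunE].
pose x : pauli_label 2 := lat 2 0 (true, false).
have x0 : x != lzero 2.
  apply/eqP => /ffunP/(_ ord0); by rewrite !ffunE.
have [G cG Gax] := pauli_transitive R a0 x0.
by exists G => //; exists x; rewrite // ffunE.
Qed.

(** The gate at a site clears the site to its right; running from the right end to [j] leaves
    nothing beyond [j]. *)
Lemma sweep_one (n j c : nat) (s : pauli_label n) : (j + c = n.-1)%N ->
  exists w : seq gate, [/\ valid_word n w, positions w = iota j c &
    exists2 s', conjp (eval_word n w) s s' & zero_above j s' /\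
      (forall q : 'I_n, (q < j)%N -> s' q = s q)].
Proof.
elim: c j => [|c IH] j jc.
  exists [::]; split=> //; exists s; first exact: conjp1.
  split=> // q jq; have := ltn_ord q; move: jc jq; rewrite addn0 => ->; lia.
have jc' : (j.+1 + c = n.-1)%N by rewrite addSnnS.
have [w [vw pw [s1 ws1 [s1a s1b]]]] := IH _ jc'.
have le2 : (j + 2 <= n)%N by lia.
have [G cG [b Gb b0]] := clear_second (lwin j 2 s1).
exists ((j, G) :: w); split=> /=.
- by split=> //; rewrite -addn2.
- by rewrite pw.
exists (lpatch j s1 b).
  apply: (conjp_mul ws1); apply: (embed_conjp le2) => //.
  exact: clifford_unitary.
split=> [q jq|q qj]; last first.
  by rewrite patch_out ?s1b // ?ltnS ?(ltnW qj) //; rewrite /inwin leqNgt qj.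
have [/(inwinP le2)[i E]|nq] := boolP (inwin j 2 q).
  rewrite E (patch_in le2); move: jq; rewrite E /= => ji.
  suff -> : i = ord_max by [].
  by apply: val_inj => /=; have := ltn_ord i; lia.
rewrite patch_out // s1a //; move: nq jq; rewrite /inwin; lia.
Qed.

Lemma conj_prod n (U P Q : 'M[C]_n) : U ^t* *m U = 1%:M ->
  U *m (P *m Q) *m U ^t* = (U *m P *m U ^t*) *m (U *m Q *m U ^t*).
Proof. by move=> UU; rewrite -!mulmxA (mulmxA (U ^t*) U) UU mul1mx. Qed.

Definition fixes n (E : op R (bits n) (bits n)) s :=
  E *m pauli R s *m E ^t* = pauli R s.

Lemma fixes_add n (E : op R (bits n) (bits n)) s t : E \is unitarymx ->
  fixes E s -> fixes E t -> fixes E (ladd s t).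
Proof.
move=> uE fs ft; apply: (scalerI (phase_neq0 (phase_pmul R s t))).
rewrite /fixes scalemxAl scalemxAr -pauliM conj_prod ?unitary_mulVmx //.
by rewrite fs ft.
Qed.

Lemma fixes_mul n (V U : op R (bits n) (bits n)) s : fixes V s -> fixes U s -> fixes (V *m U) s.
Proof. by move=> fV fU; rewrite /fixes conj_mul fU fV. Qed.

Lemma fixes_conjp n (E : op R (bits n) (bits n)) s : fixes E s -> conjp E s s.
Proof. by move=> f; exists 1; [exact: phase1|rewrite f scale1r]. Qed.

Lemma lpatch_lwin0 n o m (s : pauli_label n) : (o + m <= n)%N ->
  (forall q : 'I_n, ~~ inwin o m q -> s q = (false, false)) ->
  lpatch o (lzero n) (lwin o m s) = s.
Proof.
move=> om s0; apply/ffunP => q; have [/(inwinP om)[i ->]|nq] := boolP (inwin o m q).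
  by rewrite (patch_in om) (gwinE _ om).
by rewrite patch_out // s0 // ffunE.
Qed.

Lemma symp_lwin n o m (s t : pauli_label n) : (o + m <= n)%N ->
  (forall q : 'I_n, ~~ inwin o m q -> t q = (false, false)) ->
  symp (lwin o m s) (lwin o m t) = symp s t.
Proof.
move=> om t0; rewrite /symp (bigID (fun q : 'I_n => inwin o m q)) /=.
rewrite [X in _ = _ (+) X]big1 ?addbF => [|q nq]; last by rewrite t0 // !andbF.
have inj : {in [set: 'I_m]%SET &, injective (winord om)}.
  by move=> i j _ _ /(congr1 val)/= /addnI /val_inj.
transitivity (\big[addb/false]_(q in [set winord om j | j in [set: 'I_m]%SET]%SET)
   (((s q).1 && (t q).2) (+) ((s q).2 && (t q).1))).
  rewrite (big_imset _ inj) /=; apply: eq_big => [j|j _]; first by rewrite inE.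
  by rewrite !(gwinE _ om).
apply: eq_bigl => q; apply/imsetP/inwinP => [[j _ ->]|[j ->]]; first by exists j.
by exists j; rewrite ?inE.
Qed.

Lemma pair_gate n o m (a b a' b' : pauli_label n) (x y : bool) : (o + m <= n)%N ->
  (forall q : 'I_n, ~~ inwin o m q ->
     [/\ a q = (false, false), b q = (false, false), a' q = (false, false) & b' q = (false, false)]) ->
  symp a b -> symp a' b' ->
  exists G : op R (bits m) (bits m), [/\ clifford G,
    embed n o G *m ((-1) ^+ x *: pauli R a) *m (embed n o G) ^t* = pauli R a' &
    embed n o G *m ((-1) ^+ y *: pauli R b) *m (embed n o G) ^t* = pauli R b'].
Proof.
move=> om out ab ab'.
have outa (q : 'I_n) : ~~ inwin o m q -> a q = (false, false) by case/out.
have outb (q : 'I_n) : ~~ inwin o m q -> b q = (false, false) by case/out.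
have outa' (q : 'I_n) : ~~ inwin o m q -> a' q = (false, false) by case/out.
have outb' (q : 'I_n) : ~~ inwin o m q -> b' q = (false, false) by case/out.
have wab : symp (lwin o m a) (lwin o m b) by rewrite symp_lwin.
have wab' : symp (lwin o m a') (lwin o m b') by rewrite symp_lwin.
have [G [cG Ga Gb]] := pauli_pair_transport R x y wab wab'.
have tr (z : bool) (s s' : pauli_label n) :
    (forall q : 'I_n, ~~ inwin o m q -> s q = (false, false)) ->
    (forall q : 'I_n, ~~ inwin o m q -> s' q = (false, false)) ->
    G *m ((-1) ^+ z *: pauli R (lwin o m s)) *m G ^t* = pauli R (lwin o m s') ->
    embed n o G *m ((-1) ^+ z *: pauli R s) *m (embed n o G) ^t* = pauli R s'.
  move=> so so' E; rewrite -(lpatch_lwin0 om so) -(lpatch_lwin0 om so').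
  by rewrite -!embed_pauli // -embedZ -embed_adj -!embedM // E.
by exists G; split=> //; apply: tr.
Qed.

Definition zero_from (n : nat) (j : nat) (s : pauli_label n) :=
  forall q : 'I_n, (j <= q)%N -> s q = (false, false).

(** For q < j, X_q and Z_q are fixed by [E] and commute with the label at [j]; its image therefore
    commutes with both and is trivial at [q]. *)
Lemma image_zero_below n (j : 'I_n) E a p : E \is unitarymx ->
  (forall s : pauli_label n, zero_from j s -> fixes E s) ->
  conjp E (lat n j a) p -> forall q : 'I_n, (q < j)%N -> p q = (false, false).
Proof.
move=> uE fE Ep q qj.
have key b : symp p (lat n q b) = false.
  have f : conjp E (lat n q b) (lat n q b).
    apply/fixes_conjp/fE => i ji; apply: lat_out; apply: contraTneq ji => ->.
    by rewrite -ltnNge.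
  rewrite (conjp_symp uE Ep f) symp_lat lat_out //.
  by apply: contraTneq qj => ->; rewrite ltnn.
have := key (true, false); have := key (false, true); rewrite !symp_lat /=.
by rewrite !andbT !andbF addbF /=; case: (p q) => a1 a2 /= -> ->.
Qed.

Lemma fixes_extend n (j : 'I_n) E : E \is unitarymx ->
  (forall s : pauli_label n, zero_from j s -> fixes E s) ->
  fixes E (lat n j (true, false)) -> fixes E (lat n j (false, true)) ->
  forall s : pauli_label n, zero_from j.+1 s -> fixes E s.
Proof.
move=> uE f0 fx fz s s0.
pose s1 : pauli_label n := [ffun q => if q == j then (false, false) else s q].
have f1 : fixes E s1.
  apply: f0 => q; rewrite leq_eqVlt => /orP[/eqP/val_inj <-|jq]; rewrite ffunE ?eqxx //.
  by case: eqP => // _; exact: s0.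
have fl : fixes E (lzero n) by apply: f0 => q _; rewrite ffunE.
have -> : s = ladd s1 (ladd (if (s j).1 then lat n j (true, false) else lzero n)
                            (if (s j).2 then lat n j (false, true) else lzero n)).
  apply/ffunP => q; rewrite !ffunE; have [->|qj] := eqVneq q j.
    by case: (s j) => [[] []] /=; rewrite ?latE ?ffunE.
  by case: (s j) => [[] []] /=; rewrite ?lat_out ?ffunE //; case: (s q) => a b /=; rewrite ?addbF.
by do 2![apply: fixes_add => //]; case: ifP.
Qed.

Lemma symp_xz n (j : 'I_n) : symp (lat n j (true, false)) (lat n j (false, true)).
Proof. by rewrite symp_lat latE. Qed.

(** A sweep of two-qubit gates from the right end to site [j] moves the image of
    X_j onto site [j]; a second sweep does the same for Z_j while fixing X_j. *)
Lemma synthesis_step n (j : 'I_n) E : (2 <= n)%N -> clifford E ->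
  (forall s : pauli_label n, zero_from j s -> fixes E s) ->
  exists w : seq gate, [/\ valid_word n w,
    forall h b, (forall q, (q < n)%N -> (h q <= b + (n - q))%N) ->
      forall q, (q < n)%N -> (profile h (positions w) q <= b + 4 + (n - q))%N
    & forall s : pauli_label n, zero_from j.+1 s -> fixes (eval_word n w *m E) s].
Proof.
move=> n2 cE fE; have uE := clifford_unitary cE.
set x := lat n j (true, false); set z := lat n j (false, true).
have [_ /(_ x)[p Ep]] := (cliffordP E).1 cE.
have p0 := image_zero_below uE fE Ep.
have jc : (j + (n.-1 - j) = n.-1)%N by have := ltn_ord j; lia.
have [w1 [v1 pos1 [p1 Wp [p1a p1b]]]] := sweep_one p jc.
have p1_out (q : 'I_n) : q != j -> p1 q = (false, false).
  rewrite -(inj_eq val_inj) neq_ltn => /orP[qj|jq]; last exact: p1a.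
  by rewrite p1b // p0.
have cW1 := valid_eval_clifford v1.
have sweep_bound h b c : (j + c = n.-1)%N ->
    (forall q, (q < n)%N -> (h q <= b + (n - q))%N) ->
    forall q, (q < n)%N -> (profile h (iota j c) q <= b + 2 + (n - q))%N.
  move=> jc' hb q qn; apply: leq_trans (profile_sweep jc' hb qn) _.
  by rewrite addnAC leq_add2r leq_add2l; case: ifP => // _; case: ifP.
have fix1 s : zero_from j s -> fixes (eval_word n w1 *m E) s.
  move=> s0; apply: fixes_mul (fE s s0); apply: eval_fix => // i.
  by rewrite pos1 mem_iota => /andP[ji _] q iq; apply: s0; exact: leq_trans ji iq.
have cE1 : clifford (eval_word n w1 *m E) by exact: clifford_mul.
(* Common end of both cases: a last gate at [j] returns the images of X_j and Z_j, with their signs,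
   to X_j and Z_j. *)
have finish (w2 : seq gate) m (G : op R (bits m) (bits m)) r1 (bx bz : bool) :
    valid_word n w2 ->
    (forall i, i \in positions w2 -> (j < i)%N) -> (0 < m)%N -> (j + m <= n)%N -> clifford G ->
    conjp (eval_word n w2 *m (eval_word n w1 *m E)) z r1 ->
    forall e, e = embed n j G -> 
    let E2 := eval_word n w2 *m (eval_word n w1 *m E) in
    E2 *m pauli R x *m E2 ^t* = (-1) ^+ bx *: pauli R p1 ->
    E2 *m pauli R z *m E2 ^t* = (-1) ^+ bz *: pauli R r1 ->
    e *m ((-1) ^+ bx *: pauli R p1) *m e ^t* = pauli R x ->
    e *m ((-1) ^+ bz *: pauli R r1) *m e ^t* = pauli R z ->
    forall s, zero_from j.+1 s -> fixes (e *m E2) s.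
  move=> v2 pos2 m0 jm cG _ e -> E2 Ex Ez ex ez.
  have cE2 : clifford E2 by exact (clifford_mul (valid_eval_clifford v2) cE1).
  have ce := embed_clifford jm cG.
  have ceE := clifford_mul ce cE2.
  apply: (fixes_extend (clifford_unitary ceE)).
  - move=> s s0; apply: fixes_mul.
      apply: (embed_fix_pauli jm (clifford_unitary cG)) => q /andP[jq _].
      exact: s0.
    apply: fixes_mul (fix1 s s0); apply: eval_fix => // i /pos2 ji q iq.
    by apply: s0; apply: leq_trans iq; exact: ltnW.
  - by rewrite /fixes conj_mul Ex.
  - by rewrite /fixes conj_mul Ez.
have [jlast|jlast] := eqVneq (j : nat) n.-1.
  have [_ /(_ z)[r E1r]] := (cliffordP _).1 cE1.
  have r0 := image_zero_below (clifford_unitary cE1) fix1 E1r.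
  have Ex1 : conjp (eval_word n w1 *m E) x p1 by exact: conjp_mul Ep Wp.
  have [bx Ex] := conjp_sign (clifford_unitary cE1) Ex1.
  have [bz Ez] := conjp_sign (clifford_unitary cE1) E1r.
  have j1 : (j + 1 <= n)%N by rewrite addn1.
  have [|||G [cG ex ez]] := @pair_gate n j 1 p1 r x z bx bz j1.
  - move=> q nq; have qj : q != j.
      by apply: contraNneq nq => ->; rewrite /inwin leqnn addn1 ltnSn.
    split; [exact: p1_out| |exact: lat_out|exact: lat_out].
    apply: r0; move: qj nq; rewrite -(inj_eq val_inj) /inwin; have := ltn_ord q; lia.
  - by rewrite (conjp_symp (clifford_unitary cE1) Ex1 E1r) symp_xz.
  - exact: symp_xz.
  have le12 : (1 + 1 <= 2)%N by [].
  have le2 : (n - 2 + 2 <= n)%N by rewrite subnK.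
  (* Words contain only two-qubit gates, so at the last site the one-qubit gate is realised on sites
     n - 2 and n - 1. *)
  have eE : embed n (n - 2) (embed 2 1 G) = embed n j G.
    by rewrite embed_embed //; congr (embed n _ G); lia.
  exists ((n - 2, embed 2 1 G)%N :: w1); split.
  - by split=> //=; [lia|exact: embed_clifford].
  - move=> h b hb; rewrite /= -/(positions w1) pos1.
    have -> : (n.-1 - j = 0)%N by rewrite jlast subnn.
    move=> q qn /=; apply: leq_trans (profile_sweep (c := 1) (j := (n - 2)%N) _ hb qn) _.
      by lia.
    by rewrite addnAC leq_add2r leq_add2l; case: ifP => // _; case: ifP.
  - rewrite /= -mulmxA.
    have := finish [::] 1%N G r bx bz I _ isT j1 cG _ _ eE; rewrite /= mul1mx eE => H.
    exact: H.
have jn : (j.+1 < n)%N by have := ltn_ord j; move: jlast; lia.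
have jc2 : (j.+1 + (n.-1 - j.+1) = n.-1)%N by lia.
have [_ /(_ z)[r E1r]] := (cliffordP _).1 cE1.
have r0 := image_zero_below (clifford_unitary cE1) fix1 E1r.
have [w2 [v2 pos2 [r1 Wr [r1a r1b]]]] := sweep_one r jc2.
have cE2 : clifford (eval_word n w2 *m (eval_word n w1 *m E)).
  by exact (clifford_mul (valid_eval_clifford v2) cE1).
have W2p : conjp (eval_word n w2) p1 p1.
  apply/fixes_conjp/eval_fix => // i; rewrite pos2 mem_iota => /andP[ji _] q iq.
  apply: p1_out; rewrite -(inj_eq val_inj); apply: contraTneq iq => ->.
  by rewrite -ltnNge.
have Ex2 := conjp_mul (conjp_mul Ep Wp) W2p.
have Ez2 := conjp_mul E1r Wr.
have [bx Ex] := conjp_sign (clifford_unitary cE2) Ex2.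
have [bz Ez] := conjp_sign (clifford_unitary cE2) Ez2.
have j2 : (j + 2 <= n)%N by rewrite addn2.
have [|||G [cG ex ez]] := @pair_gate n j 2 p1 r1 x z bx bz j2.
- move=> q nq; have qj : q != j.
    by apply: contraNneq nq => ->; rewrite /inwin leqnn addn2 ltnS leqnSn.
  split; [exact: p1_out| |exact: lat_out|exact: lat_out].
  move: qj nq; rewrite -(inj_eq val_inj) neq_ltn => /orP[qj _|jq nq].
    by rewrite r1b ?r0 // ltnW.
  apply: r1a; move: nq jq; rewrite /inwin /=; lia.
- by rewrite (conjp_symp (clifford_unitary cE2) Ex2 Ez2) symp_xz.
- exact: symp_xz.
exists ((j : nat, G) :: w2 ++ w1); split.
- by split=> //; exact: valid_cat.
- move=> h b hb q qn.
  (* The second sweep stops at j + 1, off the image of X_j. The final gate at [j] completes its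
     positions to a full sweep, so the step costs two sweeps of 2 each. *)
  have -> : positions ((j : nat, G) :: w2 ++ w1)
      = iota j (n.-1 - j) ++ iota j (n.-1 - j).
    rewrite /positions /= map_cat -!/(positions _) pos1 pos2 -cat_cons.
    by congr (_ ++ _); rewrite (_ : n.-1 - j = (n.-1 - j.+1).+1)%N //; lia.
  rewrite profile_cat -[4%N]/(2 + 2)%N addnA.
  by apply: (sweep_bound _ _ _ jc) qn => q' q'n; exact: (sweep_bound _ _ _ jc).
- rewrite /= eval_cat -!mulmxA.
  apply: (finish w2 2%N G r1 bx bz v2 _ isT j2 cG Ez2 _ erefl) => // i.
  by rewrite pos2 mem_iota => /andP[].
Qed.

(** The word [W] undoes the adjoint of [U] site by site until the product commutes with every Pauli
    operator and is a scalar. Each of the n sites costs 4 on top of a staircase of height n, whence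
    5 n; one extra gate carrying the global phase gives the + 1. *)
Lemma synthesis n (U : op R (bits n) (bits n)) : (2 <= n)%N -> clifford U ->
  exists w : seq gate, [/\ valid_word n w, U = eval_word n w
    & forall q, (q < n)%N -> (profile (fun=> 0%N) (positions w) q <= 5 * n + 1)%N].
Proof.
move=> n2 cU; have cE := clifford_adj cU; set E := U ^t* in cE.
have [w [vw pw fw]] : exists w : seq gate, [/\ valid_word n w,
    forall q, (q < n)%N -> (profile (fun=> 0%N) (positions w) q <= 4 * n + (n - q))%N
    & forall s : pauli_label n, fixes (eval_word n w *m E) s].
  suff H j : (j <= n)%N -> exists w : seq gate, [/\ valid_word n w,
      forall q, (q < n)%N -> (profile (fun=> 0%N) (positions w) q <= 4 * j + (n - q))%N
      & forall s : pauli_label n, zero_from j s -> fixes (eval_word n w *m E) s].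
    have [w [vw pw fw]] := H n (leqnn n).
    exists w; split=> // s; apply: fw => q; by rewrite leqNgt ltn_ord.
  elim: j => [_|j IH jn].
    exists [::]; split=> // s s0; rewrite /= mul1mx.
    have -> : s = lzero n by apply/ffunP => q; rewrite s0 // ffunE.
    rewrite /fixes pauli0 mulmx1 unitary_mulmxV //; exact: clifford_unitary.
  have [w [vw pw fw]] := IH (ltnW jn).
  have cwE : clifford (eval_word n w *m E) by apply: clifford_mul => //; exact: valid_eval_clifford.
  have [w' [vw' pw' fw']] := @synthesis_step n (Ordinal jn) _ n2 cwE fw.
  exists (w' ++ w); split; first exact: valid_cat.
    move=> q qn; rewrite /positions map_cat profile_cat mulnS [(4 + _)%N]addnC.
    exact: pw'.
  by move=> s s0; rewrite eval_cat -mulmxA; exact: fw'.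
set W := eval_word n w in fw *.
have cW : clifford W by exact: valid_eval_clifford.
have [c Wc] : exists c, W *m E = c%:M.
  apply: pauli_commutant => s; have := fw s; rewrite /fixes.
  have uWE : W *m E \is unitarymx by exact: clifford_unitary (clifford_mul cW cE).
  by move=> f; rewrite -{2}f -(mulmxA _ ((W *m E) ^t*)) unitary_mulVmx // mulmx1.
have [c1 EW] : `|c| = 1 /\ E = c *: W ^t*.
  apply: (unitary_scalar_phase (enum_rank ([ffun=> false] : bits n))).
  - exact: clifford_unitary.
  - exact: op_unitary_adj (clifford_unitary cW).
  - by rewrite trmxCK.
have UW : U = c^* *: W by rewrite -[U]trmxCK -/E EW adjZ trmxCK.
exists ((0, c^* *: 1%:M)%N :: w); split.
- split=> //=; apply/cliffordP; split=> [|s].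
    apply/unitarymxP; rewrite adjZ adj1 -scalemxAl mul1mx scalerA conjCK.
    by rewrite mulrC -normCK c1 expr1n scale1r.
  exists s; exists 1; first exact: phase1.
  rewrite adjZ adj1 -scalemxAl mul1mx -scalemxAr mulmx1 scalerA conjCK.
  by rewrite -normCK c1 expr1n.
- by rewrite /= embedZ // embed1 // -scalemxAl mul1mx.
- have b5 q : (q < n)%N -> (profile (fun=> 0%N) (positions w) q <= 5 * n)%N.
    by move=> qn; apply: leq_trans (pw q qn) _; lia.
  move=> q qn /=; rewrite -/(positions w) addn1; case: ifP => _; last by rewrite ltnW // ltnS b5.
  by rewrite ltnS geq_max !b5 // ltnW.
Qed.

End Synthesis.

Section DoubleLayerDepth.
Variable R : realType.
Local Notation gate := (nat * op R (bits 2) (bits 2))%type.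
Variables (n N xi : nat).
Local Notation J := (N.*2).-1.
Variable wd : 'I_J -> seq gate.
Hypothesis vwd : forall j, valid_word xi.*2 (wd j).
Let off (j : 'I_J) := (j * xi)%N.
Let word (l : seq 'I_J) : seq gate := flatten [seq shift_word (off j) (wd j) | j <- l].

Hypothesis fits : forall j : 'I_J, (off j + xi.*2 <= n)%N.

Lemma eval_blocks l : valid_word n (word l) /\
  eval_word n (word l) = \prod_(j <- l) embed n (off j) (eval_word xi.*2 (wd j)).
Proof.
elim: l => [|j l [vl El]]; first by rewrite big_nil.
have [Ej vj] := eval_shift (fits j) (vwd j).
rewrite /word /= -/(word l) big_cons; split; first exact: valid_cat.
by rewrite eval_cat Ej El.
Qed.

Lemma profile_blocks (b D : nat) (l : seq 'I_J) h : uniq l ->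
  (forall i j, i \in l -> j \in l -> i != j ->
     forall q, inwin (off j) xi.*2 q -> ~~ inwin (off i) xi.*2 q) ->
  (forall j q, (q < xi.*2)%N -> (profile (fun=> 0%N) (positions (wd j)) q <= D)%N) ->
  (forall q, (q < n)%N -> (h q <= b)%N) ->
  forall q, (q < n)%N ->
    (profile h (positions (word l)) q <= if covered xi.*2 off l q then b + D else b)%N.
Proof.
move=> + + hD hb; elim: l => [|j l IH] /=; first by move=> _ _ q; exact: hb.
move=> /andP[jl ul] disj q qn.
have IHl := IH ul (fun i i' il i'l => disj i i' (mem_behead (s := j :: l) il) (mem_behead (s := j :: l) i'l)).
rewrite /word /= -/(word l) /positions map_cat -!/(positions _) profile_cat.
rewrite positions_shift /covered /= -/(covered xi.*2 off l q).
have posj := valid_positions (vwd j).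
have [jq|jq] /= := boolP (inwin (off j) xi.*2 q); last first.
  by rewrite (profile_shift_out _ posj jq); exact: IHl.
have [r rE rx] : exists2 r, q = (off j + r)%N & (r < xi.*2)%N.
  by exists (q - off j)%N; move: jq; rewrite /inwin; lia.
rewrite rE; apply: leq_trans (profile_shift_in (b := b) posj _ rx) _; last first.
  by rewrite leq_add2l; exact: hD.
move=> r' r'x; have qn' : (off j + r' < n)%N by apply: leq_trans (fits j); rewrite ltn_add2l.
have := IHl _ qn'; rewrite (_ : covered _ _ _ _ = false) //.
apply/negbTE/hasPn => i il; apply: (disj i j); rewrite ?inE ?eqxx ?il ?orbT //.
  by apply: contraNneq jl => <-.
by rewrite /inwin leq_addr ltn_add2l.
Qed.

End DoubleLayerDepth.

(** The gates of a layer have disjoint windows and run in parallel, so each layer costs 5 (2 xi) +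
    1. *)
Lemma double_layer_depth (R : realType) (n N xi : nat)
  (G : 'I_(N.*2).-1 -> op R (bits xi.*2) (bits xi.*2)) :
  (0 < n)%N -> n = (N.*2 * xi)%N -> (forall j, clifford (G j)) ->
  depth_at_most (20 * xi + 2) (double_layer n G).
Proof.
move=> n0 nE cG; have xi0 := xi_gt0 n0 nE.
have x2 : (2 <= xi.*2)%N by rewrite -[2%N]/(1.*2) leq_double.
have /choice[wd wdP] j := synthesis x2 (cG j).
have vwd j : valid_word xi.*2 (wd j) by case: (wdP j).
have EG j : G j = eval_word xi.*2 (wd j) by case: (wdP j).
have pwd j := (let: And3 _ _ h := wdP j in h).
have fits (j : 'I_(N.*2).-1) : (j * xi + xi.*2 <= n)%N.
  by apply: (gate_fits n0 nE (leq0n n)); rewrite mul0n dvdn0.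
pose odds := [seq j : 'I_(N.*2).-1 <- index_enum _ | odd j].
pose evens := [seq j : 'I_(N.*2).-1 <- index_enum _ | ~~ odd j].
have [vo Eo] := eval_blocks vwd fits odds.
have [ve Ee] := eval_blocks vwd fits evens.
set wo := flatten _ in vo Eo; set we := flatten _ in ve Ee.
have -> : double_layer n G = eval_word n (wo ++ we).
  rewrite eval_cat Eo Ee /double_layer !big_filter.
  by congr (_ *m _); apply: eq_bigr => j _; rewrite EG.
apply: depth_word; first exact: valid_cat.
have be q : (q < n)%N -> (profile (fun=> 0%N) (positions we) q <= 10 * xi + 1)%N.
  move=> qn; have := @profile_blocks R n N xi wd vwd fits 0 (10 * xi + 1) evens (fun=> 0%N) _ _ _ _ q qn.
  rewrite -/we => H; apply: (leq_trans (H _ _ _ _)) => //.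
  - by rewrite filter_uniq // index_enum_uniq.
  - move=> i j; rewrite !mem_filter => /andP[/negPf oi _] /andP[/negPf oj _].
    by apply: (window_disjoint n0 nE (leq0n n)); rewrite ?mul0n ?dvdn0 // oi oj.
  - by move=> j r rx; apply: leq_trans (pwd j r rx) _; lia.
  - by case: ifP.
move=> q qn; rewrite /positions map_cat profile_cat.
have := @profile_blocks R n N xi wd vwd fits (10 * xi + 1) (10 * xi + 1) odds (profile (fun=> 0%N) (positions we)) _ _ _ _ q qn.
rewrite -/wo => H; apply: (leq_trans (H _ _ _ _)) => //.
- by rewrite filter_uniq // index_enum_uniq.
- move=> i j; rewrite !mem_filter => /andP[oi _] /andP[oj _].
  by apply: (window_disjoint n0 nE (leq0n n)); rewrite ?mul0n ?dvdn0 // oi oj.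
- by move=> j r rx; apply: leq_trans (pwd j r rx) _; lia.
- by case: ifP => _; lia.
Qed.

(** * Rates *)

Section Asymptotics.
Variable R : realType.
Implicit Types (p x : R).

Lemma ln2_gt0 : 0 < ln 2 :> R.
Proof. by apply: ln_gt0; rewrite ltr1n. Qed.

Lemma pow2_log2 x : 0 < x -> 2 `^ log2 x = x.
Proof.
move=> x0; apply: ln_inj; rewrite ?posrE ?powR_gt0 //.
by rewrite ln_powR /log2 divfK // gt_eqF // ln2_gt0.
Qed.

Lemma log2_pow2 x : log2 (2 `^ x) = x.
Proof. by rewrite /log2 ln_powR mulfK // gt_eqF // ln2_gt0. Qed.

Lemma le_log2 x y : 0 < x -> x <= y -> log2 x <= log2 y.
Proof.
move=> x0 xy; rewrite ler_pM2r ?invr_gt0 ?ln2_gt0 //.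
by rewrite ler_ln ?posrE // (lt_le_trans x0).
Qed.

Lemma pow2D x y : 2 `^ (x + y) = 2 `^ x * 2 `^ y :> R.
Proof. by rewrite powRD // pnatr_eq0 implybT. Qed.

Lemma sqrt_sqrt_powR x : 0 <= x -> Num.sqrt (Num.sqrt x) = x `^ (1 / 4).
Proof.
move=> x0; rewrite -!powR12_sqrt ?powR_ge0 // -powRrM.
by congr (_ `^ _); field.
Qed.

Section BlockedParameters.
Variables (n k N xi : nat) (eps : R).
Hypothesis params : blocked_params n k N xi eps.
Local Notation kap := (k * xi %/ n)%N.
Local Notation rate := (k%:R / n%:R : R).
Local Notation mu := (2 ^- (xi - kap) : R).

Let n_gt0 : (0 < n)%N. Proof. by case: params. Qed.
Let nE : n = (N.*2 * xi)%N. Proof. by case: params. Qed.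
Let eps_gt0 : 0 < eps. Proof. by case: params. Qed.
Let xiE : xi%:R = log2 (n%:R / eps). Proof. by case: params. Qed.
Let le_kn : (k <= n)%N. Proof. by case: params => _ _ _ _ []. Qed.
Let dvd_n : (n %| k * xi)%N. Proof. by case: params => _ _ _ _ []. Qed.
Let n0 : (n%:R : R) != 0. Proof. by rewrite pnatr_eq0 -lt0n. Qed.

Lemma kapE : kap%:R = rate * xi%:R.
Proof.
by apply: (mulIf n0); rewrite -natrM divnK // natrM; field.
Qed.

Lemma eps_over_n : eps / n%:R = 2 `^ (- xi%:R).
Proof.
rewrite powRN xiE pow2_log2 ?invf_div //.
by rewrite divr_gt0 ?ltr0n.
Qed.

Lemma muE : mu = 2 `^ (- (xi%:R * (1 - rate))).
Proof.
rewrite powRN -powR_mulrn // natrB ?kap_le // kapE.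
by congr (_ `^ _)^-1; ring.
Qed.

Lemma mu_eps : (eps / n%:R) `^ (1 - rate) = mu.
Proof. by rewrite muE eps_over_n -powRrM mulNr. Qed.

Lemma sg_mu_le1 p : 0 < p -> rate <= 1 - log2 (1 + 3 * p) ->
  (1 + 3 * p) ^+ xi * mu <= 1.
Proof.
move=> p0 rle; have q0 : 0 < 1 + 3 * p by lra.
rewrite muE -{1}(pow2_log2 q0) -powR_mulrn ?powR_ge0 // -powRrM -pow2D.
rewrite -[leRHS](powRr0 2) ler_powR ?ler1n //.
rewrite [X in X + _]mulrC -mulrBr mulr_ge0_le0 // subr_le0; lra.
Qed.

Lemma first_term p : 0 < p ->
  (mu ^+ 2 * (1 + 3 * p) ^+ xi ^+ 2) ^+ N
  = 2 `^ (- (n%:R * (1 - log2 (1 + 3 * p) - rate))).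
Proof.
move=> p0; have q0 : 0 < 1 + 3 * p by lra.
rewrite muE -{1}(pow2_log2 q0) -(powR_mulrn xi) ?powR_ge0 // -powRrM.
rewrite -exprMn -pow2D -exprM -powR_mulrn ?powR_ge0 // -powRrM.
have nR : n%:R = 2 * N%:R * xi%:R :> R by rewrite {1}nE -mul2n !natrM.
by rewrite natrM; congr (_ `^ _); move: rate => r; rewrite nR; ring.
Qed.

(** eps^(1-rate) n^rate equals mu n by [mu_eps], while n = 2 N xi and the logarithm is [xi]. *)
Lemma second_term :
  4 * eps `^ (1 - rate) * n%:R `^ rate / log2 (n%:R / eps) = 8 * N%:R * mu.
Proof.
have xi0 : (xi%:R : R) != 0 by rewrite pnatr_eq0 -lt0n (xi_gt0 n_gt0 nE).
have -> : eps `^ (1 - rate) = mu * n%:R `^ (1 - rate).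
  by rewrite -mu_eps -powRM ?divr_ge0 ?(ltW eps_gt0) // divfK.
rewrite -xiE -!mulrA [n%:R `^ _ * _]mulrA -powRD ?subrK ?n0 ?implybT //.
have nR : n%:R = 2 * N%:R * xi%:R :> R by rewrite {1}nE -mul2n !natrM.
by rewrite powRr1 // nR mulfK //; ring.
Qed.

Lemma ensemble_mean_ge0 p :
  0 <= ensemble_mean N xi (erasure_choi_error (n := n) k xi p).
Proof.
rewrite /ensemble_mean /uniform_mean divr_ge0 // sumr_ge0 // => t _.
rewrite /erasure_choi_error /choi_error; set E := [set e | _].
(* [inf] takes the value 0 on the empty set, so no decoder has to be exhibited here. *)
have [E0|] := pselect (E !=set0); last by move/nonemptyPn => ->; rewrite inf0.
by apply: lb_le_inf => // _ [D _ ->]; exact: purified_distance_ge0.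
Qed.

Lemma ensemble_mean_le p : 0 < p < 1 -> rate <= 1 - log2 (1 + 3 * p) ->
  N%:R * mu <= 1 / 8 ->
  ensemble_mean N xi (erasure_choi_error (n := n) k xi p)
  <= (2 `^ (- (n%:R * (1 - log2 (1 + 3 * p) - rate)))
      + 4 * eps `^ (1 - rate) * n%:R `^ rate / log2 (n%:R / eps)) `^ (1 / 4).
Proof.
move=> /andP[p0 p1] rle Nmu; rewrite second_term -first_term // -sqrt_sqrt_powR.
  apply: ensemble_mean_bound => //; first by rewrite !ltW.
  exact: sg_mu_le1.
have mu0 : 0 <= mu by rewrite invr_ge0 exprn_ge0.
by rewrite addr_ge0 ?mulr_ge0 ?exprn_ge0 ?mulr_ge0 ?exprn_ge0 //; lra.
Qed.

End BlockedParameters.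

Lemma eventually_ensemble_mean_le p (k N xi : nat -> nat) (eps : nat -> R) :
  0 < p < 1 ->
  let adm := [set n : nat | blocked_params n (k n) (N n) (xi n) (eps n)] in
  let F := within adm \oo in
  let rate := fun n : nat => (k n)%:R / n%:R : R in
  (forall n : nat, adm n -> rate n <= 1 - log2 (1 + 3 * p)) ->
  (fun n : nat => (eps n / n%:R) `^ (1 - rate n) : R)
    =o_F (fun n : nat => n%:R^-1 : R) ->
  \forall n \near \oo, adm n ->
    ensemble_mean (n := n) (N n) (xi n)
      (erasure_choi_error (n := n) (k n) (xi n) p)
    <= (2 `^ (- (n%:R * (1 - log2 (1 + 3 * p) - rate n)))
        + 4 * eps n `^ (1 - rate n) * n%:R `^ rate n / log2 (n%:R / eps n))
       `^ (1 / 4).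
Proof.
move=> p01 adm F rate rle /eqoP small.
(* The threshold N mu <= 1/8 of the chain estimate; the o(1/n) condition gives n mu <= 1/8, and N <=
   n. *)
have e8 : 0 < 1 / 8 :> R by lra.
have := small _ e8; rewrite near_withinE; apply: filterS => n h an.
apply: (ensemble_mean_le an p01 (rle n an)).
have := h an; rewrite (mu_eps an) ger0_norm ?invr_ge0 ?exprn_ge0 // => hmu.
rewrite ger0_norm ?invr_ge0 // in hmu.
case: (an) => n0 nE _ _ _.
apply: (@le_trans _ _ (n%:R * 2 ^- (xi n - k n * xi n %/ n))); last first.
  by rewrite mulrC -ler_pdivlMr ?ltr0n.
rewrite ler_wpM2r ?invr_ge0 ?exprn_ge0 // ler_nat {2}nE.
have := xi_gt0 n0 nE; nia.
Qed.

(** Turns limits along the admissible sizes into ordinary limits in the stage index. *)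
Lemma cvg_within_subsequence (A : set nat) (m : nat -> nat) (u v : nat -> R) (l : R) :
  {homo m : s t / (s < t)%N} ->
  (forall n, A n -> exists2 t, n = m t & u n = v t) ->
  v t @[t --> \oo] --> l -> u n @[n --> within A \oo] --> l.
Proof.
move=> m_mono Am /cvgrPdist_lt vl; apply/cvgrPdist_lt => e e0.
rewrite near_withinE; have [T _ hT] := vl e e0.
exists (m T) => // n /= mn An; have [t nt ->] := Am n An.
apply: hT => /=; rewrite leqNgt; apply/negP => /m_mono.
by rewrite -nt ltnNge mn.
Qed.

Lemma infinite_range (A : set nat) (m : nat -> nat) :
  {homo m : s t / (s < t)%N} -> (forall t, A (m t)) -> infinite_set A.
Proof.
move=> m_mono Am finA; apply: infinite_nat.
have <- : m @^-1` A = [set: nat] by apply/seteqP; split=> // t _; exact: Am.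
apply: finite_preimage => // s t _ _ st.
by case: (ltngtP s t) => // /m_mono; rewrite st ltnn.
Qed.

(** * A family of codes reaching a given rate *)

Section Scheme.
Variables (p r : R).
Hypotheses (p01 : 0 < p < 1) (r0 : 0 < r) (rlt : r < 1 - log2 (1 + 3 * p)).
Variable M : nat.
Hypothesis M_large : 2 <= M%:R * (1 - log2 (1 + 3 * p) - r).

(** Stage [t] has 2^(t+1) pairs of regions of M (t+1) qubits. The block size is logarithmic in the
    length, and [M_large] gives mu <= 4^-(t+1), which outweighs the exponential number of blocks. *)
Let size_of t := (M * t.+1)%N.
Let len t := ((2 ^ t.+1).*2 * size_of t)%N.
Let log_of t := Num.truncn (r * (size_of t)%:R).
Let stage n := xget 0%N [set t | len t = n].
Let on_scheme n := `[< exists t, len t = n >].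

(** Admissible sizes are [len t]; for all other [n] the number of blocks is set to
    zero, which violates [blocked_params]. *)
Definition scheme_k n : nat := (log_of (stage n) * (2 ^ (stage n).+1).*2)%N.
Definition scheme_N n : nat := if on_scheme n then (2 ^ (stage n).+1)%N else 0%N.
Definition scheme_xi n : nat := size_of (stage n).
(** Solved from xi = log2 (n / eps), so that the block size is an integer by construction. *)
Definition scheme_eps n : R := n%:R * 2 `^ (- (scheme_xi n)%:R).

Let log2_ge0 : 0 <= log2 (1 + 3 * p).
Proof.
rewrite divr_ge0 ?(ltW ln2_gt0) // ln_ge0 //.
by case/andP: p01 => /ltW p0 _; rewrite lerDl mulr_ge0.
Qed.

Let M_gt0 : (0 < M)%N.
Proof. by rewrite lt0n; apply: contraTneq M_large => ->; rewrite mul0r -ltNge. Qed.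

Lemma len_mono : {homo len : s t / (s < t)%N}.
Proof.
move=> s t st; apply: ltn_mul; first by rewrite ltn_double ltn_exp2l.
by rewrite ltn_mul2l M_gt0.
Qed.

Lemma stageK t : stage (len t) = t.
Proof.
rewrite /stage; case: xgetP => [s _ /= st|/(_ t)/=]; last by [].
by case: (ltngtP s t) => // /len_mono; rewrite st ltnn.
Qed.

Let size_gt0 t : (0 < size_of t)%N. Proof. by rewrite muln_gt0 M_gt0. Qed.

Lemma scheme_admissible t :
  blocked_params (len t) (scheme_k (len t)) (scheme_N (len t)) (scheme_xi (len t))
    (scheme_eps (len t)).
Proof.
have on_t : on_scheme (len t) by apply/asboolP; exists t.
have len0 : (0 < len t)%N.
  by rewrite /len muln_gt0 double_gt0 expn_gt0 size_gt0.
rewrite /scheme_k /scheme_N /scheme_eps /scheme_xi on_t stageK; split=> //.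
- by rewrite mulr_gt0 ?powR_gt0 // ltr0n.
- by rewrite powRN invfM invrK mulrA divff ?mul1r ?log2_pow2 // pnatr_eq0 -lt0n.
split.
  rewrite /len mulnC leq_mul2l; apply/orP; right.
  rewrite -(ler_nat R); apply: le_trans (_ : r * (size_of t)%:R <= _).
    by rewrite truncn_le // mulr_ge0 // ltW.
  rewrite -[leRHS]mul1r ler_wpM2r // ltW // (lt_le_trans rlt) // gerBl.
  exact: log2_ge0.
by rewrite -mulnA dvdn_mull.
Qed.

Lemma admissibleP n :
  blocked_params n (scheme_k n) (scheme_N n) (scheme_xi n) (scheme_eps n) ->
  exists t, n = len t.
Proof.
case=> n0 nE _ _ _; move: nE n0; rewrite /scheme_N /on_scheme.
by case: asboolP => [[t <-] _ _|_ ->]; [exists t|rewrite mul0n].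
Qed.

Lemma scheme_rate t : (scheme_k (len t))%:R / (len t)%:R
  = (log_of t)%:R / (size_of t)%:R :> R.
Proof.
rewrite /scheme_k stageK /len mulnC !natrM -mulf_div divff ?mul1r //.
Qed.

Lemma scheme_rate_le t : (log_of t)%:R / (size_of t)%:R <= r.
Proof.
by rewrite ler_pdivrMr ?ltr0n // truncn_le // mulr_ge0 // ltW.
Qed.

(** Rounding down loses less than one logical qubit per region, and a region has at least t + 1
    qubits. *)
Lemma scheme_rate_ge t : r - t.+1%:R^-1 <= (log_of t)%:R / (size_of t)%:R.
Proof.
have s0 : 0 < (size_of t)%:R :> R by rewrite ltr0n.
apply: (@le_trans _ _ (r - (size_of t)%:R^-1)).
  rewrite lerD2l lerN2 lef_pV2 ?posrE ?ltr0n // ler_nat.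
  by rewrite /size_of leq_pmull.
rewrite ler_pdivlMr // mulrBl mulVf ?gt_eqF // lerBlDr.
have /truncn_itv/andP[_ h] : 0 <= r * (size_of t)%:R by rewrite mulr_ge0 // ltW.
by rewrite natr1 ltW.
Qed.

(** Both the first term and N mu are at most 2^-t, and 9 = 1 + 8 collects them; t >= 3 ensures N mu
    <= 1/8. *)
Lemma scheme_mean_le t : (3 <= t)%N ->
  ensemble_mean (n := len t) (scheme_N (len t)) (scheme_xi (len t))
    (erasure_choi_error (n := len t) (scheme_k (len t)) (scheme_xi (len t)) p)
  <= Num.sqrt (Num.sqrt (9 * 2^-1 ^+ t)).
Proof.
move=> t3; have adm := scheme_admissible t.
case/andP: (p01) => p0 p1.
have rate_r : (scheme_k (len t))%:R / (len t)%:R <= r.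
  by rewrite scheme_rate scheme_rate_le.
have rate_le : (scheme_k (len t))%:R / (len t)%:R <= 1 - log2 (1 + 3 * p).
  exact: le_trans rate_r (ltW rlt).
have xiE : scheme_xi (len t) = size_of t by rewrite /scheme_xi stageK.
have NE : scheme_N (len t) = (2 ^ t.+1)%N.
  rewrite /scheme_N stageK (_ : on_scheme _) //.
  by apply/asboolP; exists t.
have margin : 2 * t.+1%:R <= (size_of t)%:R * (1 - log2 (1 + 3 * p)
    - (scheme_k (len t))%:R / (len t)%:R).
  apply: (@le_trans _ _ ((size_of t)%:R * (1 - log2 (1 + 3 * p) - r))).
    by rewrite natrM mulrAC ler_wpM2r.
  by rewrite ler_wpM2l // lerD2l lerN2.
have pow_le (x : R) : t%:R <= x -> 2 `^ (- x) <= 2^-1 ^+ t.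
  move=> tx; rewrite powRN exprVn -powR_mulrn // lef_pV2 ?posrE ?powR_gt0 //.
  by rewrite ler_powR // ler1n.
have Nmu : (scheme_N (len t))%:R * 2 ^- (scheme_xi (len t)
    - scheme_k (len t) * scheme_xi (len t) %/ len t) <= 2^-1 ^+ t :> R.
  rewrite (muE adm) NE natrX -powR_mulrn // -pow2D xiE -[_ + _]opprK.
  apply: pow_le; have := log2_ge0; move: margin; rewrite -natr1.
  have := mulr_ge0 (ler0n R (size_of t)) log2_ge0.
  move: (log2 _) (_ / _) (size_of t)%:R => L q s; lra.
have first_le := first_term adm p0.
have [n0 nE e0 _ [kn dvdn]] := adm.
apply: le_trans (ensemble_mean_bound n0 nE kn dvdn _ _ _) _.
- by rewrite !ltW.
- exact: (sg_mu_le1 adm p0 rate_le).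
- apply: le_trans Nmu _.
  apply: le_trans (ler_wiXn2l _ _ t3) _; rewrite ?invr_ge0 ?invf_le1 ?ler1n //.
  by rewrite le_eqVlt; apply/orP; left; apply/eqP; field.
apply/ler_wsqrtr/ler_wsqrtr; rewrite first_le.
have -> : 9 * 2^-1 ^+ t = 2^-1 ^+ t + 8 * 2^-1 ^+ t :> R by ring.
rewrite lerD // -?mulrA ?ler_wpM2l //.
apply: pow_le; apply: (@le_trans _ _ (2 * t.+1%:R)); first by rewrite -natr1; have := ler0n R t; lra.
apply: le_trans margin _; apply: ler_wpM2r; first by rewrite subr_ge0.
by rewrite ler_nat leq_pmull // double_gt0 expn_gt0.
Qed.

Local Notation adm :=
  [set n : nat | blocked_params n (scheme_k n) (scheme_N n) (scheme_xi n) (scheme_eps n)].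

Lemma scheme_infinite : infinite_set adm.
Proof. exact: (infinite_range len_mono scheme_admissible). Qed.

Lemma cvg_scheme_rate : (scheme_k n)%:R / n%:R @[n --> within adm \oo] --> r.
Proof.
apply: (cvg_within_subsequence (v := fun t => (log_of t)%:R / (size_of t)%:R) len_mono).
  by move=> n /admissibleP[t ->]; exists t => //; exact: scheme_rate.
apply: (@squeeze_cvgr _ _ _ _ (fun t : nat => r - harmonic t) (cst r)).
- by near=> t; rewrite scheme_rate_ge scheme_rate_le.
- by rewrite -[X in _ --> X]subr0; apply: cvgB; [exact: cvg_cst|exact: cvg_harmonic].
- exact: cvg_cst.
Unshelve. all: by end_near. Qed.

Lemma scheme_depth n : adm n ->
  forall G : 'I_(scheme_N n).*2.-1 -> op R (bits (scheme_xi n).*2) (bits (scheme_xi n).*2),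
  (forall j, clifford (G j)) ->
  exists2 d : nat, d%:R <= (20 * M + 2)%:R * log2 (n%:R : R) & depth_at_most d (double_layer n G).
Proof.
move=> an G cG; exists (20 * scheme_xi n + 2)%N; last first.
  by case: an => n0 nE _ _ _; exact: double_layer_depth.
have [t nt] := admissibleP an; rewrite {1}/scheme_xi {1}nt stageK.
have logn : t.+1%:R <= log2 (n%:R : R).
  rewrite -[leLHS]log2_pow2 le_log2 ?powR_gt0 // powR_mulrn // -natrX ler_nat nt.
  by rewrite /len -addnn mulnDl -[leqLHS]addn0 leq_add // leq_pmulr.
apply: (@le_trans _ _ ((20 * M + 2)%:R * t.+1%:R)); last by rewrite ler_wpM2l.
rewrite -natrM ler_nat /size_of mulnDl mulnA leq_add2l.
by rewrite leq_pmulr.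
Qed.

Lemma cvg_scheme_mean :
  ensemble_mean (n := n) (scheme_N n) (scheme_xi n)
    (erasure_choi_error (n := n) (scheme_k n) (scheme_xi n) p)
  @[n --> within adm \oo] --> (0 : R).
Proof.
apply: (cvg_within_subsequence (v := fun t =>
  ensemble_mean (n := len t) (scheme_N (len t)) (scheme_xi (len t))
    (erasure_choi_error (n := len t) (scheme_k (len t)) (scheme_xi (len t)) p)) len_mono).
  by move=> n /admissibleP[t ->]; exists t.
apply: (@squeeze_cvgr _ _ _ _ (cst 0) (fun t : nat => Num.sqrt (Num.sqrt (9 * 2^-1 ^+ t)))).
- near=> t; rewrite scheme_mean_le ?andbT; last by near: t; exact: nbhs_infty_ge.
  exact: ensemble_mean_ge0.
- exact: cvg_cst.
- have h : 9 * 2^-1 ^+ t @[t --> \oo] --> (0 : R).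
    by apply: cvg_geometric; rewrite ger0_norm ?invr_ge0 // invf_lt1 ?ltr1n.
  rewrite -[X in _ --> X](@sqrtr0 R) -[X in Num.sqrt X](@sqrtr0 R).
  by do 2 apply: continuous_cvg; rewrite ?sqrtr0 //; exact: sqrt_continuous.
Unshelve. all: by end_near. Qed.

End Scheme.

End Asymptotics.

(** Limits run along the admissible sizes, and [infinite_set adm] ensures that they are not vacuous.
    The depth bound holds for every choice of Clifford gates, not merely on average. *)
Theorem corollary3 (R : realType) (p : R) (hp : 0 < p < 1) :
  (forall (k N xi : nat -> nat) (eps : nat -> R),
     let adm := [set n : nat | blocked_params n (k n) (N n) (xi n) (eps n)] in
     let F := within adm \oo in
     let rate := fun n : nat => (k n)%:R / n%:R : R in
     (forall n : nat, adm n -> rate n <= 1 - log2 (1 + 3 * p)) ->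
     (fun n : nat => (eps n / n%:R) `^ (1 - rate n) : R)
       =o_F (fun n : nat => n%:R^-1 : R) ->
     \forall n \near \oo, adm n ->
       ensemble_mean (n := n) (N n) (xi n)
         (erasure_choi_error (n := n) (k n) (xi n) p)
       <= (2 `^ (- (n%:R * (1 - log2 (1 + 3 * p) - rate n)))
           + 4 * eps n `^ (1 - rate n) * n%:R `^ rate n / log2 (n%:R / eps n))
          `^ (1 / 4))
  /\
  (forall r : R, 0 < r < 1 - log2 (1 + 3 * p) ->
     exists (k N xi : nat -> nat) (eps : nat -> R),
       let adm := [set n : nat | blocked_params n (k n) (N n) (xi n) (eps n)] in
       [/\ infinite_set adm,
           (k n)%:R / n%:R @[n --> within adm \oo] --> r,
           exists c : R, forall n : nat, adm n ->
             forall G : 'I_(N n).*2.-1 -> op R (bits (xi n).*2) (bits (xi n).*2),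
             (forall j, clifford (G j)) ->
             exists2 d : nat, d%:R <= c * log2 n%:R &
               depth_at_most d (double_layer n G)
         & ensemble_mean (n := n) (N n) (xi n)
             (erasure_choi_error (n := n) (k n) (xi n) p)
           @[n --> within adm \oo] --> (0 : R)]).
Proof.
split=> [k N xi eps|r /andP[r0 rlt]].
  exact: eventually_ensemble_mean_le.
have margin : 0 < 1 - log2 (1 + 3 * p) - r by rewrite subr_gt0.
pose M := (Num.truncn (2 / (1 - log2 (1 + 3 * p) - r))).+1.
have M_large : 2 <= M%:R * (1 - log2 (1 + 3 * p) - r).
  by rewrite -ler_pdivrMr // ltW // truncnS_gt.
exists (scheme_k r M), (scheme_N M), (scheme_xi M), (scheme_eps R M) => adm; split.
- exact: (scheme_infinite hp r0 rlt M_large).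
- exact: (cvg_scheme_rate r0 M_large).
- by exists (20 * M + 2)%:R => n an G; exact: (scheme_depth M_large an).
- exact: (cvg_scheme_mean hp r0 rlt M_large).
Qed.
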